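(* Every unital one-dimensional NCCW complex has property (H).
   Context: Homomorphisms between $\mathrm{C}^*$-algebras are $*$-homomorphisms, not assumed unital. A unital one-dimensional NCCW complex is a unital $\mathrm{C}^*$-algebra of the form $$A(F_1,F_2,\varphi_0,\varphi_1)=\{(f,a)\in C([0,1],F_2)\oplus F_1:\ f(0)=\varphi_0(a),\ f(1)=\varphi_1(a)\},$$ where $F_1,F_2$ are finite dimensional $\mathrm{C}^*$-algebras and $\varphi_0,\varphi_1:F_1\to F_2$ are homomorphisms. A $\mathrm{C}^*$-algebra $A$ has property (H) if, for any finite subset $F\subset A$ and any $\varepsilon>0$, there exist (for some integer $r$) a homomorphism $\rho:A\to M_{r-1}(A)$ and a homomorphism $\mu:A\to M_r(A)$ with finite dimensional image such that $$\|f\oplus\rho(f)-\mu(f)\|<\varepsilon\quad\text{for all } f\in F,$$ where $f\oplus\rho(f)$ denotes the block diagonal element of $M_r(A)$. *)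

(* Defs.v *)
From HB Require Import structures.
From mathcomp Require Import all_boot all_order all_algebra.
From mathcomp Require Import complex lra.
From mathcomp Require Import all_classical all_reals.
From mathcomp Require Import ereal topology normedtype derive.

Set Implicit Arguments.
Unset Strict Implicit.
Unset Printing Implicit Defensive.

Import Order.TTheory GRing.Theory Num.Theory.
Import numFieldNormedType.Exports.

Local Open Scope classical_set_scope.
Local Open Scope complex_scope.
Local Open Scope ring_scope.

Reserved Notation "x ** y" (at level 40, left associativity).
Reserved Notation "{ 'starhom' A -> B }"
  (at level 0, A at level 98, B at level 99, format "{ 'starhom'  A  ->  B }").

(* Algebras need not have a unit and homomorphisms need not preserve it, so
   the unital ring structures of the library do not apply. *)
HB.mixin Record Lmodule_isStarAlgebra (C : numClosedFieldType) A
    & GRing.Lmodule C A := {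
  star_mul : A -> A -> A;
  star : A -> A;
  star_mulA : associative star_mul;
  star_mulDl : left_distributive star_mul +%R;
  star_mulDr : right_distributive star_mul +%R;
  star_mulZl : forall (c : C) x y, star_mul (c *: x) y = c *: star_mul x y;
  star_mulZr : forall (c : C) x y, star_mul x (c *: y) = c *: star_mul x y;
  starD : {morph star : x y / x + y};
  starZ : forall (c : C) x, star (c *: x) = Num.conj c *: star x;
  starM : forall x y, star (star_mul x y) = star_mul (star y) (star x);
  starK : involutive star
}.

#[short(type="starAlgType")]
HB.structure Definition StarAlgebra (C : numClosedFieldType) :=
  {A of GRing.Lmodule C A & Lmodule_isStarAlgebra C A}.

Notation "x ** y" := (star_mul x y) : ring_scope.

HB.mixin Record isStarMorphism (C : numClosedFieldType) (A B : starAlgType C)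
    (f : A -> B) := {
  starhomM : {morph f : x y / x ** y};
  starhom_star : {morph f : x / star x}
}.

HB.structure Definition StarMorphism (C : numClosedFieldType)
    (A B : starAlgType C) :=
  {f of @GRing.Linear C A B *:%R f & isStarMorphism C A B f}.

Notation "{ 'starhom' A -> B }" := (StarMorphism.type A%type B%type)
  : type_scope.

Definition unital (C : numClosedFieldType) (A : starAlgType C) : Prop :=
  exists e : A, forall x, e ** x = x /\ x ** e = x.

Definition finite_dim (C : numClosedFieldType) (V : lmodType C) (S : set V) :
    Prop :=
  exists n (e : 'I_n -> V),
    S = [set v | exists c : 'I_n -> C, v = \sum_i c i *: e i].

Definition matrix_alg (C : numClosedFieldType) (A : starAlgType C) (n : nat) :
  Type := 'M[A]_n.

Section MatrixAlg.
Context (C : numClosedFieldType) (A : starAlgType C) (n : nat).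
Implicit Types (x y : matrix_alg A n).

HB.instance Definition _ := GRing.Zmodule.copy (matrix_alg A n) 'M[A]_n.

Definition matrix_scale (c : C) (x : matrix_alg A n) : matrix_alg A n :=
  \matrix_(i, j) (c *: x i j).

Definition matrix_mul (x y : matrix_alg A n) : matrix_alg A n :=
  \matrix_(i, j) \sum_k x i k ** y k j.

Definition matrix_star (x : matrix_alg A n) : matrix_alg A n :=
  \matrix_(i, j) star (x j i).

Let scaleA a b x : matrix_scale a (matrix_scale b x) = matrix_scale (a * b) x.
Proof. by apply/matrixP => i j; rewrite !mxE scalerA. Qed.

Let scale1 : left_id 1 matrix_scale.
Proof. by move=> x; apply/matrixP => i j; rewrite !mxE scale1r. Qed.

Let scaleDr : right_distributive matrix_scale +%R.
Proof. by move=> a x y; apply/matrixP => i j; rewrite !mxE scalerDr. Qed.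

Let scaleDl x : {morph matrix_scale^~ x : a b / a + b}.
Proof. by move=> a b; apply/matrixP => i j; rewrite !mxE scalerDl. Qed.

HB.instance Definition _ := GRing.Zmodule_isLmodule.Build C (matrix_alg A n)
  scaleA scale1 scaleDr scaleDl.

Let mul_suml (I : finType) (F : I -> A) (z : A) :
  (\sum_i F i) ** z = \sum_i (F i ** z).
Proof.
have mul0 : 0 ** z = 0 by rewrite -[X in X ** z](scale0r 0) star_mulZl scale0r.
by apply: (big_morph (fun t => t ** z)) => // a b; rewrite star_mulDl.
Qed.

Let mul_sumr (I : finType) (F : I -> A) (z : A) :
  z ** (\sum_i F i) = \sum_i (z ** F i).
Proof.
have mul0 : z ** 0 = 0 by rewrite -[X in z ** X](scale0r 0) star_mulZr scale0r.
by apply: (big_morph (fun t => z ** t)) => // a b; rewrite star_mulDr.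
Qed.

Let star_sum (I : finType) (F : I -> A) :
  star (\sum_i F i) = \sum_i star (F i).
Proof.
have star0 : star (0 : A) = 0.
  by rewrite -[X in star X](scale0r 0) starZ rmorph0 scale0r.
by apply: (big_morph (@star C A)) => // a b; rewrite starD.
Qed.

Let mulA : associative matrix_mul.
Proof.
move=> x y z; apply/matrixP => i j; rewrite !mxE.
under eq_bigr do rewrite mxE mul_sumr.
rewrite exchange_big /=; apply: eq_bigr => k _.
by rewrite mxE mul_suml; apply: eq_bigr => l _; rewrite star_mulA.
Qed.

Let mulDl : left_distributive matrix_mul +%R.
Proof.
move=> x y z; apply/matrixP => i j; rewrite !mxE -big_split.
by apply: eq_bigr => k _; rewrite mxE star_mulDl.
Qed.

Let mulDr : right_distributive matrix_mul +%R.
Proof.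
move=> x y z; apply/matrixP => i j; rewrite !mxE -big_split.
by apply: eq_bigr => k _; rewrite mxE star_mulDr.
Qed.

Let mulZl (c : C) x y : matrix_mul (c *: x) y = c *: matrix_mul x y.
Proof.
apply/matrixP => i j; rewrite !mxE scaler_sumr.
by apply: eq_bigr => k _; rewrite mxE star_mulZl.
Qed.

Let mulZr (c : C) x y : matrix_mul x (c *: y) = c *: matrix_mul x y.
Proof.
apply/matrixP => i j; rewrite !mxE scaler_sumr.
by apply: eq_bigr => k _; rewrite mxE star_mulZr.
Qed.

Let mstarD : {morph matrix_star : x y / x + y}.
Proof. by move=> x y; apply/matrixP => i j; rewrite !mxE starD. Qed.

Let mstarZ (c : C) x : matrix_star (c *: x) = Num.conj c *: matrix_star x.
Proof. by apply/matrixP => i j; rewrite !mxE starZ. Qed.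

Let mstarM x y :
  matrix_star (matrix_mul x y) = matrix_mul (matrix_star y) (matrix_star x).
Proof.
apply/matrixP => i j; rewrite !mxE star_sum.
by apply: eq_bigr => k _; rewrite !mxE starM.
Qed.

Let mstarK : involutive matrix_star.
Proof. by move=> x; apply/matrixP => i j; rewrite !mxE starK. Qed.

HB.instance Definition _ := Lmodule_isStarAlgebra.Build C (matrix_alg A n)
  mulA mulDl mulDr mulZl mulZr mstarD mstarZ mstarM mstarK.

End MatrixAlg.

HB.mixin Record StarAlgebra_isCStarAlgebra (R : realType) A
    & CompleteNormedModule R[i] A & StarAlgebra R[i] A := {
  ler_norm_star_mul : forall x y : A, `|x ** y| <= `|x| * `|y|;
  norm_cstar : forall x : A, `|star x ** x| = `|x| ^+ 2
}.

#[short(type="cstarAlgType")]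
HB.structure Definition CStarAlgebra (R : realType) :=
  {A of CompleteNormedModule R[i] A & StarAlgebra R[i] A
   & StarAlgebra_isCStarAlgebra R A}.

HB.mixin Record CStarAlgebra_isFinDim (R : realType) A & CStarAlgebra R A := {
  finite_dimT : finite_dim [set: A]
}.

#[short(type="finCStarAlgType")]
HB.structure Definition FinCStarAlgebra (R : realType) :=
  {A of CStarAlgebra R A & CStarAlgebra_isFinDim R A}.

(* The norm of a complex normed module takes its values in R[i]; [rnorm x] is
   the same norm as an element of R. *)
Definition rnorm (R : realType) (V : normedModType R[i]) (x : V) : R :=
  complex.Re `|x|.

Section RealNorm.
Context (R : realType) (V : normedModType R[i]).
Implicit Types x y : V.

Lemma rnormE x : `|x| = (rnorm x)%:C.
Proof. by rewrite /rnorm RRe_real// normr_real. Qed.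

Lemma rnorm_ge0 x : 0 <= rnorm x.
Proof. by rewrite -ler0c -rnormE. Qed.

Lemma ler_rnormD x y : rnorm (x + y) <= rnorm x + rnorm y.
Proof. by rewrite -lecR rmorphD/= -!rnormE ler_normD. Qed.

Lemma rnormN x : rnorm (- x) = rnorm x.
Proof. by rewrite /rnorm normrN. Qed.

Lemma rnorm0 : rnorm (0 : V) = 0.
Proof. by rewrite /rnorm normr0. Qed.

Lemma rnorm_eq0 x : (rnorm x == 0) = (x == 0).
Proof. by rewrite -[RHS]normr_eq0 rnormE -(inj_eq (@complexI _)). Qed.

Lemma rnormZ (c : R[i]) x : rnorm (c *: x) = complex.Re `|c| * rnorm x.
Proof.
apply: (@complexI R); rewrite rmorphM/= RRe_real ?normr_real//.
by rewrite -!rnormE normrZ.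
Qed.

Lemma ler_rnorm_sum (I : finType) (F : I -> V) :
  rnorm (\sum_i F i) <= \sum_i rnorm (F i).
Proof.
elim/big_ind2: _ => [|x a y b xa yb|//]; first by rewrite rnorm0.
exact: le_trans (ler_rnormD _ _) (lerD xa yb).
Qed.

Lemma ler_rnormB x y : `|rnorm x - rnorm y| <= rnorm (x - y).
Proof.
rewrite ler_norml; apply/andP; split.
  rewrite lerNl opprB lerBlDr -(rnormN (x - y)) opprB.
  by rewrite -[X in rnorm X <= _](subrK x y) ler_rnormD.
by rewrite lerBlDr -[X in rnorm X <= _](subrK y x) ler_rnormD.
Qed.

Lemma gt0_complexE (e : R[i]) : 0 < e -> exists2 r : R, 0 < r & e = r%:C.
Proof.
move=> e0; exists (complex.Re e); last by rewrite RRe_real ?gtr0_real.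
by rewrite -ltcR RRe_real ?gtr0_real.
Qed.

Lemma rnorm_continuous : continuous (@rnorm R V).
Proof.
move=> x; apply/cvgrPdist_lt => e e0.
have e0' : 0 < e%:C :> R[i] by rewrite ltcR.
have /cvgrPdist_lt/(_ _ e0') := @cvg_id _ (nbhs x).
apply: filterS => y /=. rewrite (rnormE (x - y)) ltcR.
exact/le_lt_trans/ler_rnormB.
Qed.

End RealNorm.

Lemma complex_mk_continuous (R : realType) :
  continuous (fun z : R * R => z.1 +i* z.2 : R[i]^o).
Proof.
move=> [x y]; apply/cvgrPdist_lt => e /gt0_complexE[r r0 ->].
have r20 : 0 < r / 2 by rewrite divr_gt0.
have nC (t : R) : `|t%:C| = `|t|%:C :> R[i].
  by rewrite normc_def/= expr0n addr0 sqrtr_sqr.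
exists (ball x (r / 2), ball y (r / 2)) => /=.
  by split; exact: nbhsx_ballx.
move=> [a b] [] /=; rewrite -!ball_normE/= => xa yb.
have -> : (x +i* y) - (a +i* b) = (x - a)%:C + 'i%C * (y - b)%:C :> R[i].
  by apply/eqP; rewrite eq_complex/= !(mul0r, mul1r, mulr0, addr0, subr0, add0r) !eqxx.
rewrite (le_lt_trans (ler_normD _ _))// normrM.
have -> : `|'i%C : R[i]| = 1 by rewrite normc_def/= expr0n expr1n add0r sqrtr1.
by rewrite mul1r !nC -rmorphD/= ltcR (splitr r) ltrD.
Qed.

Lemma unit_disc_compact (R : realType) :
  exists2 K : set R[i]^o, compact K & forall z : R[i], `|z| <= 1 -> K z.
Proof.
exists ((fun z : R * R => z.1 +i* z.2 : R[i]^o) @` (`[-1, 1] `*` `[-1, 1])).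
  apply: continuous_compact.
    by apply: continuous_subspaceT; exact: complex_mk_continuous.
  by apply: compact_setX; exact: segment_compact.
move=> [a b] z1; exists (a, b) => //=.
have : (a ^+ 2 + b ^+ 2) <= 1.
  move: z1; rewrite normc_def/= lecR => z1.
  by rewrite -[leRHS]sqrtr1 ler_sqrt in z1.
by move=> h; split; rewrite /= in_itv/=; apply/andP; split; nra.
Qed.

Lemma finite_dim_free (C : numClosedFieldType) (V : lmodType C) :
  finite_dim [set: V] -> exists n (e : 'I_n -> V),
    (forall v, exists c : 'I_n -> C, v = \sum_i c i *: e i) /\
    (forall c : 'I_n -> C, \sum_i c i *: e i = 0 -> forall i, c i = 0).
Proof.
pose P n := `[< exists e : 'I_n -> V,
  forall v, exists c : 'I_n -> C, v = \sum_i c i *: e i >].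
move=> [n0 [e0 e0E]].
have exP : exists n, P n.
  exists n0; apply/asboolP; exists e0 => v.
  by have : [set: V] v by []; rewrite e0E.
case: (ex_minnP exP) => -[|n] /asboolP[e spe] mine; exists _, e; split => //.
  by move=> c _ [].
move=> c ce i; apply/eqP; apply: contraT => ci0.
suff : P n by move=> /mine; rewrite ltnn.
apply/asboolP; exists (fun j => e (lift i j)) => v.
have ei : e i = \sum_(j < n) (- (c i)^-1 * c (lift i j)) *: e (lift i j).
  move: ce; rewrite (bigD1_ord i)//= => /eqP; rewrite addr_eq0 => /eqP/esym cei.
  transitivity ((c i)^-1 *: (c i *: e i)).
    by rewrite scalerA mulVf// scale1r.
  rewrite -cei scalerN -scaleNr scaler_sumr.
  by apply: eq_bigr => j _; rewrite scalerA.
have [d ->] := spe v.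
exists (fun j => d (lift i j) - d i * (c i)^-1 * c (lift i j)).
rewrite (bigD1_ord i)//= ei scaler_sumr -big_split/=; apply: eq_bigr => j _.
by rewrite scalerA -scalerDl mulNr mulrN mulrA addrC.
Qed.

Section FinDimContinuous.
Context (R : realType) (V W : normedModType R[i]).
Context (finV : finite_dim [set: V]).

Let absC (z : R[i]) : R := complex.Re `|z|.

Let absCE (z : R[i]) : (absC z)%:C = `|z|.
Proof. by rewrite /absC RRe_real// normr_real. Qed.

Lemma finite_dim_continuous (f : {linear V -> W}) : continuous f.
Proof.
have [n [e [spe fre]]] := finite_dim_free finV.
have [K cK Kdisc] := unit_disc_compact R.
pose comb (c : 'rV[R[i]^o]_n) : V := \sum_i c 0 i *: e i.
have comb_cont : continuous comb.
  move=> c; have Fc : Filter (nbhs c) by exact: nbhs_filter.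
  suff : \sum_(i < n) d 0 i *: e i @[d --> c] --> \sum_(i < n) c 0 i *: e i by [].
  refine (@cvg_big V 'I_n +%R 0 xpredT (@add_continuous V) 'rV[R[i]^o]_n (nbhs c) (index_enum 'I_n)
    (fun i (d : 'rV[R[i]^o]_n) => d 0 i *: e i) (fun i => c 0 i *: e i) Fc _).
  move=> i _.
  by apply: cvgZr_tmp; exact: (@coord_continuous R[i]).
have low i : exists2 m : R, 0 < m & forall c : 'rV[R[i]^o]_n,
    c 0 i = 1 -> (forall j, `|c 0 j| <= 1) -> m <= rnorm (comb c).
  pose A (j : 'I_n) : set R[i]^o := if j == i then [set 1] else K.
  pose S := [set c : 'rV[R[i]^o]_n | forall j, A j (c 0 j)].
  have cS : compact S.
    apply: rV_compact => j; rewrite /A; case: ifP => // _; exact: compact_set1.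
  have [c0 c0S c0min] : exists2 c, c \in S &
      forall t, t \in S -> rnorm (comb c) <= rnorm (comb t).
    apply: compact_EVT_min => //.
      exists (const_mx 1) => j; rewrite mxE /A; case: ifP => // _.
      by apply: Kdisc; rewrite normr1.
    apply: continuous_subspaceT => c; apply: continuous_comp.
      exact: comb_cont.
    exact: rnorm_continuous.
  exists (rnorm (comb c0)).
    rewrite lt_neqAle rnorm_ge0 andbT eq_sym rnorm_eq0; apply/eqP => /fre.
    move=> /(_ i) ci0; move: c0S; rewrite inE => /(_ i).
    by rewrite /A eqxx/= ci0 => /esym/eqP; rewrite oner_eq0.
  move=> c ci1 c1; apply: c0min; rewrite inE => j; rewrite /A.
  by case: eqP => [->//|_]; apply: Kdisc.
have [m m0 mP] : exists2 m : 'I_n -> R, (forall i, 0 < m i) &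
    forall i (c : 'rV[R[i]^o]_n), c 0 i = 1 -> (forall j, `|c 0 j| <= 1) ->
      m i <= rnorm (comb c).
  have /choice[m mP] : forall i, exists m : R, 0 < m /\
    forall c : 'rV[R[i]^o]_n, c 0 i = 1 -> (forall j, `|c 0 j| <= 1) ->
      m <= rnorm (comb c) by move=> i; have [m ? ?] := low i; exists m.
  by exists m => i; have [] := mP i.
pose L := \sum_j rnorm (f (e j)).
pose B := \sum_i L / m i.
have L0 : 0 <= L by apply: sumr_ge0 => j _; exact: rnorm_ge0.
have fB v : rnorm (f v) <= B * rnorm v.
  have [d dE] := spe v.
  have [->|v0] := eqVneq v 0; first by rewrite linear0 !rnorm0 mulr0.
  have [i0 _] : exists i0 : 'I_n, true.
    apply/not_existsP => no; move: v0; rewrite dE big1 ?eqxx// => i _.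
    by have := no i.
  pose i := [arg max_(i > i0) absC (d i)]%O.
  have imax j : absC (d j) <= absC (d i).
    by rewrite /i; case: arg_maxP => // k _ /(_ j); exact.
  have di0 : d i != 0.
    apply/eqP => di0; move: v0; rewrite dE big1 ?eqxx// => j _.
    suff -> : d j = 0 by rewrite scale0r.
    apply/eqP; rewrite -normr_le0 -absCE -(rmorph0 (real_complex R)) lecR.
    by rewrite (le_trans (imax j))// di0 /absC normr0.
  have ai0 : 0 < absC (d i) by rewrite -ltcR absCE normr_gt0.
  have mv : m i * absC (d i) <= rnorm v.
    rewrite -ler_pdivlMr//.
    pose c : 'rV[R[i]^o]_n := \row_j (d j / d i).
    have -> : rnorm v / absC (d i) = rnorm (comb c).
      have -> : comb c = (d i)^-1 *: v.
        rewrite dE scaler_sumr; apply: eq_bigr => j _.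
        by rewrite mxE scalerA mulrC.
      rewrite rnormZ mulrC; congr (_ * _); apply: (@complexI R).
      by rewrite RRe_real ?normr_real// fmorphV/= absCE normfV.
    apply: mP; first by rewrite mxE divff.
    by move=> j; rewrite mxE normrM normfV ler_pdivrMr ?normr_gt0// mul1r
      -!absCE lecR.
  have -> : f v = \sum_j d j *: f (e j).
    by rewrite dE linear_sum; apply: eq_bigr => j _; rewrite linearZ.
  apply: (@le_trans _ _ (absC (d i) * L)).
    rewrite (le_trans (ler_rnorm_sum _))// mulr_sumr ler_sum// => j _.
    by rewrite rnormZ ler_wpM2r ?rnorm_ge0// imax.
  apply: (@le_trans _ _ (L / m i * rnorm v)).
    by rewrite mulrAC -mulrA mulrC ler_wpM2l// ler_pdivlMr// mulrC.
  rewrite ler_wpM2r ?rnorm_ge0// /B (bigD1 i)//= lerDl.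
  by apply: sumr_ge0 => j _; rewrite divr_ge0// ltW.
have B0 : 0 <= B by apply: sumr_ge0 => j _; rewrite divr_ge0// ltW.
move=> x; apply/cvgrPdist_lt => eps /gt0_complexE[r r0 ->].
have B1 : 0 < B + 1 by rewrite ltr_wpDl.
have rB : 0 < (r / (B + 1))%:C :> R[i] by rewrite ltcR divr_gt0.
have /cvgrPdist_lt/(_ _ rB) := @cvg_id _ (nbhs x).
apply: filterS => y /=; rewrite (rnormE (x - y)) ltcR ltr_pdivlMr// => xy.
rewrite -linearB rnormE ltcR (le_lt_trans (fB _))// (le_lt_trans _ xy)//.
by rewrite mulrC ler_wpM2l ?rnorm_ge0// lerDl.
Qed.

End FinDimContinuous.

Section CStarTheory.
Context (R : realType) (A : cstarAlgType R).
Implicit Types x y : A.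

Lemma ler_rnorm_mul x y : rnorm (x ** y) <= rnorm x * rnorm y.
Proof. by rewrite -lecR rmorphM/= -!rnormE ler_norm_star_mul. Qed.

Lemma rnorm_cstar x : rnorm (star x ** x) = rnorm x ^+ 2.
Proof. by apply: (@complexI R); rewrite rmorphXn/= -!rnormE norm_cstar. Qed.

Lemma rnorm_star x : rnorm (star x) = rnorm x.
Proof.
have le_star y : rnorm y <= rnorm (star y).
  have [->|y0] := eqVneq (rnorm y) 0; first exact: rnorm_ge0.
  have {}y0 : 0 < rnorm y by rewrite lt_neqAle eq_sym y0 rnorm_ge0.
  by rewrite -(ler_pM2r y0) -expr2 -rnorm_cstar ler_rnorm_mul.
by apply/eqP; rewrite eq_le le_star andbT (le_trans (le_star _))// starK.
Qed.

Lemma starB x y : star (x - y) = star x - star y.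
Proof. by rewrite -scaleN1r starD starZ rmorphN rmorph1 scaleN1r. Qed.

Lemma star_mulBl x y z : (x - y) ** z = x ** z - y ** z.
Proof. by rewrite -scaleN1r star_mulDl star_mulZl scaleN1r. Qed.

Lemma star_mulBr x y z : z ** (x - y) = z ** x - z ** y.
Proof. by rewrite -scaleN1r star_mulDr star_mulZr scaleN1r. Qed.

End CStarTheory.

Lemma cvg_rnormP (R : realType) (V : normedModType R[i]) (T : Type)
    (F : set_system T) (FF : Filter F) (f : T -> V) (a : V) :
  (f @ F --> a) <-> (rnorm (a - f x) @[x --> F] --> (0 : R)).
Proof.
split=> [/cvgrPdist_lt fa|/cvgrPdist_lt fa]; apply/cvgrPdist_lt.
  move=> e e0; have e0' : 0 < e%:C :> R[i] by rewrite ltcR.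
  apply: filterS (fa _ e0') => x; rewrite sub0r normrN rnormE ltcR.
  by rewrite (ger0_norm (rnorm_ge0 _)).
move=> e /gt0_complexE[r r0 ->]; apply: filterS (fa _ r0) => x.
by rewrite sub0r normrN rnormE ltcR (ger0_norm (rnorm_ge0 _)).
Qed.

Section CStarContinuous.
Context (R : realType) (A : cstarAlgType R) (T : topologicalType).
Implicit Types f g : T -> A.

Lemma star_mul_continuous f g :
  continuous f -> continuous g -> continuous (fun t => f t ** g t).
Proof.
move=> cf cg t; apply/cvg_rnormP.
have /cvg_rnormP cf0 := cf t; have /cvg_rnormP cg0 := cg t.
have cfn : rnorm (f s) @[s --> t] --> rnorm (f t).
  by apply: continuous_comp; [exact: cf|exact: rnorm_continuous].
have bnd : rnorm (f t - f s) * rnorm (g t) + rnorm (f s) * rnorm (g t - g s)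
    @[s --> t] --> 0.
  have -> : 0 = 0 * rnorm (g t) + rnorm (f t) * 0 by rewrite mul0r mulr0 addr0.
  by apply: cvgD; apply: cvgM => //; apply: cvg_cst.
apply: (@squeeze_cvgr _ _ _ _ (fun=> 0) _ _ _ 0 _ bnd); last exact: cvg_cst.
near=> s; rewrite rnorm_ge0/=.
have -> : f t ** g t - f s ** g s =
    (f t - f s) ** g t + f s ** (g t - g s).
  by rewrite star_mulBl star_mulBr addrA subrK.
by rewrite (le_trans (ler_rnormD _ _))// lerD// ler_rnorm_mul.
Unshelve. all: by end_near. Qed.

Lemma star_continuous f : continuous f -> continuous (fun t => star (f t)).
Proof.
move=> cf t; apply/cvg_rnormP; have /cvg_rnormP := cf t.
by under eq_fun do rewrite -rnorm_star starB.
Qed.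

End CStarContinuous.

Definition unit_itv (R : realType) : set R := `[0, 1].
Arguments unit_itv R : clear implicits.

Lemma unit_itv0 (R : realType) : (0 : R) \in unit_itv R.
Proof. by rewrite inE /unit_itv/= in_itv/= lexx ler01. Qed.

Lemma unit_itv1 (R : realType) : (1 : R) \in unit_itv R.
Proof. by rewrite inE /unit_itv/= in_itv/= lexx ler01. Qed.

Definition itv_left (R : realType) : unit_itv R := SigSub (unit_itv0 R).

Definition itv_right (R : realType) : unit_itv R := SigSub (unit_itv1 R).

Lemma unit_itv_bounded (R : realType) (f : unit_itv R -> R) :
  continuous f -> has_ubound (range f).
Proof.
move=> /subspace_valL_continuousP cf.
have [c _ cmax] := EVT_max ler01 cf.
exists (valL f c) => _ [t _ <-].
have -> : f t = valL f (set_val t) by rewrite -{1}(valLK point f).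
by apply: cmax; case: t => t tI; exact: (set_mem tI).
Qed.

Section NCCW.
Context (R : realType) (F1 F2 : finCStarAlgType R).
Context (phi0 phi1 : {starhom F1 -> F2}).
Local Notation I := (unit_itv R).
Local Notation pairs := ((I -> F2) * F1)%type.

Definition nccw_pred : {pred pairs} := fun p =>
  `[< [/\ continuous p.1, p.1 (itv_left R) = phi0 p.2
        & p.1 (itv_right R) = phi1 p.2] >].

Lemma nccw_predP (p : pairs) :
  reflect [/\ continuous p.1, p.1 (itv_left R) = phi0 p.2
            & p.1 (itv_right R) = phi1 p.2] (p \in nccw_pred).
Proof. exact: asboolP. Qed.

Lemma nccw_submod : submod_closed nccw_pred.
Proof.
split=> [|c p q /nccw_predP[cp p0 p1] /nccw_predP[cq q0 q1]].
  by apply/nccw_predP; split => /=; rewrite ?linear0//; exact: cst_continuous.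
apply/nccw_predP; split; rewrite ?linearP/= -?p0 -?p1 -?q0 -?q1//.
move=> t; suff : c *: p.1 s + q.1 s @[s --> t] --> c *: p.1 t + q.1 t by [].
have Ft : Filter (nbhs t) by exact: nbhs_filter.
have cc : (fun=> c : R[i]^o) s @[s --> t] --> (c : R[i]^o) by exact: cvg_cst.
by apply: cvgD; [exact: (@cvgZ _ F2 _ _ Ft _ _ _ _ cc (cp t))|exact: cq].
Qed.

HB.instance Definition _ :=
  GRing.isSubmodClosed.Build R[i] pairs nccw_pred nccw_submod.

(* The algebra A(F1, F2, phi0, phi1); it is complete because phi0 and phi1 are
   continuous, F1 being finite dimensional. *)
Record nccw := Nccw { nccw_val :> pairs; nccw_valP : nccw_val \in nccw_pred }.

HB.instance Definition _ := [isSub for nccw_val].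
HB.instance Definition _ := [Choice of nccw by <:].
HB.instance Definition _ := [SubChoice_isSubLmodule of nccw by <:].

Implicit Types x y : nccw.

Lemma nccw_continuous x : continuous (nccw_val x).1.
Proof. by have /nccw_predP[] := nccw_valP x. Qed.

Lemma nccw_left x : (nccw_val x).1 (itv_left R) = phi0 (nccw_val x).2.
Proof. by have /nccw_predP[] := nccw_valP x. Qed.

Lemma nccw_right x : (nccw_val x).1 (itv_right R) = phi1 (nccw_val x).2.
Proof. by have /nccw_predP[] := nccw_valP x. Qed.

Lemma nccw_eq x y :
  (forall t, (nccw_val x).1 t = (nccw_val y).1 t) ->
  (nccw_val x).2 = (nccw_val y).2 -> x = y.
Proof.
move=> xy1 xy2; apply: val_inj => /=.
rewrite [nccw_val x]surjective_pairing [nccw_val y]surjective_pairing xy2.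
by congr pair; apply/funext.
Qed.

Lemma nccw_valD x y : nccw_val (x + y) = nccw_val x + nccw_val y.
Proof. exact: (raddfD val). Qed.

Lemma nccw_valB x y : nccw_val (x - y) = nccw_val x - nccw_val y.
Proof. exact: (raddfB val). Qed.

Lemma nccw_valZ (c : R[i]) x : nccw_val (c *: x) = c *: nccw_val x.
Proof. exact: (linearZZ val). Qed.

Lemma nccw_mul_subproof x y :
  ((fun t => (nccw_val x).1 t ** (nccw_val y).1 t,
    (nccw_val x).2 ** (nccw_val y).2) : pairs) \in nccw_pred.
Proof.
apply/nccw_predP; split => /=; last 2 first.
- by rewrite !nccw_left -starhomM.
- by rewrite !nccw_right -starhomM.
by apply: star_mul_continuous; exact: nccw_continuous.
Qed.

Definition nccw_mul x y : nccw := Nccw (nccw_mul_subproof x y).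

Lemma nccw_star_subproof x :
  ((fun t => star ((nccw_val x).1 t), star (nccw_val x).2) : pairs)
    \in nccw_pred.
Proof.
apply/nccw_predP; split => /=; last 2 first.
- by rewrite !nccw_left -starhom_star.
- by rewrite !nccw_right -starhom_star.
by apply: star_continuous; exact: nccw_continuous.
Qed.

Definition nccw_star x : nccw := Nccw (nccw_star_subproof x).

Let mulA : associative nccw_mul.
Proof. by move=> x y z; apply: nccw_eq => [t|] /=; rewrite star_mulA. Qed.

Let mulDl : left_distributive nccw_mul +%R.
Proof. by move=> x y z; apply: nccw_eq => [t|]; exact: star_mulDl. Qed.

Let mulDr : right_distributive nccw_mul +%R.
Proof. by move=> x y z; apply: nccw_eq => [t|]; exact: star_mulDr. Qed.

Let mulZl (c : R[i]) x y : nccw_mul (c *: x) y = c *: nccw_mul x y.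
Proof. by apply: nccw_eq => [t|]; exact: star_mulZl. Qed.

Let mulZr (c : R[i]) x y : nccw_mul x (c *: y) = c *: nccw_mul x y.
Proof. by apply: nccw_eq => [t|]; exact: star_mulZr. Qed.

Let nstarD : {morph nccw_star : x y / x + y}.
Proof. by move=> x y; apply: nccw_eq => [t|]; exact: starD. Qed.

Let nstarZ (c : R[i]) x : nccw_star (c *: x) = Num.conj c *: nccw_star x.
Proof. by apply: nccw_eq => [t|]; exact: starZ. Qed.

Let nstarM x y : nccw_star (nccw_mul x y) = nccw_mul (nccw_star y) (nccw_star x).
Proof. by apply: nccw_eq => [t|] /=; rewrite starM. Qed.

Let nstarK : involutive nccw_star.
Proof. by move=> x; apply: nccw_eq => [t|] /=; rewrite starK. Qed.

HB.instance Definition _ := Lmodule_isStarAlgebra.Build R[i] nccw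
  mulA mulDl mulDr mulZl mulZr nstarD nstarZ nstarM nstarK.

Definition nccw_norm x : R :=
  Num.max (sup (range (fun t => rnorm ((nccw_val x).1 t))))
          (rnorm (nccw_val x).2).

Lemma nccw_normP x (c : R) : nccw_norm x <= c <->
  (forall t, rnorm ((nccw_val x).1 t) <= c) /\ rnorm (nccw_val x).2 <= c.
Proof.
rewrite /nccw_norm ge_max; split=> [/andP[fc ->]|[fc ->]].
  split=> // t; rewrite (le_trans _ fc)//; apply: ub_le_sup; last by exists t.
  apply: unit_itv_bounded => s; apply: continuous_comp.
    exact: nccw_continuous.
  exact: rnorm_continuous.
rewrite andbT; apply: ge_sup; first by exists (rnorm ((nccw_val x).1 (itv_left R))), (itv_left R).
by move=> _ [t _ <-].
Qed.

Lemma nccw_norm_fun x t : rnorm ((nccw_val x).1 t) <= nccw_norm x.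
Proof. by have /nccw_normP[] := lexx (nccw_norm x). Qed.

Lemma nccw_norm_pt x : rnorm (nccw_val x).2 <= nccw_norm x.
Proof. by have /nccw_normP[] := lexx (nccw_norm x). Qed.

Lemma nccw_norm_ge0 x : 0 <= nccw_norm x.
Proof. exact: le_trans (rnorm_ge0 _) (nccw_norm_pt x). Qed.

Let normD x y : (nccw_norm (x + y))%:C <= (nccw_norm x)%:C + (nccw_norm y)%:C :> R[i].
Proof.
rewrite -rmorphD/= lecR; apply/nccw_normP; rewrite nccw_valD/=; split.
  move=> t; rewrite (le_trans (ler_rnormD _ _))// lerD//; exact: nccw_norm_fun.
rewrite (le_trans (ler_rnormD _ _))// lerD//; exact: nccw_norm_pt.
Qed.

Let normZ_le (c : R[i]) x : nccw_norm (c *: x) <= complex.Re `|c| * nccw_norm x.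
Proof.
have c0 : 0 <= complex.Re `|c| by rewrite -ler0c RRe_real ?normr_real.
apply/nccw_normP; rewrite nccw_valZ/=; split.
  by move=> t; rewrite rnormZ ler_wpM2l// nccw_norm_fun.
by rewrite rnormZ ler_wpM2l// nccw_norm_pt.
Qed.

Let norm_eq0 x : (nccw_norm x)%:C = 0 :> R[i] -> x = 0.
Proof.
move=> /complexI x0.
apply: nccw_eq => [t|]; apply/eqP; rewrite -rnorm_eq0 eq_le rnorm_ge0 andbT -x0.
  exact: nccw_norm_fun.
exact: nccw_norm_pt.
Qed.

Let normZ (c : R[i]) x : (nccw_norm (c *: x))%:C = `|c| * (nccw_norm x)%:C :> R[i].
Proof.
have cE (d : R[i]) : `|d| = (complex.Re `|d|)%:C by rewrite RRe_real ?normr_real.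
rewrite (cE c) -rmorphM/=; congr (_%:C); apply/eqP; rewrite eq_le normZ_le andTb.
have [->|c0] := eqVneq c 0.
  by rewrite Normc.normc0 mul0r nccw_norm_ge0.
have c0' : 0 < complex.Re `|c| by rewrite -ltcR -cE normr_gt0.
rewrite mulrC -ler_pdivlMr//.
have := normZ_le c^-1 (c *: x); rewrite scalerA mulVf// scale1r mulrC.
suff -> : complex.Re `|c^-1| = (complex.Re `|c|)^-1 by [].
by apply: (@complexI R); rewrite fmorphV/= -!cE normfV.
Qed.

HB.instance Definition _ := Lmodule_isNormed.Build R[i] nccw normD normZ norm_eq0.

Lemma rnorm_nccw x : rnorm x = nccw_norm x.
Proof. by []. Qed.

Let ball_nccwE x y (r : R) : ball x r%:C y <-> nccw_norm (x - y) < r.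
Proof. by rewrite -ball_normE/= -rnorm_nccw (rnormE (x - y)) ltcR. Qed.

Let nccw_complete (F : set_system nccw) : ProperFilter F -> cauchy F -> cvg F.
Proof.
move=> FF cF.
pose G1 : set_system (arrow_uniform_type I F2) := (fun x => (nccw_val x).1) @ F.
pose G2 : set_system F1 := (fun x => (nccw_val x).2) @ F.
have near_ball e : 0 < e ->
    \forall x & y \near F, nccw_norm (x - y) < e.
  move=> e0; have e0' : 0 < e%:C :> R[i] by rewrite ltcR.
  have /cauchy_ballP/(_ _ e0') := cF.
  by apply: filterS => -[x y] /=; rewrite ball_nccwE.
have cG1 : cauchy G1.
  move=> A [B entB BA].
  have [e /gt0_complexE[r r0 ->] eB] : exists2 e : R[i], 0 < e &
    forall u v : F2, ball u e v -> B (u, v).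
    move: entB; rewrite -entourage_ballE => -[e /= e0 eB].
    by exists e => // u v uv; exact: eB.
  have [[P1 P2] /= [FP1 FP2] P12] := near_ball _ r0.
  exists ((fun x => (nccw_val x).1) @` P1, (fun x => (nccw_val x).1) @` P2).
    by split; [apply: filterS FP1 => x ?; exists x|apply: filterS FP2 => x ?; exists x].
  move=> [_ _] [/= [x Px <-] [y Py <-]]; apply: BA => /= t; apply: eB.
  rewrite -ball_normE/= rnormE ltcR.
  have := P12 (x, y) (conj Px Py); apply: le_lt_trans.
  have := nccw_norm_fun (x - y) t; rewrite nccw_valB; exact.
have cG2 : cauchy G2.
  apply/cauchy_ballP => e /gt0_complexE[r r0 ->].
  have [[P1 P2] /= [FP1 FP2] P12] := near_ball _ r0.
  exists ((fun x => (nccw_val x).2) @` P1, (fun x => (nccw_val x).2) @` P2).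
    by split; [apply: filterS FP1 => x ?; exists x|apply: filterS FP2 => x ?; exists x].
  move=> [_ _] [/= [x Px <-] [y Py <-]].
  rewrite -ball_normE/= rnormE ltcR.
  have := P12 (x, y) (conj Px Py); apply: le_lt_trans.
  have := nccw_norm_pt (x - y); rewrite nccw_valB; exact.
have [f fE] := (cvg_ex _).1 (@cauchy_cvg (arrow_uniform_type I F2) G1 _ cG1).
have [a aE] := (cvg_ex _).1 (@cauchy_cvg F1 G2 _ cG2).
have near_fun e : 0 < e -> \forall x \near F,
    forall t, rnorm (f t - (nccw_val x).1 t) < e.
  move=> e0; have e0' : 0 < e%:C :> R[i] by rewrite ltcR.
  have /cvg_fct_entourageP/(_ _ (entourage_ball F2 (PosNum e0'))) := fE.
  apply: (@filterS _ F) => x /= xf t.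
  by have := xf t; rewrite -ball_normE/= rnormE ltcR.
have near_pt e : 0 < e -> \forall x \near F, rnorm (a - (nccw_val x).2) < e.
  move=> e0; have e0' : 0 < e%:C :> R[i] by rewrite ltcR.
  have /cvgrPdist_lt/(_ _ e0') := aE.
  by apply: filterS => x; rewrite rnormE ltcR.
have cf : continuous (f : I -> F2).
  apply: (@uniform_limit_continuous _ _ G1 f).
    suff : \forall x \near F, continuous (nccw_val x).1 by [].
    by apply: nearW => x; exact: nccw_continuous.
  move=> Q /= /uniform_nbhs[E [entE EQ]].
  have /cvg_fct_entourageP/(_ _ entE) := fE.
  by apply: (@filterS _ F) => x xf; apply: EQ => t _; exact: xf.
have cphi (phi : {starhom F1 -> F2}) : continuous phi.
  by apply: finite_dim_continuous; exact: finite_dimT.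
have lim_end t (phi : {starhom F1 -> F2}) :
    (forall x, (nccw_val x).1 t = phi (nccw_val x).2) -> f t = phi a.
  move=> tE.
  have h1 : (nccw_val x).1 t @[x --> F] --> f t.
    apply/cvgrPdist_lt => e /gt0_complexE[r r0 ->].
    by apply: filterS (near_fun _ r0) => x /(_ t); rewrite rnormE ltcR.
  have h2 : (nccw_val x).1 t @[x --> F] --> phi a.
    under eq_fun do rewrite tE.
    exact: (cvg_comp _ _ aE (cphi phi a)).
  exact: (cvg_unique (@norm_hausdorff _ F2) h1 h2).
have yP : ((f, a) : pairs) \in nccw_pred.
  apply/nccw_predP; split => //=; apply: lim_end.
    exact: nccw_left.
  exact: nccw_right.
apply/cvg_ex; exists (Nccw yP); apply/cvgrPdist_lt => e /gt0_complexE[r r0 ->].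
have r20 : 0 < r / 2 by rewrite divr_gt0.
apply: filterS2 (near_fun _ r20) (near_pt _ r20) => x xf xa.
rewrite rnormE ltcR (@le_lt_trans _ _ (r / 2))//; last first.
  by rewrite ltr_pdivrMr// ltr_pMr// ltr1n.
by apply/nccw_normP; rewrite nccw_valB; split=> [t|] /=; apply: ltW; [exact: xf|].
Qed.

HB.instance Definition _ := Uniform_isComplete.Build nccw nccw_complete.

Let norm_mul x y : `|x ** y| <= `|x| * `|y|.
Proof.
rewrite !rnormE -rmorphM/= lecR; apply/nccw_normP => /=; split=> [t|].
  rewrite (le_trans (ler_rnorm_mul _ _))// ler_pM ?rnorm_ge0//;
    exact: nccw_norm_fun.
by rewrite (le_trans (ler_rnorm_mul _ _))// ler_pM ?rnorm_ge0//;
  exact: nccw_norm_pt.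
Qed.

Let norm_star_sqr x : `|star x ** x| = `|x| ^+ 2.
Proof.
rewrite !rnormE -rmorphXn/=; congr (_%:C); apply/eqP; rewrite eq_le.
apply/andP; split.
  apply/nccw_normP => /=; split=> [t|]; rewrite rnorm_cstar ler_sqr ?nnegrE//;
    rewrite ?rnorm_ge0 ?nccw_norm_ge0//; [exact: nccw_norm_fun|exact: nccw_norm_pt].
have s0 : 0 <= nccw_norm (star x ** x) by exact: nccw_norm_ge0.
have sq (r : R) : 0 <= r -> r ^+ 2 <= nccw_norm (star x ** x) ->
    r <= Num.sqrt (nccw_norm (star x ** x)).
  by move=> r0 rs; rewrite -(ger0_norm r0) -sqrtr_sqr ler_wsqrtr.
rewrite -[leRHS]sqr_sqrtr// ler_sqr ?nnegrE ?sqrtr_ge0 ?nccw_norm_ge0//.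
apply/nccw_normP; split=> [t|]; apply: sq; rewrite ?rnorm_ge0// -rnorm_cstar.
  exact: (nccw_norm_fun (star x ** x)).
exact: (nccw_norm_pt (star x ** x)).
Qed.

HB.instance Definition _ :=
  StarAlgebra_isCStarAlgebra.Build R nccw norm_mul norm_star_sqr.

End NCCW.

Section MatrixNorm.
Context (R : realType) (A : cstarAlgType R) (n : nat).

Definition col_dot (u v : 'cV[A]_n) : A := \sum_i star (u i 0) ** v i 0.

Definition matrix_act (T : matrix_alg A n) (v : 'cV[A]_n) : 'cV[A]_n :=
  \col_i \sum_j T i j ** v j 0.

(* The unique C*-norm of M_n(A), obtained as the operator norm of its action
   on the Hilbert A-module A^n, where |v| = |<v, v>|^(1/2). *)
Definition matrix_norm (T : matrix_alg A n) : \bar R :=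
  ereal_sup [set (Num.sqrt (rnorm (col_dot (matrix_act T v) (matrix_act T v))))%:E
            | v in [set v | rnorm (col_dot v v) <= 1]].

Definition block_diag (a : A) (b : matrix_alg A n) : matrix_alg A n.+1 :=
  block_mx (const_mx a : 'M[A]_1) 0 0 b.

End MatrixNorm.

(* [n] stands for r - 1. *)
Definition property_H (R : realType) (A : cstarAlgType R) : Prop :=
  forall (F : set A) (eps : R), finite_set F -> 0 < eps ->
    exists (n : nat) (rho : {starhom A -> matrix_alg A n})
           (mu : {starhom A -> matrix_alg A n.+1}),
      finite_dim (range mu) /\
      forall f, F f -> (matrix_norm (block_diag f (rho f) - mu f)%R < eps%:E)%E.

(* Main.v *)
(* Property (H) holds because the identity of A can be completed to a
   homomorphism conjugate to one by scalar matrices, up to point evaluations.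

   Every finite dimensional C*-algebra F has a row x of elements with
   sum_j x_j x_j^* = 1 and a x_j = sum_i tau_ij(a) x_i for a *-representation
   tau of F by scalar matrices. Hence a is the compression of tau(a) by the
   isometry x^*, and the complementary compression
   tau(a)_ij - x_i^* a x_j is again a homomorphism.

   Apply this to F1 (row X, representation tau) and to F2 (row Y, representation
   sigma). For f = (f(t), a) in A and g a reparametrization of [0,1] close to
   the identity, consider the scalar representations
   tau(a) + sigma(f(s)) + sigma(f(1-s)). While g stays at 0 or at 1, the row
   phi_0(X) or phi_1(X) intertwines f(g) with the first summand; as g goes from
   0 to 1/2 and s = g, the row Y does so with the second summand; as g goes on to
   1 and s = 1-g goes back to 0, the row Y does so with the third one. Rotating
   from one row to the next while g is stationary gives a row om over A which
   intertwines f o g with a loop kappa of scalar representations, based at s = 0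
   and retracing its steps. The complementary compression of kappa is rho.

   Finally the loop kappa, once the evaluations at s = 1/n, ..., n/n are added,
   is uniformly close to a conjugate, by a loop of orthogonal matrices, of the
   constant representation given by the evaluations at 0, 1/n, ..., n/n: as s
   increases, its evaluation successively exchanges places with the points of
   the grid. Conjugating the constant representation gives mu. *)

From HB Require Import structures.
Require Import Defs.
From mathcomp Require Import all_boot all_order all_algebra.
From mathcomp Require Import all_classical all_reals.
From mathcomp Require Import complex ring lra zify.
From mathcomp Require Import ereal topology normedtype realfun.

Set Implicit Arguments.
Unset Strict Implicit.
Unset Printing Implicit Defensive.

Import Order.TTheory GRing.Theory Num.Theory.
Import numFieldNormedType.Exports.

Local Open Scope classical_set_scope.
Local Open Scope complex_scope.
Local Open Scope ring_scope.

(** * Projections in finite dimensional C*-algebras *)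

Section StarAlgebraTheory.
Context (C : numClosedFieldType) (A : starAlgType C).
Implicit Types x y z : A.

Lemma star_mul0l x : 0 ** x = 0.
Proof. by rewrite -[X in X ** x](scale0r 0) star_mulZl scale0r. Qed.

Lemma star_mul0r x : x ** 0 = 0.
Proof. by rewrite -[X in x ** X](scale0r 0) star_mulZr scale0r. Qed.

Lemma star_mulNl x y : (- x) ** y = - (x ** y).
Proof. by rewrite -scaleN1r star_mulZl scaleN1r. Qed.

Lemma star_mulNr x y : x ** (- y) = - (x ** y).
Proof. by rewrite -scaleN1r star_mulZr scaleN1r. Qed.

Lemma star_mulrBl x y z : (x - y) ** z = x ** z - y ** z.
Proof. by rewrite star_mulDl star_mulNl. Qed.

Lemma star_mulrBr x y z : z ** (x - y) = z ** x - z ** y.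
Proof. by rewrite star_mulDr star_mulNr. Qed.

Lemma star0 : star (0 : A) = 0.
Proof. by rewrite -[X in star X](scale0r 0) starZ rmorph0 scale0r. Qed.

Lemma starN x : star (- x) = - star x.
Proof. by rewrite -scaleN1r starZ rmorphN rmorph1 scaleN1r. Qed.

Lemma star_suml I (r : seq I) (P : pred I) (F : I -> A) z :
  (\sum_(i <- r | P i) F i) ** z = \sum_(i <- r | P i) F i ** z.
Proof.
by apply: (big_morph (fun t => t ** z)) => [a b|]; rewrite ?star_mulDl ?star_mul0l.
Qed.

Lemma star_sumr I (r : seq I) (P : pred I) (F : I -> A) z :
  z ** (\sum_(i <- r | P i) F i) = \sum_(i <- r | P i) z ** F i.
Proof.
by apply: (big_morph (fun t => z ** t)) => [a b|]; rewrite ?star_mulDr ?star_mul0r.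
Qed.

Lemma star_sum I (r : seq I) (P : pred I) (F : I -> A) :
  star (\sum_(i <- r | P i) F i) = \sum_(i <- r | P i) star (F i).
Proof. by apply: (big_morph (@star C A)) => [a b|]; rewrite ?starD ?star0. Qed.

Lemma star_unit (e : A) : (forall x, e ** x = x /\ x ** e = x) -> star e = e.
Proof.
move=> eP; transitivity (star e ** e); first by rewrite (eP _).2.
by rewrite -[RHS]starK -[in RHS](eP (star e)).2 starM starK.
Qed.

End StarAlgebraTheory.

Section Projections.
Context (R : realType) (F : cstarAlgType R).
Implicit Types (a b c x y p q : F).

Definition projection p := star p = p /\ p ** p = p.

Definition minimal_projection p :=
  [/\ projection p, p != 0 & forall x, exists c : R[i], p ** x ** p = c *: p].

Lemma star_mul_eq0 x : star x ** x = 0 -> x = 0.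
Proof.
move=> x0; apply/eqP; rewrite -rnorm_eq0 -sqrf_eq0 -rnorm_cstar x0.
by rewrite rnorm0.
Qed.

Lemma rnorm_projection p : projection p -> p != 0 -> rnorm p = 1.
Proof.
move=> [sp pp] p0; have := rnorm_cstar p; rewrite sp pp expr2.
have np0 : rnorm p != 0 by rewrite rnorm_eq0.
by move=> /(congr1 (fun t => t / rnorm p)); rewrite divff// mulfK.
Qed.

Lemma projection_le p q : projection p -> projection q -> p ** q = q ->
  q ** p = q.
Proof. by move=> [sp _] [sq _] /(congr1 (@star _ _)); rewrite starM sp sq. Qed.

Lemma projectionB p q : projection p -> projection q -> p ** q = q ->
  projection (p - q).
Proof.
move=> pp pq le; have qp := projection_le pp pq le.
split; first by rewrite starB pp.1 pq.1.
by rewrite star_mulrBl !star_mulrBr pp.2 pq.2 le qp subrr subr0.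
Qed.

End Projections.

(** * Polynomial functional calculus in a corner *)

Section PolyEval.
Context (R : realType) (F : cstarAlgType R) (p c : F).
Implicit Types g h : {poly R[i]}.
Hypotheses (pp : projection p) (pc : p ** c = c) (cp : c ** p = c).

Let pow i := iter i (fun x => c ** x) p.

(* evaluation at c in the corner p F p, whose unit is p *)
Definition corner_horner g : F := \sum_(i < size g) g`_i *: pow i.

Let ev := corner_horner.

Let evE n g : (size g <= n)%N -> ev g = \sum_(i < n) g`_i *: pow i.
Proof.
move=> gn; rewrite /ev /corner_horner (big_ord_widen n (fun i => g`_i *: pow i))//.
rewrite big_mkcond/=; apply: eq_bigr => i _; case: ltnP => // ni.
by rewrite nth_default// scale0r.
Qed.

Lemma corner_hornerD g h : ev (g + h) = ev g + ev h.
Proof.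
pose n := maxn (size g) (size h).
rewrite (@evE n g) ?leq_maxl// (@evE n h) ?leq_maxr// (@evE n) ?size_polyD//.
by rewrite -big_split; apply: eq_bigr => i _; rewrite coefD scalerDl.
Qed.

Lemma corner_hornerZ (a : R[i]) g : ev (a *: g) = a *: ev g.
Proof.
rewrite (@evE (size g)) ?size_scale_leq// scaler_sumr.
by apply: eq_bigr => i _; rewrite coefZ scalerA.
Qed.

Lemma corner_hornerC (a : R[i]) : ev a%:P = a *: p.
Proof. by rewrite (@evE 1) ?size_polyC_leq1// big_ord1 coefC. Qed.

Lemma corner_hornerMX g : ev (g * 'X) = c ** ev g.
Proof.
rewrite (@evE (size g).+1); last first.
  by rewrite (leq_trans (size_polyMleq _ _))// size_polyX addn2.
rewrite big_ord_recl coefMX eqxx scale0r add0r /ev /corner_horner star_sumr.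
by apply: eq_bigr => i _; rewrite coefMX/= star_mulZr.
Qed.

Lemma corner_horner_eigen g y (l : R[i]) : p ** y = y -> c ** y = l *: y ->
  ev g ** y = g.[l] *: y.
Proof.
move=> py cy; elim/poly_ind: g => [|g a IH].
  by rewrite /ev /corner_horner size_poly0 big_ord0 star_mul0l horner0 scale0r.
rewrite corner_hornerD corner_hornerMX corner_hornerC star_mulDl -star_mulA IH.
by rewrite star_mulZr cy star_mulZl py scalerA -scalerDl hornerMXaddC.
Qed.

Lemma corner_horner_star g : star c = c ->
  star (ev g) = ev (map_poly Num.conj g).
Proof.
move=> sc; elim/poly_ind: g => [|g a IH].
  by rewrite rmorph0 /ev /corner_horner size_poly0 big_ord0 star0.
have comm h : ev h ** c = c ** ev h.
  elim/poly_ind: h => [|h b IHh].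
    by rewrite /ev /corner_horner size_poly0 big_ord0 star_mul0l star_mul0r.
  rewrite corner_hornerD corner_hornerMX corner_hornerC star_mulDl star_mulDr.
  by rewrite -!star_mulA IHh star_mulZl star_mulZr pc cp.
rewrite rmorphD rmorphM/= map_polyX map_polyC/= !corner_hornerD !corner_hornerMX.
by rewrite !corner_hornerC starD starM sc starZ pp.1 IH comm.
Qed.

Lemma corner_horner_unit g : p ** ev g = ev g.
Proof.
elim/poly_ind: g => [|g a IH].
  by rewrite /ev /corner_horner size_poly0 big_ord0 star_mul0r.
rewrite corner_hornerD corner_hornerMX corner_hornerC star_mulDr star_mulZr.
by rewrite pp.2 star_mulA pc.
Qed.

Lemma corner_horner_comm b g : b ** p = p ** b -> b ** c = c ** b ->
  b ** ev g = ev g ** b.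
Proof.
move=> bp bc; elim/poly_ind: g => [|g a IH].
  by rewrite /ev /corner_horner size_poly0 big_ord0 star_mul0l star_mul0r.
rewrite corner_hornerD corner_hornerMX corner_hornerC star_mulDr star_mulDl.
by rewrite star_mulZr star_mulZl bp star_mulA bc -!star_mulA IH.
Qed.

(** The [n + 1] powers [pow 0, ..., pow n] are combinations of [n] vectors, so their coefficient
    matrix has a nonzero left kernel vector, whose entries are the coefficients of the
    polynomial. *)
Lemma corner_horner_annihilator : finite_dim [set: F] ->
  exists2 g, g != 0 & ev g = 0.
Proof.
move=> [n [e eE]].
have spe v : exists d : 'I_n -> R[i], v = \sum_i d i *: e i.
  by have : [set: F] v by []; rewrite eE.
have /choice[d dE] := spe.
pose M : 'M[R[i]]_(n.+1, n) := \matrix_(i, j) d (pow i) j.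
have : kermx M != 0.
  by rewrite kermx_eq0 -row_leq_rank -ltnNge (leq_ltn_trans (rank_leq_col M)).
case/rowV0Pn => v /sub_kermxP vM v0.
exists (\poly_(i < n.+1) v 0 (inord i)).
  apply/eqP => g0; move/eqP: v0; apply; apply/rowP => i; rewrite mxE.
  move/(congr1 (fun h : {poly R[i]} => h`_i)): g0.
  by rewrite coef_poly ltn_ord coef0 inord_val.
rewrite (@evE n.+1) ?size_poly//.
have -> : \sum_(i < n.+1) (\poly_(i < n.+1) v 0 (inord i))`_i *: pow i =
    \sum_(j < n) (v *m M) 0 j *: e j.
  under [RHS]eq_bigr do rewrite mxE scaler_suml.
  rewrite exchange_big/=; apply: eq_bigr => i _.
  rewrite coef_poly ltn_ord inord_val {1}(dE (pow i)) scaler_sumr.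
  by apply: eq_bigr => j _; rewrite mxE scalerA.
by rewrite vM big1// => j _; rewrite mxE scale0r.
Qed.

End PolyEval.

(* The projection is a normalized eigenvector of c obtained from an annihilating
   polynomial of least degree by removing one linear factor. *)
Lemma projection_split (R : realType) (F : finCStarAlgType R) (p c : F) :
  projection p -> p != 0 -> p ** c = c -> c ** p = c -> star c = c ->
  (forall l : R[i], c <> l *: p) ->
  exists q, [/\ projection q, q != 0, q != p, p ** q = q &
    forall b, b ** p = p ** b -> b ** c = c ** b -> b ** q = q ** b].
Proof.
move=> pp p0 pc cp sc cNp; pose ev := corner_horner p c.
pose P k := `[< exists g : {poly R[i]}, [/\ g != 0, ev g = 0 & size g = k] >].
have exP : exists k, P k.
  have [g g0 evg] := corner_horner_annihilator p c (@finite_dimT R F).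
  by exists (size g); apply/asboolP; exists g.
case: (ex_minnP exP) => k /asboolP[g [g0 evg <-]] ming.
have sg1 : size g != 1%N.
  apply/negP => /eqP sg1; have [a a0 ga] := size_poly1P _ (introT eqP sg1).
  move/eqP: evg; rewrite /ev ga corner_hornerC scaler_eq0.
  by rewrite (negbTE a0) (negbTE p0).
have [l /factor_theorem[h gh]] := closed_rootP g sg1.
have h0 : h != 0 by apply: contraNneq g0 => h0; rewrite gh h0 mul0r.
pose y := ev h.
have y0 : y != 0.
  apply/eqP => evh; have : P (size h) by apply/asboolP; exists h.
  move=> /ming; rewrite gh size_Mmonic ?monicXsubC// size_XsubC addn2/=.
  by rewrite ltnn.
have py : p ** y = y by exact: corner_horner_unit.
have cy : c ** y = l *: y.
  move/eqP: evg; rewrite gh mulrBr /ev corner_hornerD corner_hornerMX.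
  rewrite -mulrN -polyCN mulrC mul_polyC corner_hornerZ.
  by rewrite scaleNr subr_eq0 => /eqP.
(* Every polynomial in [c] acts on the eigenvector [y] by its value at [l]; both [y] and its adjoint
   are such polynomials, so both products with [y] are multiples of [y]. *)
have yy : y ** y = h.[l] *: y by exact: corner_horner_eigen.
pose m := (map_poly Num.conj h).[l].
have syy : star y ** y = m *: y.
  by rewrite /y /ev corner_horner_star//; exact: corner_horner_eigen.
have m0 : m != 0.
  apply: contraNneq y0 => m0; apply/eqP/star_mul_eq0.
  by rewrite syy m0 scale0r.
have ssy : star y = (Num.conj m^-1 * m) *: y.
  have {1}-> : y = m^-1 *: (star y ** y) by rewrite syy scalerA mulVf// scale1r.
  by rewrite starZ starM starK syy scalerA.
have n0 : h.[l] != 0.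
  apply: contraNneq y0 => n0; apply/eqP/star_mul_eq0.
  by rewrite ssy star_mulZl yy n0 scale0r scaler0.
pose q := h.[l]^-1 *: y.
have q0 : q != 0 by rewrite scaler_eq0 invr_eq0 negb_or n0.
have qq : q ** q = q.
  by rewrite star_mulZl star_mulZr yy (scalerA _ h.[l]) mulVf// scale1r.
have [k' sq] : exists k' : R[i], star q = k' *: q.
  exists (Num.conj h.[l]^-1 * (Num.conj m^-1 * m) * h.[l]).
  by rewrite /q starZ ssy !scalerA mulfK.
have k'0 : k' != 0.
  apply: contraNneq q0 => k'0; rewrite -[q]starK sq k'0 scale0r star0 eqxx//.
(* The adjoint of an idempotent is idempotent, hence [k' ^+ 2 = k']. *)
have k'1 : k' = 1.
  have : star (q ** q) = star q by rewrite qq.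
  rewrite starM sq star_mulZl star_mulZr qq scalerA => /eqP.
  rewrite -subr_eq0 -scalerBl scaler_eq0 (negbTE q0) orbF subr_eq0 => /eqP kk.
  by apply: (mulfI k'0); rewrite kk mulr1.
exists q; split => //.
- by split=> //; rewrite sq k'1 scale1r.
- apply/eqP => qp; apply: (cNp l); rewrite -cp -{1}qp star_mulZr cy scalerA.
  by rewrite mulrC -scalerA -/q qp.
- by rewrite star_mulZr py.
- move=> b bp bc; rewrite star_mulZl star_mulZr; congr (_ *: _).
  exact: corner_horner_comm.
Qed.

(** * Existence of minimal projections *)

Section FinDimProjections.
Context (R : realType) (F : finCStarAlgType R).
Implicit Types (a b c x y p q : F).

(** The rank of [p] is that of left multiplication by [p] on [F]: a strictly smaller projection has
    a strictly smaller range. *)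
Lemma projection_rank : exists rk : F -> nat, forall p q,
  projection p -> projection q -> p ** q = q -> q != p -> (rk q < rk p)%N.
Proof.
have [n [e [spe fre]]] := finite_dim_free (@finite_dimT R F).
have /choice[d dE] := spe.
pose L a : 'M[R[i]]_n := \matrix_(i, j) d (a ** e i) j.
have dP x (k : 'I_n -> R[i]) : x = \sum_i k i *: e i -> forall i, d x i = k i.
  move=> xk i; apply/eqP; rewrite -subr_eq0; apply/eqP.
  apply: (fre (fun i => d x i - k i)).
  by under eq_bigr do rewrite scalerBl; rewrite sumrB -dE -xk subrr.
(* Vectors are rows, so [L] reverses products. *)
have LM a b : L (a ** b) = L b *m L a.
  apply/matrixP => i j; rewrite mxE [RHS]mxE.
  apply: (dP _ (fun j => \sum_k L b i k * L a k j)).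
  transitivity (a ** (b ** e i)); first by rewrite star_mulA.
  rewrite {1}(dE (b ** e i)) star_sumr.
  under eq_bigr => k _ do rewrite star_mulZr (dE (a ** e k)) scaler_sumr.
  rewrite exchange_big/=; apply: eq_bigr => k _.
  by rewrite scaler_suml; apply: eq_bigr => l _; rewrite !mxE scalerA.
have Linj a b : L a = L b -> forall x, a ** x = b ** x.
  move=> ab x; rewrite (dE x) !star_sumr; apply: eq_bigr => i _.
  rewrite !star_mulZr; congr (_ *: _); rewrite (dE (a ** e i)) (dE (b ** e i)).
  apply: eq_bigr => j _; congr (_ *: _).
  by move/matrixP: ab => /(_ i j); rewrite !mxE.
exists (fun a => \rank (L a)) => p q pp pq le qNp.
have qp := projection_le pp pq le.
have sub : (L q <= L p)%MS by rewrite -{1}le LM submxMl.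
rewrite ltn_neqAle mxrankS// andbT; apply: contra qNp => /eqP rk.
(* With equal ranks the row space of [L p] lies in that of [L q], on which multiplication by [q] is
   the identity; hence [q ** p = p], whereas [q ** p = q]. *)
have /submxP[D DE] : (L p <= L q)%MS by rewrite -(geq_leqif (mxrank_leqif_sup sub)) rk.
have : L (q ** p) = L p by rewrite LM {1}DE -mulmxA -LM pq.2 -DE.
by move=> /Linj/(_ p); rewrite -star_mulA pp.2 qp => ->.
Qed.

(** A subprojection of least rank among those satisfying [Q] works. The predicate is trivial in
    [minimal_subprojection]; in [selfadjoint_norm_attained] it demands commutation with [b] and
    preservation of its norm. *)
Lemma least_subprojection (Q : F -> Prop) p : projection p -> p != 0 -> Q p ->
  exists q, [/\ projection q, q != 0, p ** q = q, Q q & forall q',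
    projection q' -> q' != 0 -> q ** q' = q' -> Q q' -> q' = q].
Proof.
move=> pp p0 Qp; have [rk rkP] := projection_rank.
pose P k := `[< exists q, [/\ projection q, q != 0, p ** q = q, Q q & rk q = k] >].
have exP : exists k, P k.
  by exists (rk p); apply/asboolP; exists p; split=> //; rewrite pp.2.
case: (ex_minnP exP) => k /asboolP[q [pq q0 le Qq <-]] minq.
exists q; split=> // q' pq' q'0 le' Qq'; apply/eqP; apply: contraT => q'Nq.
have : P (rk q').
  apply/asboolP; exists q'; split => //.
  by rewrite -[in RHS]le' -le -!star_mulA le'.
by move=> /minq; rewrite leqNgt rkP.
Qed.

(** By [projection_split] the selfadjoint elements of the corner are multiples of [p]; the real and
    imaginary parts of [p ** x ** p] are such elements. *)
Lemma minimal_projectionP p : projection p -> p != 0 ->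
  (forall q, projection q -> q != 0 -> p ** q = q -> q = p) ->
  minimal_projection p.
Proof.
move=> pp p0 minp.
have herm c : p ** c = c -> c ** p = c -> star c = c ->
    exists l : R[i], c = l *: p.
  move=> pc cp sc; apply/not_existsP => cNp.
  have [q [pq q0 /eqP qp le _]] := projection_split pp p0 pc cp sc cNp.
  by apply: qp; exact: minp.
split=> // x; pose z := p ** x ** p.
have pz : p ** z = z by rewrite /z !star_mulA pp.2.
have zp : z ** p = z by rewrite /z -!star_mulA pp.2.
have psz : p ** star z = star z by rewrite -[in RHS]zp starM pp.1.
have szp : star z ** p = star z by rewrite -[in RHS]pz starM pp.1.
have [l lE] : exists l : R[i], z + star z = l *: p.
  apply: herm; rewrite ?starD ?starK 1?addrC// ?star_mulDr ?star_mulDl.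
    by rewrite psz pz addrC.
  by rewrite szp zp addrC.
have [m mE] : exists m : R[i], 'i *: (z - star z) = m *: p.
  apply: herm.
  - by rewrite star_mulZr star_mulrBr pz psz.
  - by rewrite star_mulZl star_mulrBl zp szp.
  - by rewrite starZ starB starK conjCi scaleNr -scalerN opprB.
exists (2^-1 * (l - 'i * m)).
have -> : p ** x ** p = 2^-1 *: ((z + star z) + (z - star z)).
  rewrite addrACA subrr addr0 -/z -[z in RHS]scale1r -scalerDl.
  by rewrite scalerA mulVf ?scale1r// pnatr_eq0.
have -> : z - star z = (- 'i * m) *: p.
  by rewrite -scalerA -mE scalerA mulNr -expr2 sqrCi opprK scale1r.
by rewrite lE -scalerDl scalerA mulNr.
Qed.

Lemma minimal_subprojection p : projection p -> p != 0 ->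
  exists2 q, minimal_projection q & p ** q = q.
Proof.
move=> pp p0.
have [q [pq q0 le _ minq]] := @least_subprojection (fun=> True) p pp p0 I.
by exists q => //; apply: minimal_projectionP => // q' ? ? ?; exact: minq.
Qed.

End FinDimProjections.

Section MinimalProjections.
Context (R : realType) (F : cstarAlgType R).
Implicit Types (a b c x y p q : F).

(** Positivity is obtained without spectral theory. One has $y^* y = l p$ with $l$ real and $|l| =
    |y|^2$. If $l \le 0$, some $t$ with $|t|^2 = |l|$ makes $z = y + t p$ satisfy $z^* z = 0$, so $y
    = -t p$ and $y^* y = |t|^2 p$ after all. *)
Lemma minimal_projection_posl p y : minimal_projection p -> y ** p = y ->
  star y ** y = (rnorm y ^+ 2)%:C *: p.
Proof.
move=> [pp p0 minp] yp.
have [l lE] : exists l : R[i], star y ** y = l *: p.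
  have [l lE] := minp (star y ** y); exists l; rewrite -lE.
  have psy : p ** star y = star y by rewrite -[in RHS]yp starM pp.1.
  by rewrite star_mulA psy -star_mulA yp.
have inj (s t : R[i]) : s *: p = t *: p -> s = t.
  move=> /eqP; rewrite -subr_eq0 -scalerBl scaler_eq0 (negbTE p0) orbF.
  by rewrite subr_eq0 => /eqP.
have lr : l \is Num.real.
  apply/CrealP; apply: inj; rewrite -[in LHS]pp.1 -starZ -lE.
  by rewrite starM starK.
have nl : `|l| = (rnorm y ^+ 2)%:C.
  have := rnorm_cstar y; rewrite lE rnormZ rnorm_projection// mulr1 => <-.
  by rewrite RRe_real// normr_real.
rewrite lE; congr (_ *: _); move: lr nl; rewrite realE => /orP[l0|l0] <-.
  by rewrite ger0_norm.
have [k kE] : exists k : R[i], p ** y = k *: p.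
  by have [k kE] := minp y; exists k; rewrite -kE -star_mulA yp.
have skE : star y ** p = Num.conj k *: p.
  by rewrite -{1}pp.1 -starM kE starZ pp.1.
(* The number [t] is taken perpendicular to [k] in the complex plane, so that the cross terms of
   [star z ** z] cancel. *)
have [t tt tk] : exists2 t : R[i], t * Num.conj t = `|l| &
    t * Num.conj k + Num.conj t * k = 0.
  have nl' : Num.conj `|l| = `|l| by apply/CrealP; exact: normr_real.
  pose r := sqrtC `|l|.
  have r0 : 0 <= r by rewrite sqrtC_ge0.
  have rr : Num.conj r = r by apply/CrealP; exact: ger0_real.
  have r2 : r * r = `|l| by rewrite -expr2 sqrtCK.
  have [->|k0] := eqVneq k 0.
    by exists r; rewrite ?rr// rmorph0 !mulr0 addr0.
  have nk0 : `|k| != 0 by rewrite normr_eq0.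
  have nk : Num.conj `|k| = `|k| by apply/CrealP; exact: normr_real.
  exists ('i * r * (k / `|k|)).
    rewrite !rmorphM fmorphV /= conjCi rr nk.
    transitivity (- 'i ^+ 2 * (r * r) * (k * Num.conj k) / (`|k| * `|k|)).
      by field.
    rewrite sqrCi opprK mul1r r2 -normCK -expr2 mulfK// expf_neq0//.
  rewrite !rmorphM fmorphV /= conjCi rr nk; field.
  by [].
pose z := y + t *: p.
have : star z ** z = 0.
  rewrite /z starD starZ pp.1 star_mulDl !star_mulDr !star_mulZl !star_mulZr.
  rewrite lE skE kE pp.2 !scalerA -!scalerDl.
  have -> : l + t * Num.conj k + (Num.conj t * k + Num.conj t * t) =
    l + (t * Num.conj k + Num.conj t * k) + t * Num.conj t by ring.
  by rewrite tk tt addr0 ler0_norm// subrr scale0r.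
move=> /star_mul_eq0 /eqP; rewrite addr_eq0 => /eqP yE.
apply/esym; rewrite -tt; apply: inj; rewrite -lE yE starN starZ star_mulNl star_mulNr.
by rewrite opprK star_mulZl star_mulZr scalerA pp.1 pp.2 mulrC.
Qed.


End MinimalProjections.

(** * Norms of positive elements through minimal projections *)

Section NormOfPositive.
Context (R : realType) (F : cstarAlgType R).
Implicit Types (a b c x y p q : F).

(** Compressing the positive element on the right by [p] gives the left-hand side times [p], and [p]
    has norm 1. *)
Lemma minimal_projection_norm_le (I : finType) (x : I -> F) p :
  minimal_projection p ->
  \sum_i rnorm (x i ** p) ^+ 2 <= rnorm (\sum_i star (x i) ** x i).
Proof.
move=> mp; have [pp p0 _] := mp.
have : p ** (\sum_i star (x i) ** x i) ** p =
    (\sum_i rnorm (x i ** p) ^+ 2)%:C *: p.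
  rewrite star_sumr star_suml rmorph_sum/= scaler_suml.
  apply: eq_bigr => i _; rewrite -minimal_projection_posl//; last first.
    by rewrite -star_mulA pp.2.
  by rewrite starM pp.1 !star_mulA.
move=> /(congr1 (@rnorm _ _)); rewrite rnormZ (rnorm_projection pp p0) mulr1.
rewrite ger0_norm;
  last by rewrite ler0c sumr_ge0// => i _; rewrite exprn_ge0// rnorm_ge0.
move=> /= <-; apply: (le_trans (ler_rnorm_mul _ _)).
rewrite (rnorm_projection pp p0) mulr1 (le_trans (ler_rnorm_mul _ _))//.
by rewrite (rnorm_projection pp p0) mul1r.
Qed.

(** As the products of [y] and [z] vanish, the powers of [y + z] are sums of powers, and the
    C*-identity gives $|y+z|^{2^k} \le 2 m^{2^k}$ for all $k$. Bernoulli's inequality then excludes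
    $|y+z| > m$. *)
Lemma rnorm_orthogonal_le y z (m : R) : star y = y -> star z = z ->
  y ** z = 0 -> z ** y = 0 -> rnorm y <= m -> rnorm z <= m -> rnorm (y + z) <= m.
Proof.
move=> sy sz yz zy ym zm.
have m0 : 0 <= m by apply: le_trans ym; exact: rnorm_ge0.
have pow k : rnorm (y + z) ^+ (2 ^ k) <= 2 * m ^+ (2 ^ k).
  elim: k y z m sy sz yz zy ym zm m0 => [|k IH] {}y {}z {}m sy sz yz zy ym zm m0.
    by rewrite !expr1 mulr_natl mulr2n (le_trans (ler_rnormD _ _))// lerD.
  rewrite expnS !exprM -rnorm_cstar starD sy sz.
  rewrite star_mulDl !star_mulDr yz zy addr0 add0r.
  apply: IH; rewrite ?starM ?sy ?sz ?exprn_ge0//.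
  - by rewrite star_mulA -(star_mulA y y z) yz star_mul0r star_mul0l.
  - by rewrite star_mulA -(star_mulA z z y) zy star_mul0r star_mul0l.
  - by rewrite (le_trans (ler_rnorm_mul _ _))// expr2 ler_pM// rnorm_ge0.
  - by rewrite (le_trans (ler_rnorm_mul _ _))// expr2 ler_pM// rnorm_ge0.
rewrite leNgt; apply/negP => mlt.
have [m00|m1] := eqVneq m 0.
  have := pow 0; rewrite !expr1 m00 mulr0 leNgt.
  by rewrite (le_lt_trans _ mlt)// m00.
have {m1}m1 : 0 < m by rewrite lt_neqAle eq_sym m1.
pose r := rnorm (y + z) / m.
have r1 : 0 < r - 1 by rewrite subr_gt0 ltr_pdivlMr// mul1r.
have rk k : r ^+ (2 ^ k) <= 2.
  by rewrite expr_div_n ler_pdivrMr ?exprn_gt0.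
have bern k : 1 + k%:R * (r - 1) <= r ^+ k.
  elim: k => [|k IH]; first by rewrite mul0r addr0 expr0.
  rewrite exprS (le_trans _ (ler_wpM2l _ IH))//; last first.
    by rewrite -[r](subrK 1) addr_ge0// ltW.
  have k0 : 0 <= k%:R :> R by [].
  rewrite -natr1; have := mulr_ge0 k0 (sqr_ge0 (r - 1)).
  by move: (k%:R) r {IH k0 r1 rk} => s r; nra.
have := archi_boundP (ltW (divr_gt0 (ltr01 : 0 < 1 :> R) r1)).
set k := Num.Def.archi_bound _ => /ltW; rewrite ler_pdivrMr// => k1.
have := le_trans (bern (2 ^ k)%N) (rk k); rewrite leNgt => /negP; apply.
have : 1 + k%:R * (r - 1) < 1 + (2 ^ k)%:R * (r - 1).
  by rewrite ltrD2l ltr_pM2r// ltr_nat ltn_expl.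
by apply: le_lt_trans; lra.
Qed.

End NormOfPositive.

Section NormAttained.
Context (R : realType) (F : finCStarAlgType R) (u : F).
Hypothesis (uP : forall x, u ** x = x /\ x ** u = x).
Implicit Types (a b c x y p q : F).

Lemma unit_projection : projection u.
Proof. by split; [exact: star_unit|exact: (uP u).1]. Qed.

(* Among the projections p commuting with b such that |b p| = |b|, one of least
   rank is minimal. *)
Lemma selfadjoint_norm_attained b : star b = b -> b != 0 ->
  exists p, minimal_projection p /\ exists l : R[i],
    b ** p = l *: p /\ complex.Re `|l| = rnorm b.
Proof.
move=> sb b0; pose Q p := b ** p = p ** b /\ rnorm (b ** p) = rnorm b.
have u0 : u != 0 by apply: contraNneq b0 => u0; rewrite -(uP b).1 u0 star_mul0l.
have Qu : Q u by rewrite /Q (uP b).1 (uP b).2.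
have [p [pp p0 _ [bp nb] minp]] := least_subprojection unit_projection u0 Qu.
have pbp : p ** (b ** p) = b ** p by rewrite bp star_mulA pp.2.
have [l lE] : exists l : R[i], b ** p = l *: p.
  apply/not_existsP => bpN.
  have [||q [pq q0 /eqP qNp le comm]] := projection_split pp p0 pbp _ _ bpN.
  - by rewrite -star_mulA pp.2.
  - by rewrite starM sb pp.1 -bp.
  have qp := projection_le pp pq le.
  have bq : b ** q = q ** b.
    by apply: (comm b bp); rewrite -star_mulA -bp.
  have bpq : b ** (p - q) = (p - q) ** b by rewrite star_mulBr star_mulBl bp bq.
  have ppq := projectionB pp pq le.
  (* Since [p] is least, a proper subprojection commuting with [b] strictly lowers the norm. *)
  have sub r : projection r -> r != 0 -> p ** r = r -> b ** r = r ** b ->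
      r <> p -> rnorm (b ** r) < rnorm b.
    move=> pr r0 ler br rp; rewrite lt_neqAle; apply/andP; split.
      by apply/eqP => nbr; apply: rp; exact: minp.
    rewrite (le_trans (ler_rnorm_mul _ _))// ler_piMr ?rnorm_ge0//.
    by rewrite rnorm_projection.
  have pq0 : p - q != 0 by rewrite subr_eq0; apply/eqP => /esym.
  have lpq : p ** (p - q) = p - q by rewrite star_mulBr pp.2 le.
  have pqNp : p - q <> p.
    move=> /(congr1 (fun z => z - p)); rewrite addrAC !subrr add0r => /eqP.
    by rewrite oppr_eq0 (negbTE q0).
  have := sub _ pq q0 le bq qNp; have := sub _ ppq pq0 lpq bpq pqNp.
  set s := rnorm (b ** (p - q)); set t := rnorm (b ** q) => sb' tb.
  (* The element [b ** p] is an orthogonal sum of two terms of norm less than that of [b], against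
     [nb]. *)
  have : rnorm (b ** q + b ** (p - q)) <= Num.max s t.
    apply: rnorm_orthogonal_le; rewrite ?le_max ?lexx ?orbT//.
    - by rewrite starM pq.1 sb.
    - by rewrite starM ppq.1 sb.
    - rewrite bpq -star_mulA (star_mulA q (p - q)) star_mulBr qp pq.2 subrr.
      by rewrite star_mul0l star_mul0r.
    - rewrite bq -star_mulA (star_mulA (p - q) q) star_mulBl le pq.2 subrr.
      by rewrite star_mul0l star_mul0r.
  rewrite -star_mulDr addrC subrK nb; apply/negP; rewrite -ltNge.
  by rewrite gt_max sb' tb.
exists p; split; last first.
  exists l; split=> //.
  by rewrite -nb lE rnormZ rnorm_projection ?mulr1.
(* A nonzero subprojection of [p] inherits the eigenvalue [l], hence the norm, and so equals [p]. *)
apply: minimal_projectionP => // q pq q0 le.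
have qp := projection_le pp pq le.
have bq : b ** q = l *: q by rewrite -{1}le star_mulA lE star_mulZl le.
apply: minp => //; split.
  by rewrite bq -[in RHS]qp -star_mulA -bp lE star_mulZr qp.
by rewrite bq -nb lE !rnormZ !rnorm_projection.
Qed.

(** Together with [minimal_projection_norm_le] this makes the norm of [b] a maximum, over minimal
    projections, of sums of squares of real numbers; operator estimates thus reduce to estimates of
    numbers. *)
Lemma norm_attained_at_minimal_projection (I : finType) (x : I -> F) :
  let b := \sum_i star (x i) ** x i in b != 0 ->
  exists2 p, minimal_projection p & rnorm b <= \sum_i rnorm (x i ** p) ^+ 2.
Proof.
move=> b b0.
have sb : star b = b.
  by rewrite star_sum; apply: eq_bigr => i _; rewrite starM starK.
have [p [mp [l [bp nl]]]] := selfadjoint_norm_attained sb b0.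
have [pp p0 _] := mp; exists p => //.
have : p ** b ** p = l *: p by rewrite -star_mulA bp star_mulZr pp.2.
have -> : p ** b ** p = \sum_i star (x i ** p) ** (x i ** p).
  rewrite star_sumr star_suml; apply: eq_bigr => i _.
  by rewrite starM pp.1 !star_mulA.
move=> E; rewrite -nl -[leLHS]mulr1 -(rnorm_projection pp p0) -rnormZ -E.
rewrite (le_trans (ler_rnorm_sum _))// ler_sum// => i _.
by rewrite rnorm_cstar.
Qed.

End NormAttained.

(** * Compressions of scalar representations *)

(** Matrix entries are indexed by a finite type, so that direct sums are indexed by sum and product
    types. *)
Definition scalar_rep (C : numClosedFieldType) (A : starAlgType C) (T : finType)
    (tau : A -> T -> T -> C) : Prop :=
  [/\ forall c a b i j, tau (c *: a + b) i j = c * tau a i j + tau b i j,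
      forall a b i j, tau (a ** b) i j = \sum_k tau a i k * tau b k j &
      forall a i j, tau (star a) i j = Num.conj (tau a j i)].

Section Dilation.
Context (R : realType) (F : finCStarAlgType R) (u : F).
Hypothesis (uP : forall x, u ** x = x /\ x ** u = x).
Implicit Types (a b c x y p q : F).

(** Induction on the rank: split off a minimal subprojection [q] and decompose [p - q]. *)
Lemma minimal_projection_decomposition p : projection p ->
  exists (T : finType) (q : T -> F), [/\ forall i, minimal_projection (q i),
    forall i j, i != j -> q i ** q j = 0 & \sum_i q i = p].
Proof.
have [rk rkP] := projection_rank F.
have [n] := ubnP (rk p); elim: n p => // n IH p rkn pp.
have [->|p0] := eqVneq p 0.
  by exists void, (fun=> 0); split=> [[]|[]|]; rewrite big1 => // -[].
have [q mq le] := minimal_subprojection pp p0; have [pq q0 _] := mq.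
have qp := projection_le pp pq le.
have ppq := projectionB pp pq le.
have lpq : p ** (p - q) = p - q by rewrite star_mulBr pp.2 le.
have pqNp : p - q != p.
  apply: contra q0 => /eqP/(congr1 (fun z => z - p)).
  by rewrite addrAC !subrr add0r => /eqP; rewrite oppr_eq0.
have [|T [r [mr rr rE]]] := IH (p - q) _ ppq.
  by rewrite (leq_trans (rkP _ _ pp ppq lpq pqNp)).
(* Each term lies under [p - q] and is therefore orthogonal to [q]. *)
have rpq i : r i ** (p - q) = r i.
  rewrite -rE star_sumr (bigD1 i)//= [X in _ + X]big1 ?addr0.
    by have [[]] := mr i.
  by move=> j ji; apply: rr; rewrite eq_sym.
have rq i : r i ** q = 0.
  by rewrite -rpq -star_mulA star_mulBl le pq.2 subrr star_mul0r.
have qr i : q ** r i = 0.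
  by have [[sr _] _ _] := mr i; rewrite -sr -pq.1 -starM rq star0.
exists (unit + T)%type, (fun o => if o is inr i then r i else q); split.
- by case.
- case=> [[]|i] [[]|j]//= ij; apply: rr; apply: contra ij => /eqP->.
  by rewrite eqxx.
- by rewrite big_sumType/= (big_pred1 tt)/= ?rE 1?addrC ?subrK//; case.
Qed.

(** Normalizing [z = q ** y ** p] turns [star z ** z] into [p] by [minimal_projection_posl]; then
    [x ** star x] is a nonzero idempotent multiple of [q]. *)
Lemma partial_isometry_of_link p q : minimal_projection p -> minimal_projection q ->
  (exists y, q ** y ** p != 0) ->
  exists x, [/\ q ** x = x, x ** p = x, star x ** x = p & x ** star x = q].
Proof.
move=> mp mq [y y0]; have [pp p0 _] := mp; have [pq q0 minq] := mq.
pose z := q ** y ** p.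
have zp : z ** p = z by rewrite /z -star_mulA pp.2.
have qz : q ** z = z by rewrite /z !star_mulA pq.2.
have szz := minimal_projection_posl mp zp.
have nz : rnorm z != 0 by rewrite rnorm_eq0.
pose k : R[i] := ((rnorm z)^-1)%:C.
have kk : Num.conj k = k by apply/CrealP; rewrite complex_real.
pose x := k *: z.
have sxx : star x ** x = p.
  rewrite starZ star_mulZl star_mulZr szz !scalerA kk.
  suff -> : k * k * (rnorm z ^+ 2)%:C = 1 by rewrite scale1r.
  rewrite /k -!rmorphM/= -[RHS](rmorph1 (real_complex R)); congr (_%:C).
  by field.
have qx : q ** x = x by rewrite star_mulZr qz.
have xp : x ** p = x by rewrite star_mulZl zp.
exists x; split => //.
have sxq : star x ** q = star x by rewrite -[in RHS]qx starM pq.1.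
have [l lE] := minq (x ** star x).
have xxl : x ** star x = l *: q by rewrite -lE star_mulA qx -star_mulA sxq.
have xxx : (x ** star x) ** (x ** star x) = x ** star x.
  by rewrite -star_mulA (star_mulA (star x)) sxx star_mulA xp.
have l0 : l != 0.
  apply: contraNneq p0 => l0; apply/eqP/star_mul_eq0.
  rewrite pp.1 pp.2 -{1}pp.2 -{1 2}sxx -star_mulA (star_mulA x) xxl l0.
  by rewrite scale0r star_mul0l star_mul0r.
have l1 : l = 1.
  move: xxx; rewrite xxl star_mulZl star_mulZr pq.2 scalerA => /eqP.
  rewrite -subr_eq0 -scalerBl scaler_eq0 (negbTE q0) orbF subr_eq0 => /eqP ll.
  by apply: (mulfI l0); rewrite ll mulr1.
by rewrite xxl l1 scale1r.
Qed.

(* The row x is a coisometry intertwining left multiplication on F with a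
   representation by scalar matrices: each x j is a partial isometry onto one
   term of a decomposition of the unit from a representative of the equivalence
   class of that term. *)
Lemma scalar_dilation : exists (T : finType) (x : T -> F)
    (tau : F -> T -> T -> R[i]), [/\ scalar_rep tau,
    forall a j, a ** x j = \sum_i tau a i j *: x i &
    \sum_j x j ** star (x j) = u].
Proof.
have [T [q [mq qq qE]]] := minimal_projection_decomposition (unit_projection uP).
(* By [partial_isometry_of_link] this is Murray-von Neumann equivalence of minimal projections. *)
pose link i j := `[< exists y, q i ** y ** q j != 0 >].
have linkxx i : link i i.
  apply/asboolP; exists (q i); have [[_ pq] q0 _] := mq i.
  by rewrite !pq.
have linkC i j : link i j -> link j i.
  move=> /asboolP[y y0]; apply/asboolP; exists (star y).
  have [[si _] _ _] := mq i; have [[sj _] _ _] := mq j.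
  rewrite -si -sj -star_mulA -!starM; apply: contra y0 => /eqP y0.
  by rewrite -[X in X == _]starK y0 star0.
have link_trans i j k : link i j -> link j k -> link i k.
  move=> /asboolP/(partial_isometry_of_link (mq j) (mq i))[x [ix xj sxx xsx]].
  move=> /asboolP[y y0]; apply/asboolP; exists (x ** y).
  apply: contra y0 => /eqP y0.
  by rewrite -sxx -(star_mulA (star x)) -star_mulA -star_mulA (star_mulA x)
    -ix -!star_mulA (star_mulA x) (star_mulA (q i)) y0 star_mul0r.
(* A representative of the class of [i]: [pick] depends only on the predicate, and linked indices
   have the same one. *)
pose r i := odflt i [pick j | link i j].
have linkr i : link i (r i).
  by rewrite /r; case: pickP => [j //|/(_ i)]; rewrite linkxx.
have rE i j : link i j -> r i = r j.
  move=> ij; rewrite /r; have -> : [pick k | link i k] = [pick k | link j k].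
    apply: eq_pick => k; apply/idP/idP; last exact: link_trans.
    by apply: link_trans; exact: linkC.
  by case: pickP => // /(_ j); rewrite linkxx.
have rr i j : r i != r j -> forall y, q (r i) ** y ** q (r j) = 0.
  move=> rij y; apply/eqP; apply: contraT => y0.
  suff : r i = r j by move/eqP; rewrite (negbTE rij).
  apply: rE; apply: (link_trans _ (r i)) => //.
  apply: (link_trans _ (r j)); last exact: linkC.
  by apply/asboolP; exists y.
have /choice[x xP] : forall i, exists x, [/\ q i ** x = x, x ** q (r i) = x,
    star x ** x = q (r i) & x ** star x = q i].
  by move=> i; have /asboolP := linkr i; exact: partial_isometry_of_link.
have /choice[cf cfP] : forall i, exists cf : F -> R[i], forall y,
    q i ** y ** q i = cf y *: q i.
  by move=> i; have [_ _ /choice[cf cfP]] := mq i; exists cf.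
have inj i (s t : R[i]) : s *: q i = t *: q i -> s = t.
  have [_ q0 _] := mq i; move=> /eqP; rewrite -subr_eq0 -scalerBl scaler_eq0.
  by rewrite (negbTE q0) orbF subr_eq0 => /eqP.
have qx i : q (r i) ** star (x i) = star (x i).
  have [_ xq _ _] := xP i; have [[sq _] _ _] := mq (r i).
  by rewrite -[in RHS]xq starM sq.
have xq i : x i ** q (r i) = x i by have [] := xP i.
(* The element $x_i^* a x_j$ lies in the corner between [q (r i)] and [q (r j)], which is spanned by
   [q (r i)] when the representatives agree and is zero otherwise. *)
pose tau a i j : R[i] := if r i == r j then cf (r i) (star (x i) ** a ** x j) else 0.
have tauE a i j : star (x i) ** a ** x j = tau a i j *: q (r i).
  rewrite /tau; have [rij|rij] := eqVneq (r i) (r j).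
    by rewrite -cfP {2}rij -!star_mulA xq !star_mulA qx.
  rewrite scale0r -(qx i) -(xq j) !star_mulA.
  by rewrite -(star_mulA (q (r i))) -(star_mulA (q (r i))) rr.
have xx : \sum_j x j ** star (x j) = u.
  by rewrite -qE; apply: eq_bigr => j _; have [] := xP j.
have tauU a i j (s : R[i]) : star (x i) ** a ** x j = s *: q (r i) -> tau a i j = s.
  by rewrite tauE => /inj.
exists T, x, tau; split=> //; last first.
  move=> a j; rewrite -[LHS](uP _).1 -xx star_suml; apply: eq_bigr => i _.
  by rewrite -star_mulA (star_mulA (star _)) tauE star_mulZr xq.
split=> [c a b i j|a b i j|a i j]; apply: tauU.
- by rewrite star_mulDr star_mulDl star_mulZr star_mulZl !tauE scalerA -scalerDl.
- rewrite -{1}[a](uP _).2 -xx star_sumr scaler_suml !(star_sumr, star_suml).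
  apply: eq_bigr => k _.
  transitivity ((star (x i) ** a ** x k) ** (star (x k) ** b ** x j)).
    by rewrite !star_mulA.
  have [E|/negbTE N] := eqVneq (r i) (r k).
    have [[_ qrr] _ _] := mq (r i).
    by rewrite !tauE -E star_mulZl star_mulZr scalerA qrr.
  by rewrite tauE /tau N scale0r star_mul0l mul0r scale0r.
- have -> : star (x i) ** star a ** x j = star (star (x j) ** a ** x i).
    by rewrite !starM starK star_mulA.
  rewrite tauE starZ; have [[-> _] _ _] := mq (r j).
  have [->//|/negbTE N] := eqVneq (r i) (r j).
  by rewrite /tau eq_sym N rmorph0 !scale0r.
Qed.

End Dilation.

(** * Homomorphisms built from a coisometric row *)

Lemma starhomP (C : numClosedFieldType) (A B : starAlgType C) (f : A -> B) :
  (forall c x y, f (c *: x + y) = c *: f x + f y) ->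
  {morph f : x y / x ** y} -> {morph f : x / star x} ->
  exists g : {starhom A -> B}, g =1 f.
Proof.
move=> lf mf sf.
pose lf' := GRing.isLinear.Build C A B *:%R f lf.
pose mf' := isStarMorphism.Build C A B f mf sf.
pose g : {starhom A -> B} := HB.pack f lf' mf'.
by exists g.
Qed.

(** As [f] vanishes where all the coordinates [v] do, its range is spanned by the images of a family
    whose coordinate vectors have maximal rank. *)
Lemma finite_dim_range (C : numClosedFieldType) (V W : lmodType C)
    (f : {linear V -> W}) (T : finType) (v : V -> T -> C) :
  (forall c x y t, v (c *: x + y) t = c * v x t + v y t) ->
  (forall x, (forall t, v x t = 0) -> f x = 0) -> finite_dim (range f).
Proof.
move=> lv v0; pose r x : 'rV[C]_#|T| := \row_i v x (enum_val i).
have rD c x y : r (c *: x + y) = c *: r x + r y.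
  by apply/rowP => i; rewrite !mxE lv.
have r0 : r 0 = 0.
  have := rD 1 0 0; rewrite scaler0 addr0 scale1r => /eqP.
  by rewrite -{1}[r 0]addr0 (inj_eq (addrI _)) eq_sym => /eqP.
have r_sum n (c : 'I_n -> C) (x : 'I_n -> V) :
    r (\sum_i c i *: x i) = \sum_i c i *: r (x i).
  elim: n c x => [|n IH] c x; first by rewrite !big_ord0.
  by rewrite !big_ord_recl rD IH.
pose P k := `[< exists n (x : 'I_n -> V), \rank (\matrix_i r (x i)) = k >].
have exP : exists k, P k.
  by exists (\rank (\matrix_(i < 0) r 0)); apply/asboolP; exists 0%N, (fun=> 0).
have ubP k : P k -> (k <= #|T|)%N.
  by move=> /asboolP[n [x <-]]; exact: rank_leq_col.
case: (ex_maxnP exP ubP) => k /asboolP[n [x xk]] maxk.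
exists n, (f \o x); apply/seteqP; split => [_ [y _ <-]|_ [c ->]] /=; last first.
  exists (\sum_i c i *: x i) => //.
  by rewrite linear_sum; apply: eq_bigr => i _; rewrite linearZ.
have /submxP[D DE] : (r y <= \matrix_i r (x i))%MS.
  (* Adjoining [y] cannot raise the maximal rank, so [r y] lies in the span. *)
  pose x' (i : 'I_(1 + n)) := if fintype.split i is inr j then x j else y.
  have E : \matrix_i r (x' i) = col_mx (r y) (\matrix_i r (x i)).
    apply/row_matrixP => i; rewrite rowK /x' -[i in RHS]splitK.
    case: (fintype.split i) => j /=; first by rewrite rowKu [j]ord1 row_id.
    by rewrite rowKd rowK.
  have sub : (\matrix_i r (x i) <= \matrix_i r (x' i))%MS.
    by rewrite E -addsmxE addsmxSr.
  apply: (@submx_trans _ _ _ _ _ _ (\matrix_i r (x' i))).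
    by rewrite E -addsmxE addsmxSl.
  rewrite -(geq_leqif (mxrank_leqif_sup sub)) xk maxk//.
  by apply/asboolP; exists (1 + n)%N, x'.
exists (fun i => D 0 i).
have yE : r y = r (\sum_i D 0 i *: x i).
  rewrite r_sum DE mulmx_sum_row; apply: eq_bigr => i _; by rewrite rowK.
have : f (y - \sum_i D 0 i *: x i) = 0.
  apply: v0 => t; rewrite addrC -scaleN1r lv.
  have /rowP/(_ (enum_rank t)) := yE; rewrite !mxE enum_rankK => ->.
  by rewrite mulN1r addNr.
rewrite linearB linear_sum => /eqP; rewrite subr_eq0 => /eqP ->.
by apply: eq_bigr => i _; rewrite linearZ.
Qed.

Section Assembly.
Context (C : numClosedFieldType) (A : starAlgType C) (e : A) (S : finType).
Hypothesis eP : forall x, e ** x = x /\ x ** e = x.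

Definition matrix_rep (kap : A -> S -> S -> A) : Prop :=
  [/\ forall c a b i j, kap (c *: a + b) i j = c *: kap a i j + kap b i j,
      forall a b i j, kap (a ** b) i j = \sum_k kap a i k ** kap b k j &
      forall a i j, kap (star a) i j = star (kap a j i)].

Definition block_index (i : 'I_(1 + #|S|)) : unit + S :=
  match fintype.split i with inl _ => inl tt | inr j => inr (enum_val j) end.

Lemma sum_block_index (V : nmodType) (G : unit + S -> V) :
  \sum_i G (block_index i) = G (inl tt) + \sum_s G (inr s).
Proof.
rewrite big_split_ord/= big_ord1 /block_index (unsplitK (inl _)); congr (_ + _).
rewrite [RHS](big_enum_val (A := predT))/=.
by apply: eq_bigr => j _; rewrite (unsplitK (inr j)).
Qed.

Lemma block_diagE (f : A) (b : S -> S -> A) (M : matrix_alg A #|S|) i j :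
  (forall i j, M i j = b (enum_val i) (enum_val j)) ->
  (block_mx (const_mx f : 'M[A]_1) 0 0 M : 'M[A]_(1 + #|S|)) i j =
  match block_index i, block_index j with
  | inl _, inl _ => f | inr k, inr l => b k l | _, _ => 0
  end.
Proof.
move=> Mb; rewrite -[i in LHS]splitK -[j in LHS]splitK /block_index.
case: (fintype.split i) => k; case: (fintype.split j) => l /=.
- by rewrite block_mxEul mxE.
- by rewrite block_mxEur mxE.
- by rewrite block_mxEdl mxE.
- by rewrite block_mxEdr Mb.
Qed.

Context (gam : {starhom A -> A}) (kap : A -> S -> S -> A) (om : S -> A).
Hypothesis kap_rep : matrix_rep kap.
Hypothesis om_kap : forall f j, gam f ** om j = \sum_k om k ** kap f k j.
Hypothesis om_unit : \sum_j om j ** star (om j) = e.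

Let kap_om f i : \sum_k kap f i k ** star (om k) = star (om i) ** gam f.
Proof.
have [_ _ ks] := kap_rep.
rewrite -[gam f]starK -starM -starhom_star om_kap star_sum.
by apply: eq_bigr => k _; rewrite starM ks starK.
Qed.

(* the compression of kap to the complement of the range of the isometry om^* *)
Definition complement_entry f i j := kap f i j - star (om i) ** gam f ** om j.

(** In the product of two entries the mixed terms and the product of the compressions all equal
    $om_i^* \, gam(x) gam(y) \, om_j$, by [om_kap], its adjoint and [om_unit]; one such term
    survives with a minus sign. *)
Lemma complement_hom : exists rho : {starhom A -> matrix_alg A #|S|},
  forall f i j, rho f i j = complement_entry f (enum_val i) (enum_val j).
Proof.
have [kl km ks] := kap_rep.
pose r f : matrix_alg A #|S| :=
  \matrix_(i, j) complement_entry f (enum_val i) (enum_val j).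
have [|||rho rhoE] := @starhomP C A (matrix_alg A #|S|) r.
- move=> c x y; apply/matrixP => i j; rewrite !mxE /complement_entry kl linearP.
  rewrite star_mulDr star_mulDl star_mulZr star_mulZl scalerBr opprD.
  by rewrite addrACA.
- move=> x y; apply/matrixP => i j; rewrite !mxE.
  transitivity (\sum_k complement_entry x (enum_val i) k **
                       complement_entry y k (enum_val j)); last first.
    rewrite (big_enum_val (A := predT))/=.
    by apply: eq_bigr => k _; rewrite !mxE.
  move: (enum_val i) (enum_val j) => {}i {}j; rewrite /complement_entry km.
  under [RHS]eq_bigr do rewrite star_mulrBl !star_mulrBr.
  rewrite !sumrB.
  have -> : \sum_k kap x i k ** (star (om k) ** gam y ** om j) =
      star (om i) ** gam x ** gam y ** om j.
    rewrite -kap_om !star_suml; apply: eq_bigr => k _.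
    by rewrite !star_mulA.
  have -> : \sum_k star (om i) ** gam x ** om k ** kap y k j =
      star (om i) ** gam x ** gam y ** om j.
    rewrite -[in RHS]star_mulA om_kap star_sumr.
    by apply: eq_bigr => k _; rewrite !star_mulA.
  have -> : \sum_k star (om i) ** gam x ** om k ** (star (om k) ** gam y ** om j) =
      star (om i) ** gam x ** gam y ** om j.
    rewrite -[X in _ = X ** gam y ** om j](eP _).2 -om_unit star_sumr !star_suml.
    by apply: eq_bigr => k _; rewrite !star_mulA.
  by rewrite subrr subr0 starhomM !star_mulA.
- move=> x; apply/matrixP => i j; rewrite !mxE /complement_entry.
  by rewrite ks starD starN starhom_star !starM starK star_mulA.
by exists rho => f i j; rewrite rhoE mxE.
Qed.

Context (kap' : A -> S -> S -> C) (W : S -> S -> A).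
Hypothesis kap'_rep : scalar_rep kap'.
Hypothesis W_unitary : forall i j, \sum_k star (W k i) ** W k j = (i == j)%:R *: e.

(** The isometry from $A^S$ to $A \oplus A^S$ whose components are the row [om] and the projection
    $1 - om^* om$. It carries [kap] to the direct sum of [gam] and its complementary compression. *)
Definition dilation_entry (o : unit + S) (k : S) : A :=
  match o with inl _ => om k | inr i => (i == k)%:R *: e - star (om i) ** om k end.

Let J := dilation_entry.

Let JJ k l : \sum_i star (J (block_index i) k) ** J (block_index i) l =
  (k == l)%:R *: e.
Proof.
rewrite (sum_block_index (fun o => star (J o k) ** J o l))/=.
have es : star e = e by exact: star_unit.
have -> : \sum_s star ((s == k)%:R *: e - star (om s) ** om k) **
    ((s == l)%:R *: e - star (om s) ** om l) =
  \sum_s (((s == k)%:R * (s == l)%:R) *: e - (s == k)%:R *: (star (om s) ** om l)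
   - (s == l)%:R *: (star (om k) ** om s)
   + star (om k) ** om s ** star (om s) ** om l).
  apply: eq_bigr => s _; rewrite starD starN starZ starM starK es conjC_nat.
  rewrite star_mulrBl !star_mulrBr !star_mulZl !star_mulZr (eP e).1 scalerA.
  by rewrite (eP _).1 (eP _).2 !star_mulA opprB addrA addrAC.
rewrite big_split/= !sumrB.
have -> : \sum_s star (om k) ** om s ** star (om s) ** om l = star (om k) ** om l.
  rewrite -[X in _ = X ** om l](eP _).2 -om_unit star_sumr star_suml.
  by apply: eq_bigr => s _; rewrite !star_mulA.
have sumd (x : S) (G : S -> A) : \sum_s (s == x)%:R *: G s = G x.
  rewrite (bigD1 x)//= eqxx scale1r big1 ?addr0// => s /negbTE->.
  by rewrite scale0r.
rewrite !sumd.
under eq_bigr do rewrite -scalerA.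
by rewrite sumd subrK addrC subrK.
Qed.

Definition conjugator (i : 'I_(1 + #|S|)) (k : S) : A :=
  \sum_l J (block_index i) l ** W l k.

Let conjugator_isometry k l :
  \sum_i star (conjugator i k) ** conjugator i l = (k == l)%:R *: e.
Proof.
rewrite -W_unitary.
transitivity (\sum_i \sum_m \sum_n star (W m k) **
   (star (J (block_index i) m) ** J (block_index i) n) ** W n l).
  apply: eq_bigr => i _; rewrite star_sum star_suml; apply: eq_bigr => m _.
  rewrite star_sumr; apply: eq_bigr => n _.
  by rewrite starM !star_mulA.
rewrite exchange_big/=; apply: eq_bigr => m _.
rewrite exchange_big/= (bigD1 m)//= [X in _ + X]big1 ?addr0.
  by rewrite -star_suml -star_sumr JJ eqxx scale1r (eP _).2.
move=> n nm; rewrite -star_suml -star_sumr JJ eq_sym (negbTE nm) scale0r.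
by rewrite star_mul0r star_mul0l.
Qed.

Definition conjugate_entry f i j : A :=
  \sum_k \sum_l kap' f k l *: (conjugator i k ** star (conjugator j l)).

(** Multiplicativity holds because [conjugator] is an isometry. The range is finite dimensional
    because [mu f] depends on [f] only through the finitely many scalars [kap' f k l]. *)
Lemma finite_dim_hom : exists mu : {starhom A -> matrix_alg A #|S|.+1},
  finite_dim (range mu) /\ forall f i j, mu f i j = conjugate_entry f i j.
Proof.
have [kl km ks] := kap'_rep.
pose m f : matrix_alg A #|S|.+1 := \matrix_(i, j) conjugate_entry f i j.
have [|||mu muE] := @starhomP C A (matrix_alg A #|S|.+1) m.
- move=> c x y; apply/matrixP => i j; rewrite !mxE /conjugate_entry scaler_sumr.
  rewrite -big_split; apply: eq_bigr => k _; rewrite scaler_sumr -big_split.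
  by apply: eq_bigr => l _; rewrite kl scalerDl scalerA.
- move=> x y; apply/matrixP => i j; rewrite !mxE /conjugate_entry.
  under [RHS]eq_bigr do rewrite !mxE /conjugate_entry star_suml.
  rewrite [RHS]exchange_big/=; apply: eq_bigr => k _.
  transitivity (\sum_(n < #|S|.+1) \sum_l \sum_k' \sum_l'
     (kap' x k l * kap' y k' l') *: (conjugator i k **
       (star (conjugator n l) ** conjugator n k') ** star (conjugator j l'))).
    rewrite exchange_big/=.
    under [RHS]eq_bigr do rewrite exchange_big/=.
    transitivity (\sum_l \sum_k' \sum_l' (kap' x k l * kap' y k' l') *:
     (conjugator i k ** ((l == k')%:R *: e) ** star (conjugator j l'))).
      under [LHS]eq_bigr do rewrite km scaler_suml.
      rewrite exchange_big/=; apply: eq_bigr => l _.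
      rewrite [RHS](bigD1 l)//= [X in _ = _ + X]big1 ?addr0.
        by apply: eq_bigr => l' _; rewrite eqxx scale1r (eP _).2.
      move=> k' k'l; apply: big1 => l' _; rewrite eq_sym (negbTE k'l) scale0r.
      by rewrite star_mul0r star_mul0l scaler0.
    apply: eq_bigr => l _; apply: eq_bigr => k' _; rewrite exchange_big/=.
    apply: eq_bigr => l' _; rewrite -conjugator_isometry star_sumr star_suml.
    by rewrite scaler_sumr.
  apply: eq_bigr => n _; rewrite [RHS]star_suml; apply: eq_bigr => l _.
  rewrite [RHS]star_sumr; apply: eq_bigr => k' _; rewrite [RHS]star_sumr.
  apply: eq_bigr => l' _; rewrite star_mulZl star_mulZr scalerA.
  by rewrite !star_mulA.
- move=> x; apply/matrixP => i j; rewrite !mxE /conjugate_entry.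
  rewrite [RHS]star_sum exchange_big/=; apply: eq_bigr => k _.
  rewrite [RHS]star_sum; apply: eq_bigr => l _.
  by rewrite ks starZ starM starK.
exists mu; split; last by move=> f i j; rewrite muE mxE.
apply: (@finite_dim_range _ _ _ mu (S * S)%type (fun f kl => kap' f kl.1 kl.2)).
  by move=> c x y t; rewrite kl.
move=> x x0; transitivity (m x); first exact: muE.
apply/matrixP => i j; rewrite !mxE /conjugate_entry.
apply: big1 => k _; apply: big1 => l _.
by rewrite (x0 (k, l)) scale0r.
Qed.

(** Conjugation by the isometry [J] gives $J \, kap \, J^* = gam \oplus M$, so the error consists of
    [f - gam f] in the corner and of the conjugate by [J] of $kap - W kap' W^*$. *)
Lemma block_diag_sub_conjugate f (M : matrix_alg A #|S|) i j :
  (forall i j, M i j = complement_entry f (enum_val i) (enum_val j)) ->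
  (block_mx (const_mx f : 'M[A]_1) 0 0 M : 'M[A]_(1 + #|S|)) i j -
    conjugate_entry f i j =
  (if (block_index i, block_index j) is (inl _, inl _) then f - gam f else 0) +
  \sum_k \sum_l J (block_index i) k **
    (kap f k l - \sum_m \sum_n kap' f m n *: (W k m ** star (W l n))) **
    star (J (block_index j) l).
Proof.
move=> ME; rewrite (block_diagE _ _ _ ME).
have -> : conjugate_entry f i j = \sum_k \sum_l J (block_index i) k **
    (\sum_m \sum_n kap' f m n *: (W k m ** star (W l n))) **
    star (J (block_index j) l).
  have JW i' k : conjugator i' k = \sum_l J (block_index i') l ** W l k by [].
  rewrite /conjugate_entry.
  under [RHS]eq_bigr => k _ do under eq_bigr => l _ do
    (rewrite star_sumr star_suml; under eq_bigr => m _ do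
      rewrite star_sumr star_suml).
  rewrite [RHS](eq_bigr (fun k => \sum_m \sum_n \sum_l J (block_index i) k **
    (kap' f m n *: (W k m ** star (W l n))) ** star (J (block_index j) l))); last first.
    by move=> k _; rewrite exchange_big; apply: eq_bigr => m _; rewrite exchange_big.
  rewrite [RHS]exchange_big; apply: eq_bigr => m _.
  rewrite [RHS]exchange_big; apply: eq_bigr => n _.
  rewrite !JW star_sum star_suml scaler_sumr; apply: eq_bigr => k _.
  rewrite star_sumr scaler_sumr; apply: eq_bigr => l _.
  by rewrite starM star_mulZr star_mulZl !star_mulA.
have -> : \sum_k \sum_l J (block_index i) k **
    (kap f k l - \sum_m \sum_n kap' f m n *: (W k m ** star (W l n))) **
    star (J (block_index j) l) =
  \sum_k \sum_l J (block_index i) k ** kap f k l ** star (J (block_index j) l) -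
  \sum_k \sum_l J (block_index i) k **
    (\sum_m \sum_n kap' f m n *: (W k m ** star (W l n))) **
    star (J (block_index j) l).
  rewrite -sumrB; apply: eq_bigr => k _; rewrite -sumrB; apply: eq_bigr => l _.
  by rewrite star_mulrBr star_mulrBl.
rewrite addrA; congr (_ - _).
(* The two components of [J] have orthogonal ranges since $om \, om^* = 1$; this kills the
   off-diagonal blocks. *)
have omJ k : \sum_l om l ** star (J (inr k) l) = 0.
  under eq_bigr => l _ do rewrite /J/= starD starN starZ conjC_nat starM starK
    star_mulrBr star_mulZr (star_unit eP) (eP _).2 star_mulA.
  rewrite sumrB (bigD1 k)//= eqxx scale1r big1 ?addr0 => [|l /negbTE lk].
    by rewrite -star_suml om_unit (eP _).1 subrr.
  by rewrite eq_sym lk scale0r.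
have omJ0 k : \sum_l J (inr k) l ** star (om l) = 0.
  transitivity (star (\sum_l om l ** star (J (inr k) l))).
    by rewrite star_sum; apply: eq_bigr => l _; rewrite starM starK.
  by rewrite omJ star0.
have omkap l : \sum_k om k ** kap f k l = gam f ** om l by rewrite om_kap.
have -> : \sum_k \sum_l J (block_index i) k ** kap f k l ** star (J (block_index j) l)
  = match block_index i, block_index j with
  | inl _, inl _ => gam f
  | inr k, inr l => complement_entry f k l | _, _ => 0 end.
  case: (block_index i) => [[]|i']; case: (block_index j) => [[]|j'].
  - rewrite exchange_big/=; under eq_bigr do rewrite -star_suml omkap -star_mulA.
    by rewrite -star_sumr om_unit (eP _).2.
  - rewrite exchange_big/=; under eq_bigr do rewrite -star_suml omkap -star_mulA.
    by rewrite -star_sumr omJ star_mul0r.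
  - under eq_bigr do (under eq_bigr do rewrite -star_mulA;
    rewrite -star_sumr kap_om star_mulA).
    by rewrite -star_suml omJ0 star_mul0l.
  - have Jkap l : \sum_k J (inr i') k ** kap f k l =
        kap f i' l - star (om i') ** gam f ** om l.
      under eq_bigr => k _ do rewrite /J/= star_mulrBl star_mulZl (eP _).1.
      rewrite sumrB (bigD1 i')//= eqxx scale1r [X in _ + X - _]big1 ?addr0.
        rewrite -star_mulA om_kap star_sumr; congr (_ - _).
        by apply: eq_bigr => k _; rewrite star_mulA.
      by move=> k ki; rewrite eq_sym (negbTE ki) scale0r.
    rewrite exchange_big/=; under eq_bigr do rewrite -star_suml Jkap star_mulrBl.
    rewrite sumrB; under [X in _ - X]eq_bigr do rewrite -star_mulA.
    rewrite -star_sumr omJ star_mul0r subr0 /complement_entry -kap_om star_suml.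
    under eq_bigr => l _ do rewrite /J/= starD starN starZ conjC_nat starM starK
      star_mulrBr star_mulZr (star_unit eP) (eP _).2 star_mulA.
    rewrite sumrB (bigD1 j')//= eqxx scale1r [X in _ + X - _]big1 ?addr0//.
    by move=> l lj; rewrite eq_sym (negbTE lj) scale0r.
by case: (block_index i) => [[]|i']; case: (block_index j) => [[]|j'];
  rewrite ?add0r// subrK.
Qed.

End Assembly.

(** * Norm estimates *)

(** Weighted Cauchy-Schwarz bounds each square by [r] times a weighted sum of squares; the column
    sums give the second factor [r]. *)
Lemma schur_test (R : realType) (I J : finType) (B : I -> J -> R) (a : J -> R)
    (r : R) : (forall i j, 0 <= B i j) ->
  (forall i, \sum_j B i j <= r) -> (forall j, \sum_i B i j <= r) ->
  \sum_i (\sum_j B i j * a j) ^+ 2 <= r ^+ 2 * \sum_j a j ^+ 2.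
Proof.
move=> B0 rows cols.
have CS i : (\sum_j B i j * a j) ^+ 2 <= r * \sum_j B i j * a j ^+ 2.
  set y := \sum_j _; set z := \sum_j _.
  have r0 : 0 <= r by apply: le_trans (rows i); rewrite sumr_ge0.
  (* Expanding, with row sum at most [r], gives $r y^2 \le r^2 z$. *)
  have : 0 <= \sum_j B i j * (r * a j - y) ^+ 2.
    by apply: sumr_ge0 => j _; rewrite mulr_ge0// sqr_ge0.
  have -> : \sum_j B i j * (r * a j - y) ^+ 2 =
      r ^+ 2 * z - 2 * r * y * y + y ^+ 2 * \sum_j B i j.
    have E (t : R) : \sum_j B i j * (r * a j - t) ^+ 2 =
        r ^+ 2 * z - 2 * r * t * y + t ^+ 2 * \sum_j B i j.
      rewrite /z /y !mulr_sumr -sumrB -big_split/=; apply: eq_bigr => j _.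
      by ring.
    exact: E.
  have := ler_wpM2l (sqr_ge0 y) (rows i).
  move: (rows i); set s := \sum_j B i j => sr ysr H.
  have [r00|r1] := eqVneq r 0.
    have Bi0 j : B i j = 0.
      apply/eqP; rewrite eq_le B0 andbT -r00.
      by apply: le_trans sr; rewrite /s (bigD1 j)//= lerDl sumr_ge0.
    suff -> : y = 0 by rewrite expr0n r00 mul0r.
    by apply: big1 => j _; rewrite Bi0 mul0r.
  have {r1}r0 : 0 < r by rewrite lt_neqAle eq_sym r1.
  by rewrite -(ler_pM2l r0); nra.
apply: (@le_trans _ _ (\sum_i r * \sum_j B i j * a j ^+ 2)).
  by apply: ler_sum => i _; exact: CS.
rewrite -mulr_sumr expr2 -mulrA.
(* The sign of [r] is read off a row, so an empty [I] is treated apart. *)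
have [[i0 _]|noI] := pselect (exists i : I, true); last first.
  rewrite [X in r * X]big1; last by move=> i; case: noI; exists i.
  rewrite mulr0 mulrA -expr2 mulr_ge0 ?sqr_ge0// sumr_ge0// => j _.
  exact: sqr_ge0.
have r0 : 0 <= r by apply: le_trans (rows i0); rewrite sumr_ge0.
rewrite ler_wpM2l// exchange_big/= mulr_sumr; apply: ler_sum => j _.
by rewrite -mulr_suml ler_wpM2r// sqr_ge0.
Qed.

(** The left-hand norm is attained at a minimal projection [p]. Multiplying by [p] leaves the
    numerical Schur test for the norms of [v j ** p], whose squares sum to at most the norm of
    $\sum_j v_j^* v_j$. *)
Lemma rnorm_schur (R : realType) (F : finCStarAlgType R) (u : F)
    (I J : finType) (T : I -> J -> F) (v : J -> F) (r : R) :
  (forall x, u ** x = x /\ x ** u = x) ->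
  (forall i, \sum_j rnorm (T i j) <= r) -> (forall j, \sum_i rnorm (T i j) <= r) ->
  rnorm (\sum_i star (\sum_j T i j ** v j) ** (\sum_j T i j ** v j)) <=
  r ^+ 2 * rnorm (\sum_j star (v j) ** v j).
Proof.
move=> uP rows cols; set b := \sum_i _.
have [->|b0] := eqVneq b 0; first by rewrite rnorm0 mulr_ge0 ?sqr_ge0 ?rnorm_ge0.
have [p mp /le_trans->//] :=
  norm_attained_at_minimal_projection uP (x := fun i => \sum_j T i j ** v j) b0.
apply: le_trans (ler_wpM2l (sqr_ge0 _) (minimal_projection_norm_le v mp)).
apply: le_trans (schur_test (fun j => rnorm (v j ** p)) _ rows cols) => //; last first.
  by move=> i j; exact: rnorm_ge0.
apply: ler_sum => i _; rewrite ler_sqr ?nnegrE ?rnorm_ge0 ?sumr_ge0//; last first.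
  by move=> j _; rewrite mulr_ge0 ?rnorm_ge0.
rewrite star_suml (le_trans (ler_rnorm_sum _))//; apply: ler_sum => j _.
by rewrite -star_mulA ler_rnorm_mul.
Qed.

(** * Uniform continuity on the unit interval *)

Section UniformContinuity.
Context (R : realType) (V : normedModType R[i]).

Lemma itv_uniform_continuity (F : R -> V) (e : R) : continuous F -> 0 < e ->
  exists2 d, 0 < d & forall s t, 0 <= s <= 1 -> `|s - t| < d -> rnorm (F s - F t) < e.
Proof.
move=> cF e0.
have e20 : 0 < e / 2 by rewrite divr_gt0.
have /compact_near_coveringP := @segment_compact R 0 1.
move=> /(_ R (0^'+) (fun d s => forall t, `|s - t| < d -> rnorm (F s - F t) < e)).
have FF : Filter (0 : R)^'+ by exact: at_right_proper_filter.
move=> /(_ FF) H.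
have : \forall d \near 0^'+, (`[0, 1] : set R) `<=`
    (fun s => forall t, `|s - t| < d -> rnorm (F s - F t) < e).
  apply: H => x _.
  have /cvg_rnormP/cvgrPdist_lt/(_ _ e20) := cF x.
  move=> /nbhs_ballP[h /= h0 hP].
  have h20 : 0 < h / 2 by rewrite divr_gt0.
  have hP' t : `|x - t| < h -> rnorm (F x - F t) < e / 2.
    by move=> xt; have := hP t xt; rewrite sub0r normrN ger0_norm// rnorm_ge0.
  exists (ball x (h / 2), [set d | d < h / 2]).
    split; first exact: nbhsx_ballx.
    exact: nbhs_right_lt.
  move=> [s d] [/= xs dh] t st.
  have xs' : `|x - s| < h by apply: lt_trans xs _; rewrite ltr_pdivrMr// ltr_pMr// ltr1n.
  have xt : `|x - t| < h.
    rewrite -[x](subrK s) -addrA (le_lt_trans (ler_normD _ _))//.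
    by rewrite (splitr h) ltrD// (lt_trans st).
  have -> : F s - F t = - (F x - F s) + (F x - F t) by rewrite opprB addrA subrK.
  rewrite (le_lt_trans (ler_rnormD _ _))// rnormN (splitr e) ltrD//; exact: hP'.
move=> near_d; have gt0 : \forall d \near (0 : R)^'+, 0 < d by exact: nbhs_right_gt.
have [d [dP d0]] := filter_ex (filterI near_d gt0).
by exists d => // s t s01; apply: dP; rewrite /= in_itv.
Qed.

End UniformContinuity.

(** * Elements of an NCCW complex *)

Section Clamp.
Context (R : realType).
Implicit Types s t : R.

(** The retraction of the line onto $[0,1]$ lets functions on the subtype [unit_itv R] be handled as
    functions of a real variable. *)
Definition clamp s : R := Num.max 0 (Num.min s 1).

Lemma clampP s : 0 <= clamp s <= 1.
Proof. by rewrite /clamp; case: (leP s 1) => h1;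
  [case: (leP 0 s)|case: (leP 0 (1 : R))] => h0; lra. Qed.

Lemma clamp_id s : 0 <= s <= 1 -> clamp s = s.
Proof. by rewrite /clamp; case: (leP s 1) => h1;
  [case: (leP 0 s)|case: (leP 0 (1 : R))] => h0; lra. Qed.

Lemma clamp_le0 s : s <= 0 -> clamp s = 0.
Proof. by rewrite /clamp; case: (leP s 1) => h1;
  [case: (leP 0 s)|case: (leP 0 (1 : R))] => h0; lra. Qed.

Lemma clamp_ge1 s : 1 <= s -> clamp s = 1.
Proof. by rewrite /clamp; case: (leP s 1) => h1;
  [case: (leP 0 s)|case: (leP 0 (1 : R))] => h0; lra. Qed.

Lemma clamp_continuous : continuous clamp.
Proof.
move=> s; apply: (@continuous_max R _ (fun=> 0) (fun t => Num.min t 1)).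
  exact: cvg_cst.
by apply: continuous_min; [exact: cvg_id|exact: cvg_cst].
Qed.

Lemma clamp_subproof s : clamp s \in unit_itv R.
Proof. by rewrite inE /unit_itv/= in_itv/= clampP. Qed.

Definition itv_clamp s : unit_itv R := SigSub (clamp_subproof s).

Lemma set_val_itv_clamp s : set_val (itv_clamp s) = clamp s.
Proof. by []. Qed.

Lemma itv_clamp_continuous : continuous itv_clamp.
Proof. by apply: continuous_comp_initial; exact: clamp_continuous. Qed.

Lemma unit_itv_bounds (t : unit_itv R) : 0 <= set_val t <= 1.
Proof. by case: t => t tI; have := set_mem tI; rewrite /unit_itv/= in_itv. Qed.

Lemma itv_clampK (t : unit_itv R) : itv_clamp (set_val t) = t.
Proof.
apply/val_inj; rewrite -!set_valE set_val_itv_clamp clamp_id//.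
exact: unit_itv_bounds.
Qed.

Lemma itv_clamp0 : itv_clamp 0 = itv_left R.
Proof. by rewrite -[RHS]itv_clampK. Qed.

Lemma itv_clamp1 : itv_clamp 1 = itv_right R.
Proof. by rewrite -[RHS]itv_clampK. Qed.

Lemma set_val_itv_continuous : continuous (set_val : unit_itv R -> R).
Proof. exact: initial_continuous. Qed.

End Clamp.

Lemma real_complex_continuous (R : realType) (c : R -> R) :
  continuous c -> continuous (fun s => (c s)%:C : R[i]^o).
Proof.
move=> cc s; have /cvgrPdist_lt H := cc s.
apply/(@cvgrPdist_lt _ R[i]^o) => e /gt0_complexE[r r0 ->].
apply: filterS (H _ r0) => t.
by rewrite -rmorphB/= normc_def/= expr0n/= addr0 sqrtr_sqr ltcR.
Qed.

Section NccwTheory.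
Context (R : realType) (F1 F2 : finCStarAlgType R).
Context (phi0 phi1 : {starhom F1 -> F2}).
Local Notation A := (nccw phi0 phi1).
Implicit Types x y : A.

Lemma nccw_fun_sum I (r : seq I) (P : pred I) (G : I -> A) t :
  (nccw_val (\sum_(i <- r | P i) G i)).1 t =
  \sum_(i <- r | P i) (nccw_val (G i)).1 t.
Proof.
apply: (big_morph (fun x : A => (nccw_val x).1 t)) => [x y|].
  by rewrite nccw_valD.
by rewrite -(subrr (0 : A)) nccw_valB/= fctE subrr.
Qed.

Lemma nccw_pt_sum I (r : seq I) (P : pred I) (G : I -> A) :
  (nccw_val (\sum_(i <- r | P i) G i)).2 =
  \sum_(i <- r | P i) (nccw_val (G i)).2.
Proof.
apply: (big_morph (fun x : A => (nccw_val x).2)) => [x y|].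
  by rewrite nccw_valD.
by rewrite -(subrr (0 : A)) nccw_valB/= subrr.
Qed.

Lemma nccw_fun_lin (k : R[i]) x y t : (nccw_val (k *: x + y)).1 t =
  k *: (nccw_val x).1 t + (nccw_val y).1 t.
Proof. by rewrite nccw_valD nccw_valZ. Qed.

Lemma nccw_fun_sub x y t : (nccw_val (x - y)).1 t =
  (nccw_val x).1 t - (nccw_val y).1 t.
Proof. by rewrite nccw_valB. Qed.

Lemma nccw_fun_scale (k : R[i]) x t : (nccw_val (k *: x)).1 t =
  k *: (nccw_val x).1 t.
Proof. by rewrite nccw_valZ. Qed.

Lemma nccw_pt_lin (k : R[i]) x y : (nccw_val (k *: x + y)).2 =
  k *: (nccw_val x).2 + (nccw_val y).2.
Proof. by rewrite nccw_valD nccw_valZ. Qed.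

Lemma nccw_path (c : R -> F2) (a : F1) : continuous c -> c 0 = phi0 a ->
  c 1 = phi1 a -> exists x : A,
  (forall t, (nccw_val x).1 t = c (set_val t)) /\ (nccw_val x).2 = a.
Proof.
move=> cc c0 c1.
have xP : ((fun t : unit_itv R => c (set_val t), a) : (unit_itv R -> F2) * F1) \in
    nccw_pred phi0 phi1.
  apply/nccw_predP; split => //= t; apply: continuous_comp; last exact: cc.
  exact: set_val_itv_continuous.
by exists (Nccw xP).
Qed.

Lemma nccw_lift x : exists2 c : R -> F2, continuous c &
  forall s, c s = (nccw_val x).1 (itv_clamp s).
Proof.
exists (fun s => (nccw_val x).1 (itv_clamp s)) => // s.
by apply: continuous_comp; [exact: itv_clamp_continuous|exact: nccw_continuous].
Qed.

Lemma rscale_continuous (c : R -> R) (f : R -> F2) :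
  continuous c -> continuous f -> continuous (fun s => (c s)%:C *: f s).
Proof.
move=> cc cf s; apply: (@cvgZ _ F2 _ _ _ _ _ _ _ _ (cf s)).
exact: real_complex_continuous.
Qed.

(** Evaluation in [F1] and at interior points of the interval is onto, so the unit of [A] takes unit
    values there. Continuity extends this to the ends, which makes [phi0] and [phi1] unital. *)
Lemma nccw_units : unital A -> exists (u1 : F1) (u2 : F2),
  [/\ forall a, u1 ** a = a /\ a ** u1 = a,
      forall b, u2 ** b = b /\ b ** u2 = b, phi0 u1 = u2 & phi1 u1 = u2].
Proof.
move=> [e eP].
have u1P a : (nccw_val e).2 ** a = a /\ a ** (nccw_val e).2 = a.
  (* The segment from [phi0 a] to [phi1 a] lies over [a]. *)
  have [|||x [_ xa]] := @nccw_path (fun s => (1 - s)%:C *: phi0 a + s%:C *: phi1 a) a.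
  - move=> s; apply: cvgD.
      apply: (@rscale_continuous (fun t => 1 - t) (fun=> phi0 a)).
        by move=> t; apply: cvgB; [exact: cvg_cst|exact: cvg_id].
      by move=> t; exact: cvg_cst.
    apply: (@rscale_continuous id (fun=> phi1 a)); first by move=> t; exact: cvg_id.
    by move=> t; exact: cvg_cst.
  - by rewrite subr0 scale1r scale0r addr0.
  - by rewrite subrr scale1r scale0r add0r.
  by have [ex xe] := eP x; rewrite -xa -[in RHS]ex -[in X in _ /\ _ = X]xe.
have inner s b : 0 < s < 1 -> (nccw_val e).1 (itv_clamp s) ** b = b /\
    b ** (nccw_val e).1 (itv_clamp s) = b.
  move=> s01.
  (* The factor vanishes at the ends and is invertible inside. *)
  have [|||x [xf _]] := @nccw_path (fun s => (s * (1 - s))%:C *: b) 0.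
  - apply: rscale_continuous; last by move=> t; exact: cvg_cst.
    move=> t; apply: cvgM; first exact: cvg_id.
    by apply: cvgB; [exact: cvg_cst|exact: cvg_id].
  - by rewrite mul0r scale0r linear0.
  - by rewrite subrr mulr0 scale0r linear0.
  have k0 : (s * (1 - s))%:C != 0 :> R[i].
    by rewrite (inj_eq (@complexI _) _ 0) mulf_neq0//; apply/eqP; lra.
  have [ex xe] := eP x.
  have xs : (nccw_val x).1 (itv_clamp s) = (s * (1 - s))%:C *: b.
    by rewrite xf set_val_itv_clamp clamp_id//; lra.
  have := congr1 (fun y => (nccw_val y).1 (itv_clamp s)) ex.
  have := congr1 (fun y => (nccw_val y).1 (itv_clamp s)) xe.
  rewrite /= xs star_mulZl star_mulZr => /(scalerI k0) ? /(scalerI k0) ?.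
  by split.
pose u2 := (nccw_val e).1 (itv_clamp 2^-1).
have half : 0 < (2^-1 : R) < 1 by lra.
have u2P b := inner _ b half.
have uE s : 0 < s < 1 -> (nccw_val e).1 (itv_clamp s) = u2.
  by move=> s01; rewrite -[LHS](u2P _).1 (inner _ _ s01).2.
have [c cc cE] := nccw_lift e.
have dense s0 : 0 <= s0 <= 1 -> c s0 = u2.
  move=> s01; apply/eqP; rewrite -subr_eq0 -rnorm_eq0; apply: contraT => n0.
  have {}n0 : 0 < rnorm (c s0 - u2) by rewrite lt_neqAle eq_sym n0 rnorm_ge0.
  have [d d0 dP] := itv_uniform_continuity cc n0.
  (* Moving from [s0] by [h / 2] towards the midpoint reaches an interior point at distance less
     than [d]. *)
  pose h := Num.min (d / 2) (2^-1).
  pose s := if s0 <= 2^-1 then s0 + h / 2 else s0 - h / 2.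
  have h0 : 0 < h by rewrite lt_min divr_gt0//=; lra.
  have hd : h <= d / 2 by rewrite ge_min lexx.
  have h1 : h <= 2^-1 by rewrite ge_min lexx orbT.
  have s01' : 0 < s < 1 by rewrite /s; case: (leP s0 2^-1) => ?; clearbody h; lra.
  have := dP s0 s s01; rewrite [c s]cE uE// ltxx => -> //.
  by rewrite /s ltr_norml; case: (leP s0 2^-1) => ?; clearbody h; lra.
exists (nccw_val e).2, u2; split => //.
- by rewrite -nccw_left -itv_clamp0 -cE dense// lexx ler01.
- by rewrite -nccw_right -itv_clamp1 -cE dense// lexx ler01.
Qed.

(** The norm of [A] is computed fibrewise, so [rnorm_schur] in each fibre suffices. *)
Lemma matrix_norm_le (u1 : F1) (u2 : F2) (n : nat) (T : matrix_alg A n) (r : R) :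
  (forall a, u1 ** a = a /\ a ** u1 = a) ->
  (forall b, u2 ** b = b /\ b ** u2 = b) -> 0 <= r ->
  (forall t i, \sum_j rnorm ((nccw_val (T i j)).1 t) <= r) ->
  (forall t j, \sum_i rnorm ((nccw_val (T i j)).1 t) <= r) ->
  (forall i, \sum_j rnorm (nccw_val (T i j)).2 <= r) ->
  (forall j, \sum_i rnorm (nccw_val (T i j)).2 <= r) ->
  (matrix_norm T <= r%:E)%E.
Proof.
move=> u1P u2P r0 rows cols rows2 cols2.
apply: ub_ereal_sup => _ [v /= v1 <-]; rewrite lee_fin.
rewrite -[leRHS]ger0_norm// -sqrtr_sqr ler_wsqrtr//.
apply: (@le_trans _ _ (r ^+ 2 * rnorm (col_dot v v))); last first.
  by rewrite ler_piMr ?sqr_ge0.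
have sv t : \sum_j star ((nccw_val (v j 0)).1 t) ** (nccw_val (v j 0)).1 t =
    (nccw_val (col_dot v v)).1 t by rewrite nccw_fun_sum.
have sv2 : \sum_j star (nccw_val (v j 0)).2 ** (nccw_val (v j 0)).2 =
    (nccw_val (col_dot v v)).2 by rewrite nccw_pt_sum.
apply/nccw_normP; split=> [t|].
  apply: (@le_trans _ _ (r ^+ 2 * rnorm ((nccw_val (col_dot v v)).1 t))); last first.
    by rewrite ler_wpM2l ?sqr_ge0//; exact: nccw_norm_fun.
  rewrite -sv.
  apply: le_trans (rnorm_schur (fun j => (nccw_val (v j 0)).1 t) u2P (rows t) (cols t)).
  rewrite nccw_fun_sum /= le_eqVlt; apply/orP; left; apply/eqP; congr rnorm.
  by apply: eq_bigr => i _; rewrite !mxE nccw_fun_sum.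
apply: (@le_trans _ _ (r ^+ 2 * rnorm (nccw_val (col_dot v v)).2)); last first.
  by rewrite ler_wpM2l ?sqr_ge0//; exact: nccw_norm_pt.
rewrite -sv2.
apply: le_trans (rnorm_schur (fun j => (nccw_val (v j 0)).2) u1P rows2 cols2).
rewrite nccw_pt_sum /= le_eqVlt; apply/orP; left; apply/eqP; congr rnorm.
by apply: eq_bigr => i _; rewrite !mxE nccw_pt_sum.
Qed.

End NccwTheory.

(** * A path of orthogonal matrices *)

Lemma sum_eq_le1 (R : realType) (I : finType) (f : I -> nat) (m : nat) :
  injective f -> \sum_i (f i == m)%:R <= 1 :> R.
Proof.
move=> fI; have [[i0 i0m]|noi] := pselect (exists i0, f i0 = m).
  rewrite (bigD1 i0)//= i0m eqxx big1 ?addr0// => i ii0.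
  by rewrite -i0m (inj_eq fI) (negbTE ii0).
by rewrite big1// => i _; case: eqP => // im; case: noi; exists i.
Qed.

Section Staircase.
Context (R : realType) (n : nat).
Implicit Types (u : R).

(* At parameter u in [(m-1)/n, m/n] the rotation between the coordinates 0 and m
   is under way: its sine goes from 0 to 1, the sines of the rotations 1..m-1
   being already equal to 1 and the later ones still 0. *)
Definition stair_sin u (j : nat) : R := clamp (n%:R * u - j%:R + 1).

Definition stair_cos u (j : nat) : R := Num.sqrt (1 - stair_sin u j ^+ 2).

(** For [u] in $[(m-1)/n, m/n]$, row 0, that of the moving evaluation, is spread over the columns
    [m-1] and [m]; the rows [0 < i < m] have moved, up to sign, to the column [i-1], and the rows
    [i > m] are still in place. *)
Definition stair u (i k : nat) : R :=
  if i == 0%N then stair_sin u k * stair_cos u k.+1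
  else stair_cos u i * (k == i)%:R - stair_sin u i * (k.+1 == i)%:R.

(** The point of evaluation attached to row [i]: moving for row 0, a grid point otherwise. *)
Definition stair_pos u (i : nat) : R := if i == 0%N then u else i%:R / n%:R.

Local Notation s := stair_sin.
Local Notation c := stair_cos.

Lemma stair_continuous i k : continuous (fun u => stair u i k).
Proof.
have cs j : continuous (fun u => s u j).
  move=> u; apply: (@continuous_comp _ _ _ (fun u => n%:R * u - j%:R + 1));
    last exact: clamp_continuous.
  apply: cvgD; last exact: cvg_cst.
  by apply: cvgB; [apply: cvgM; [exact: cvg_cst|exact: cvg_id]|exact: cvg_cst].
have cc j : continuous (fun u => c u j).
  move=> u; apply: (@continuous_comp _ _ _ (fun u => 1 - s u j ^+ 2));
    last exact: sqrt_continuous.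
  by apply: cvgB; [exact: cvg_cst|apply: cvgM; exact: cs].
rewrite /stair; case: eqP => _ u; first by apply: cvgM; [exact: cs|exact: cc].
by apply: cvgB; apply: cvgM; (exact: cs || exact: cc || exact: cvg_cst).
Qed.

Context (u : R) (u01 : 0 <= u <= 1).

Let s01 j : 0 <= s u j <= 1. Proof. exact: clampP. Qed.

Let c2 j : c u j ^+ 2 = 1 - s u j ^+ 2.
Proof. by rewrite sqr_sqrtr//; have := s01 j; nra. Qed.

Let c01 j : 0 <= c u j <= 1.
Proof.
rewrite sqrtr_ge0/= -[leRHS]sqrtr1 ler_wsqrtr//.
by have := s01 j; nra.
Qed.

Let s0 : s u 0 = 1.
Proof. by apply: clamp_ge1; rewrite subr0 lerDr mulr_ge0; case/andP: u01. Qed.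

Let sn1 : s u n.+1 = 0.
Proof.
apply: clamp_le0; rewrite -natr1 opprD addrA subrK subr_le0.
by rewrite ler_piMr//; case/andP: u01.
Qed.

(** Rotation [j+1] starts only once rotation [j] is complete; the orthogonality relations rest on
    this. *)
Let s_next j : s u j.+1 != 0 -> s u j = 1.
Proof.
move=> sj; apply: clamp_ge1; rewrite lerDr; apply/ltW; rewrite ltNge.
apply: contra sj => h; apply/eqP/clamp_le0.
by rewrite -natr1 opprD addrA subrK.
Qed.

Let cs j : c u j * s u j.+1 = 0.
Proof.
have [->|/s_next sj] := eqVneq (s u j.+1) 0; first by rewrite mulr0.
by rewrite /c sj expr1n subrr sqrtr0 mul0r.
Qed.

Let s_sqr j : s u j ^+ 2 * s u j.+1 ^+ 2 = s u j.+1 ^+ 2.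
Proof.
have [->|/s_next ->] := eqVneq (s u j.+1) 0; first by rewrite expr0n mulr0.
by rewrite expr1n mul1r.
Qed.

Let sumd (X : nat -> R) j : (j < n.+1)%N ->
  \sum_(k < n.+1) (k == j :> nat)%:R * X k = X j.
Proof.
move=> jn; rewrite (bigD1 (Ordinal jn))//= eqxx mul1r big1 ?addr0// => i ij.
by rewrite (_ : (i == j :> nat) = false) ?mul0r//; apply/negbTE.
Qed.

Let row (X : nat -> R) j : (j.+1 < n.+1)%N ->
  \sum_(k < n.+1) stair u j.+1 k * X k = c u j.+1 * X j.+1 - s u j.+1 * X j.
Proof.
move=> jn; rewrite /stair/=.
under eq_bigr do rewrite mulrBl -!mulrA eqSS.
by rewrite sumrB -!mulr_sumr !sumd// ltnW.
Qed.

Let stair0 k : stair u 0 k = s u k * c u k.+1. Proof. by []. Qed.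

(** The squares are $s_k^2 - s_{k+1}^2$ and telescope from $s_0 = 1$ to $s_{n+1} = 0$. *)
Let row00 : \sum_(k < n.+1) stair u 0 k * stair u 0 k = 1.
Proof.
under eq_bigr => k _.
  have -> : stair u 0 k * stair u 0 k = - (s u k.+1 ^+ 2 - s u k ^+ 2).
    rewrite stair0 -expr2 exprMn c2 mulrBr mulr1 s_sqr opprB//.
  over.
rewrite sumrN -(big_mkord xpredT (fun k => s u k.+1 ^+ 2 - s u k ^+ 2)).
by rewrite telescope_sumr// s0 sn1 expr0n expr1n sub0r opprK.
Qed.

Let row0S j : (j.+1 < n.+1)%N -> \sum_(k < n.+1) stair u j.+1 k * stair u 0 k = 0.
Proof.
move=> jn; rewrite row// !stair0.
have [->|/s_next sj] := eqVneq (s u j.+1) 0; first by rewrite !mul0r mulr0 subrr.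
rewrite sj mul1r; have [->|nz] := eqVneq (c u j.+1) 0; first by rewrite mul0r mulr0 subrr.
have sj2 : s u j.+2 = 0 by have /eqP := cs j.+1; rewrite mulf_eq0 (negbTE nz) => /eqP.
have -> : c u j.+2 = 1 by rewrite /c sj2 expr0n subr0 sqrtr1.
by rewrite mulr1 mulrC subrr.
Qed.

Let rowSS i j : (i.+1 < n.+1)%N -> (j.+1 < n.+1)%N ->
  \sum_(k < n.+1) stair u i.+1 k * stair u j.+1 k = (i == j)%:R.
Proof.
move=> iN jN; rewrite row// /stair/= !eqSS.
have A : c u i.+1 * (s u j.+1 * (i.+1 == j)%:R) = 0.
  by case: eqP => [<-|_]; [rewrite mulr1 cs|rewrite !mulr0].
have B : s u i.+1 * (c u j.+1 * (i == j.+1)%:R) = 0.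
  by case: eqP => [->|_]; [rewrite mulr1 mulrC cs|rewrite !mulr0].
rewrite !mulrBr A B subr0 sub0r opprK.
case: eqVneq => [<-|_]; last by rewrite !mulr0 addr0.
by rewrite !mulr1 -!expr2 c2 subrK.
Qed.

Let stair_rows (i j : 'I_n.+1) :
  \sum_(k < n.+1) stair u i k * stair u j k = (i == j)%:R.
Proof.
case: i => [[|i] iN]; case: j => [[|j] jN].
- by rewrite row00 -val_eqE.
- by under eq_bigr do rewrite mulrC; rewrite row0S -?val_eqE.
- by rewrite row0S -?val_eqE.
- by rewrite rowSS -?val_eqE.
Qed.

Lemma stair_orthogonal (i j : 'I_n.+1) :
  \sum_(k < n.+1) stair u i k * stair u j k = (i == j)%:R /\
  \sum_(k < n.+1) stair u k i * stair u k j = (i == j)%:R.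
Proof.
split; first exact: stair_rows.
pose W : 'M[R]_n.+1 := \matrix_(i, j) stair u i j.
have : W *m W^T = 1%:M.
  apply/matrixP => k l; rewrite !mxE -stair_rows.
  by apply: eq_bigr => m _; rewrite !mxE.
move=> /mulmx1C/matrixP/(_ i j); rewrite !mxE => <-.
by apply: eq_bigr => k _; rewrite !mxE.
Qed.

(** Evaluations are exchanged only between points at distance at most [1/n], which is why
    conjugation by [stair] nearly turns the constant representation into the moving one. *)
Lemma stair_local (i k : 'I_n.+1) : (0 < n)%N -> stair u i k != 0 ->
  `|stair_pos u i - k%:R / n%:R| <= n%:R^-1.
Proof.
move=> n0; have n0' : (n%:R : R) != 0 by rewrite pnatr_eq0 -lt0n.
have np : 0 < (n%:R : R) by rewrite ltr0n.
have scal (x : R) : `|x - k%:R / n%:R| = `|n%:R * x - k%:R| / n%:R.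
  have -> : x - k%:R / n%:R = (n%:R * x - k%:R) / n%:R.
    by field.
  by rewrite normf_div (ger0_norm (ler0n _ _)).
rewrite scal ler_pdivrMr// mulVf//.
rewrite /stair /stair_pos; have [i0|i0] := eqVneq (i : nat) 0%N.
  rewrite mulf_eq0 negb_or => /andP[sk ck].
  have h1 : 0 < n%:R * u - k%:R + 1.
    by rewrite ltNge; apply: contra sk => /clamp_le0 h; apply/eqP.
  have h2 : n%:R * u - k%:R < 1.
    rewrite ltNge; apply: contra ck => h.
    rewrite /c /s clamp_ge1 ?expr1n ?subrr ?sqrtr0//.
    by rewrite -natr1 opprD addrA subrK.
  by rewrite ler_norml; apply/andP; split; lra.
rewrite mulrCA divff// mulr1.
have [ki|ki] := eqVneq (k : nat) i; first by rewrite ki subrr normr0.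
have [<-|ki1] := eqVneq k.+1 (i : nat); first by rewrite -natr1 addrAC subrr add0r normr1.
by rewrite !mulr0 subrr eqxx.
Qed.

(** Entries are at most 1 in absolute value and [b] counts at most four positions in any row or
    column. The bound does not depend on [n], which is chosen later. *)
Lemma stair_bounds (i k : 'I_n.+1) :
  \sum_(j < n.+1) `|stair u i j| <= 4 /\ \sum_(j < n.+1) `|stair u j k| <= 4.
Proof.
(* Row 0 is supported on the columns [m] and [m.+1]. *)
pose m := Num.truncn (n%:R * u).
have nu0 : 0 <= n%:R * u by rewrite mulr_ge0//; case/andP: u01.
have m1 : m%:R <= n%:R * u < m.+1%:R by exact: truncn_itv.
pose b (i k : nat) : R := (k == i)%:R + (k.+1 == i)%:R +
  (i == 0%N)%:R * ((k == m)%:R + (k == m.+1)%:R).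
have bP (i' k' : nat) : `|stair u i' k'| <= b i' k'.
  rewrite /b /stair; have [->|i0] := eqVneq i' 0%N.
    have sc : `|s u k' * c u k'.+1| <= 1.
      have /andP[sa sb] := s01 k'; have /andP[ca cb] := c01 k'.+1.
      by rewrite normrM !ger0_norm// mulr_ile1.
    have [z|nz] := eqVneq (s u k' * c u k'.+1) 0.
      by rewrite z normr0 mul1r !addr_ge0.
    rewrite mul1r; suff : (k' == m) || (k' == m.+1).
      move=> km; apply: (le_trans sc).
      have : 1 <= (k' == m)%:R + (k' == m.+1)%:R :> R.
        by case/orP: km => ->; rewrite ?lerDl ?lerDr.
      by move=> /le_trans; apply; rewrite lerDr addr_ge0.
    move: nz; rewrite mulf_eq0 negb_or => /andP[sk ck].
    have h1 : 0 < n%:R * u - k'%:R + 1.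
      by rewrite ltNge; apply: contra sk => /clamp_le0 h; apply/eqP.
    have h2 : n%:R * u - k'%:R < 1.
      rewrite ltNge; apply: contra ck => h.
      rewrite /c /s clamp_ge1 ?expr1n ?subrr ?sqrtr0//.
      by rewrite -natr1 opprD addrA subrK.
    have g1 : (k' < m.+2)%N.
      rewrite -(ltr_nat R) -natr1; case/andP: m1; lra.
    have g2 : (m < k'.+1)%N.
      rewrite -(ltr_nat R) -natr1; case/andP: m1; lra.
    lia.
  rewrite mul0r addr0 (le_trans (ler_normB _ _))//.
  rewrite !normrM !(ger0_norm (ler0n _ _)) lerD// ler_piMl//.
    by rewrite ger0_norm; case/andP: (c01 i').
  by rewrite ger0_norm; case/andP: (s01 i').
have le1 (f : 'I_n.+1 -> nat) l : injective f -> \sum_j (f j == l)%:R <= 1 :> R.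
  exact: sum_eq_le1.
have vI : injective (fun j : 'I_n.+1 => j : nat) by exact: val_inj.
have vSI : injective (fun j : 'I_n.+1 => j.+1) by move=> x y [] /val_inj.
split; apply: (le_trans (ler_sum _ (fun j _ => bP _ _))); rewrite /b big_split/= big_split/=.
  have -> : 4 = 1 + 1 + (1 + 1) :> R by ring.
  apply: lerD; first by apply: lerD; exact: le1.
  rewrite -mulr_sumr big_split/=; case: (_ == _); last by rewrite mul0r addr_ge0.
  by rewrite mul1r lerD//; exact: le1.
have -> : 4 = 1 + 1 + (1 + 1) :> R by ring.
apply: lerD.
  apply: lerD; under eq_bigr do rewrite eq_sym; exact: le1.
rewrite -mulr_suml -[leRHS]mul1r ler_pM ?sumr_ge0 ?addr_ge0//; first exact: le1.
by rewrite lerD// lern1 leq_b1.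
Qed.

End Staircase.

(** As [fold_time] vanishes at both ends, this is what makes the component in [F1] of the rotation
    the identity. *)
Lemma stair_start (R : realType) n (i k : 'I_n.+1) : stair n 0 i k = (i == k)%:R :> R.
Proof.
have s0 j : stair_sin n 0 j.+1 = 0 :> R.
  apply: clamp_le0; rewrite mulr0 sub0r -natr1 opprD subrK oppr_le0//.
have c0 j : stair_cos n 0 j.+1 = 1 :> R.
  by rewrite /stair_cos s0 expr0n subr0 sqrtr1.
rewrite /stair -val_eqE/=; have [->|] := eqVneq (i : nat) 0%N.
  rewrite c0 mulr1; case: (k : nat) => [|k']; last by rewrite s0.
  by rewrite /stair_sin mulr0 subrr add0r clamp_ge1.
by case: (i : nat) => // i' _; rewrite c0 s0 mul0r subr0 mul1r eq_sym.
Qed.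

(** * The schedule of the homotopy *)

Section Schedule.
Context (R : realType) (d : R).
Implicit Types t : R.

(** The line of slope [1 + 8 d] through $(1/4, 1/4)$, cut off at 0 and 1/2. For $0 < d \le 1/8$ it
    is 0 up to [d] and 1/2 from [1/2 - d] on. *)
Definition half_clamp t : R := clamp (2 * ((1 + 8 * d) * t - 2 * d)) / 2.

(* reparametrization of the interval which is stationary near 0, 1/2 and 1 *)
Definition slow_time t : R := half_clamp t + half_clamp (t - 2^-1).

(** The parameter of the loop: it climbs to 1/2 and comes back, agreeing with [slow_time] on the
    first half and with [1 - slow_time] on the second. *)
Definition fold_time t : R := half_clamp (Num.min t (1 - t)).

(** The two bumps and the two weights below have squares of sum 1, and each is nonzero only while
    the row that it multiplies intertwines. *)
Definition left_bump t : R := clamp (1 - t / d).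

Definition right_bump t : R := clamp (1 - (1 - t) / d).

(** Goes from 0 to 1 on $[1/2 - d, 1/2 + d]$, where time stands still at 1/2. *)
Definition mid_switch t : R := clamp ((t - 2^-1) / (2 * d) + 2^-1).

Definition inner_weight t : R :=
  Num.sqrt (1 - left_bump t ^+ 2 - right_bump t ^+ 2).

Definition first_weight t : R := inner_weight t * Num.sqrt (1 - mid_switch t ^+ 2).

Definition second_weight t : R := inner_weight t * mid_switch t.

Lemma half_clamp_continuous : continuous half_clamp.
Proof.
move=> t; apply: cvgM; last exact: cvg_cst.
apply: (@continuous_comp _ _ _ (fun t => 2 * ((1 + 8 * d) * t - 2 * d)));
  last exact: clamp_continuous.
apply: cvgM; first exact: cvg_cst.
by apply: cvgB; [apply: cvgM; [exact: cvg_cst|exact: cvg_id]|exact: cvg_cst].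
Qed.

Lemma slow_time_continuous : continuous slow_time.
Proof.
move=> t; apply: cvgD; first exact: half_clamp_continuous.
apply: (@continuous_comp _ _ _ (fun t => t - 2^-1)); last exact: half_clamp_continuous.
by apply: cvgB; [exact: cvg_id|exact: cvg_cst].
Qed.

Lemma fold_time_continuous : continuous fold_time.
Proof.
move=> t; apply: (@continuous_comp _ _ _ (fun t => Num.min t (1 - t)));
  last exact: half_clamp_continuous.
apply: continuous_min; first exact: cvg_id.
by apply: cvgB; [exact: cvg_cst|exact: cvg_id].
Qed.

Lemma left_bump_continuous : continuous left_bump.
Proof.
move=> t; apply: (@continuous_comp _ _ _ (fun t => 1 - t / d));
  last exact: clamp_continuous.
apply: cvgB; first exact: cvg_cst.
by apply: cvgM; [exact: cvg_id|exact: cvg_cst].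
Qed.

Lemma right_bump_continuous : continuous right_bump.
Proof.
move=> t; apply: (@continuous_comp _ _ _ (fun t => 1 - (1 - t) / d));
  last exact: clamp_continuous.
apply: cvgB; first exact: cvg_cst.
apply: cvgM; last exact: cvg_cst.
by apply: cvgB; [exact: cvg_cst|exact: cvg_id].
Qed.

Lemma mid_switch_continuous : continuous mid_switch.
Proof.
move=> t; apply: (@continuous_comp _ _ _ (fun t => (t - 2^-1) / (2 * d) + 2^-1));
  last exact: clamp_continuous.
apply: cvgD; last exact: cvg_cst.
apply: cvgM; last exact: cvg_cst.
by apply: cvgB; [exact: cvg_id|exact: cvg_cst].
Qed.

Lemma inner_weight_continuous : continuous inner_weight.
Proof.
move=> t; apply: (@continuous_comp _ _ _ (fun t => 1 - left_bump t ^+ 2 - right_bump t ^+ 2));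
  last exact: sqrt_continuous.
apply: cvgB; last by apply: cvgM; exact: right_bump_continuous.
by apply: cvgB; [exact: cvg_cst|apply: cvgM; exact: left_bump_continuous].
Qed.

Lemma first_weight_continuous : continuous first_weight.
Proof.
move=> t; apply: cvgM; first exact: inner_weight_continuous.
apply: (@continuous_comp _ _ _ (fun t => 1 - mid_switch t ^+ 2));
  last exact: sqrt_continuous.
by apply: cvgB; [exact: cvg_cst|apply: cvgM; exact: mid_switch_continuous].
Qed.

Lemma second_weight_continuous : continuous second_weight.
Proof.
by move=> t; apply: cvgM; [exact: inner_weight_continuous|exact: mid_switch_continuous].
Qed.

Hypotheses (d0 : 0 < d) (d8 : d <= 8^-1).

Ltac dlra := move: d0 d8 => ? ?; lra.

Lemma half_clamp_itv t : 0 <= half_clamp t <= 2^-1.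
Proof.
rewrite /half_clamp; have := clampP (2 * ((1 + 8 * d) * t - 2 * d)).
by move: (clamp _) => x; dlra.
Qed.

(** The affine part differs from [t] by [8 d t - 2 d], and the cut-off only brings it closer. *)
Lemma half_clamp_close t : 0 <= t <= 2^-1 -> `|half_clamp t - t| <= 2 * d.
Proof.
move=> /andP[t0 t1]; have dt0 : 0 <= d * t by rewrite mulr_ge0// ltW.
have dt1 : d * t <= d / 2 by rewrite ler_wpM2l// ltW.
rewrite /half_clamp; set x := 2 * _.
have xE : x = 2 * t + 16 * (d * t) - 4 * d by rewrite /x; ring.
rewrite ler_norml; have [x0|x0] := leP x 0.
  by rewrite clamp_le0// mul0r sub0r; dlra.
have [x1|x1] := leP 1 x; first by rewrite clamp_ge1//; dlra.
by rewrite clamp_id; dlra.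
Qed.

Lemma half_clamp_small t : t <= d -> half_clamp t = 0.
Proof.
move=> td; rewrite /half_clamp clamp_le0 ?mul0r//.
have := ler_wpM2l (ltW d0) td; have : d * d <= d * 8^-1 by rewrite ler_pM2l.
by dlra.
Qed.

Lemma half_clamp_large t : 2^-1 - d <= t -> half_clamp t = 2^-1.
Proof.
move=> td; rewrite /half_clamp clamp_ge1 ?mul1r//.
have := ler_wpM2l (ltW d0) td; have : d * d <= d * 8^-1 by rewrite ler_pM2l.
by dlra.
Qed.

Lemma half_clampN t : half_clamp (2^-1 - t) = 2^-1 - half_clamp t.
Proof.
rewrite /half_clamp; set x := 2 * ((1 + 8 * d) * t - 2 * d).
have -> : 2 * ((1 + 8 * d) * (2^-1 - t) - 2 * d) = 1 - x.
  by rewrite /x; dlra.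
clearbody x; have [x0|x0] := leP x 0.
  by rewrite (clamp_le0 x0) clamp_ge1; dlra.
have [x1|x1] := leP 1 x; first by rewrite (clamp_ge1 x1) clamp_le0; dlra.
by rewrite !clamp_id; dlra.
Qed.

Lemma slow_time_first t : t <= 2^-1 -> slow_time t = fold_time t.
Proof.
move=> t1; rewrite /slow_time (@half_clamp_small (t - 2^-1)) ?addr0; last by dlra.
by rewrite /fold_time; case: leP => //; dlra.
Qed.

Lemma slow_time_second t : 2^-1 <= t -> slow_time t = 1 - fold_time t.
Proof.
move=> t1; rewrite /slow_time (@half_clamp_large t); last by dlra.
have -> : t - 2^-1 = 2^-1 - (1 - t) by dlra.
rewrite half_clampN /fold_time.
have -> : Num.min t (1 - t) = 1 - t by case: leP => //; dlra.
dlra.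
Qed.

Lemma slow_time_itv t : 0 <= slow_time t <= 1.
Proof.
rewrite /slow_time; have := half_clamp_itv t; have := half_clamp_itv (t - 2^-1).
by move: (half_clamp _) (half_clamp _) => x y; dlra.
Qed.

Lemma slow_time_close t : 0 <= t <= 1 -> `|slow_time t - t| <= 2 * d.
Proof.
move=> t01; have [t1|t1] := leP t 2^-1.
  rewrite /slow_time (@half_clamp_small (t - 2^-1)) ?addr0; last by dlra.
  by apply: half_clamp_close; dlra.
rewrite /slow_time (@half_clamp_large t); last by dlra.
have -> : 2^-1 + half_clamp (t - 2^-1) - t = half_clamp (t - 2^-1) - (t - 2^-1) by ring.
by apply: half_clamp_close; dlra.
Qed.

Lemma fold_time_itv t : 0 <= fold_time t <= 2^-1. Proof. exact: half_clamp_itv. Qed.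

Lemma fold_time_start t : t <= d -> fold_time t = 0.
Proof. by move=> td; rewrite /fold_time half_clamp_small// ge_min td. Qed.

Lemma fold_time_end t : 1 - d <= t -> fold_time t = 0.
Proof.
by move=> td; rewrite /fold_time half_clamp_small// ge_min; apply/orP; right; dlra.
Qed.

Lemma fold_time_mid t : `|t - 2^-1| <= d -> fold_time t = 2^-1.
Proof.
rewrite ler_norml => td; rewrite /fold_time half_clamp_large//.
by rewrite le_min; apply/andP; split; dlra.
Qed.

Lemma left_bump_neq0 t : left_bump t != 0 -> t < d.
Proof.
rewrite ltNge; apply: contra => td; apply/eqP/clamp_le0.
by rewrite subr_le0 ler_pdivlMr// mul1r.
Qed.

Lemma right_bump_neq0 t : right_bump t != 0 -> 1 - d < t.
Proof.
rewrite ltNge; apply: contra => td; apply/eqP/clamp_le0.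
by rewrite subr_le0 ler_pdivlMr// mul1r; dlra.
Qed.

Lemma bumps_disjoint t : left_bump t * right_bump t = 0.
Proof.
have [->|/left_bump_neq0 h0] := eqVneq (left_bump t) 0; first by rewrite mul0r.
have [->|/right_bump_neq0 h1] := eqVneq (right_bump t) 0; first by rewrite mulr0.
dlra.
Qed.

(** Past the midpoint the weight lives only before [1/2 + d], where both times equal 1/2. *)
Lemma first_weight_neq0 t : first_weight t != 0 -> slow_time t = fold_time t.
Proof.
move=> ft; have [t1|t1] := leP t 2^-1; first exact: slow_time_first.
have td : t < 2^-1 + d.
  rewrite ltNge; apply: contra ft => td; rewrite /first_weight.
  have -> : mid_switch t = 1.
    apply: clamp_ge1; rewrite -lerBlDr ler_pdivlMr ?mulr_gt0//; dlra.
  by rewrite expr1n subrr sqrtr0 mulr0.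
rewrite slow_time_second ?fold_time_mid; [dlra| |exact: ltW].
by rewrite ler_norml; dlra.
Qed.

Lemma second_weight_neq0 t : second_weight t != 0 -> slow_time t = 1 - fold_time t.
Proof.
move=> ft; have [t1|t1] := leP 2^-1 t; first exact: slow_time_second.
have td : 2^-1 - d < t.
  rewrite ltNge; apply: contra ft => td; rewrite /second_weight.
  have -> : mid_switch t = 0.
    apply: clamp_le0; rewrite -lerBrDr sub0r ler_pdivrMr ?mulr_gt0//; dlra.
  by rewrite mulr0.
rewrite slow_time_first ?fold_time_mid; [dlra| |exact: ltW].
by rewrite ler_norml; dlra.
Qed.

Lemma weights_unit t : left_bump t ^+ 2 + right_bump t ^+ 2 + first_weight t ^+ 2 +
  second_weight t ^+ 2 = 1.
Proof.
have := bumps_disjoint t; have := clampP (1 - t / d).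
have := clampP (1 - (1 - t) / d); rewrite -/(left_bump t) -/(right_bump t).
rewrite /first_weight /second_weight !exprMn.
have m2 : Num.sqrt (1 - mid_switch t ^+ 2) ^+ 2 = 1 - mid_switch t ^+ 2.
  rewrite sqr_sqrtr//; have := clampP ((t - 2^-1) / (2 * d) + 2^-1).
  by rewrite -/(mid_switch t) => /andP[m0 m1]; nra.
rewrite m2 -addrA -mulrDr subrK mulr1 /inner_weight.
move: (left_bump t) (right_bump t) => x y /andP[y0 y1] /andP[x0 x1] /eqP.
rewrite mulf_eq0 => /orP[]/eqP->; rewrite sqr_sqrtr; nra.
Qed.

Lemma weights_start : [/\ left_bump 0 = 1, right_bump 0 = 0, first_weight 0 = 0 &
  second_weight 0 = 0].
Proof.
have l : left_bump 0 = 1 by rewrite /left_bump mul0r subr0 clamp_ge1.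
have r : right_bump 0 = 0.
  by have /eqP := bumps_disjoint 0; rewrite l mul1r => /eqP.
have i : inner_weight 0 = 0.
  by rewrite /inner_weight l r expr1n expr0n subrr subr0 sqrtr0.
by split=> //; rewrite /first_weight /second_weight i mul0r.
Qed.

Lemma weights_end : [/\ left_bump 1 = 0, right_bump 1 = 1, first_weight 1 = 0 &
  second_weight 1 = 0].
Proof.
have r : right_bump 1 = 1 by rewrite /right_bump subrr mul0r subr0 clamp_ge1.
have l : left_bump 1 = 0.
  by have /eqP := bumps_disjoint 1; rewrite r mulr1 => /eqP.
have i : inner_weight 1 = 0.
  by rewrite /inner_weight l r expr1n expr0n subr0 subrr sqrtr0.
by split=> //; rewrite /first_weight /second_weight i mul0r.
Qed.

Lemma weights_le1 t : [/\ `|left_bump t| <= 1, `|right_bump t| <= 1,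
  `|first_weight t| <= 1 & `|second_weight t| <= 1].
Proof.
have := weights_unit t.
move: (left_bump t) (right_bump t) (first_weight t) (second_weight t) => a b x y h.
have sq (z : R) : z ^+ 2 <= 1 -> `|z| <= 1.
  by move=> z1; rewrite -sqrtr_sqr -[leRHS]sqrtr1 ler_wsqrtr.
have := sqr_ge0 a; have := sqr_ge0 b; have := sqr_ge0 x; have := sqr_ge0 y.
by move=> ? ? ? ?; split; apply: sq; lra.
Qed.

End Schedule.

(** * Direct sums and pullbacks of scalar representations *)

Section ScalarReps.
Context (C : numClosedFieldType) (A : starAlgType C).

Lemma scalar_rep_sum (T1 T2 : finType) (r1 : A -> T1 -> T1 -> C)
    (r2 : A -> T2 -> T2 -> C) : scalar_rep r1 -> scalar_rep r2 ->
  scalar_rep (fun a (i j : T1 + T2) => match i, j with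
    | inl i, inl j => r1 a i j | inr i, inr j => r2 a i j | _, _ => 0 end).
Proof.
move=> [l1 m1 s1] [l2 m2 s2]; split.
- by move=> c a b [i|i] [j|j]; rewrite ?l1 ?l2 ?mulr0 ?addr0.
- move=> a b [i|i] [j|j]; rewrite big_sumType/= ?m1 ?m2.
  + by rewrite [X in _ + X]big1 ?addr0// => k _; rewrite mul0r.
  + by rewrite !big1 ?addr0// => k _; rewrite ?mul0r ?mulr0.
  + by rewrite !big1 ?addr0// => k _; rewrite ?mul0r ?mulr0.
  + by rewrite [X in X + _]big1 ?add0r// => k _; rewrite mul0r.
- by move=> a [i|i] [j|j]; rewrite ?s1 ?s2 ?rmorph0.
Qed.

Lemma scalar_rep_diag (I T : finType) (r : I -> A -> T -> T -> C) :
  (forall i, scalar_rep (r i)) ->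
  scalar_rep (fun a (x y : I * T) => (x.1 == y.1)%:R * r x.1 a x.2 y.2).
Proof.
move=> rr; split.
- by move=> c a b x y; have [-> _ _] := rr x.1; rewrite mulrDr mulrCA.
- move=> a b [i x] [j y] /=; have [_ -> _] := rr i.
  rewrite -(pair_bigA _ (fun k z => (i == k)%:R * r i a x z * ((k == j)%:R * r k b z y)))/=.
  rewrite (bigD1 i)//= [X in _ + X]big1 ?addr0 => [|k ki].
    rewrite mulr_sumr; apply: eq_bigr => z _.
    by rewrite eqxx mul1r mulrCA.
  by apply: big1 => z _; rewrite eq_sym (negbTE ki) !mul0r.
- move=> a [i x] [j y] /=; have [_ _ ->] := rr i; rewrite rmorphM/= conjC_nat eq_sym.
  by case: eqVneq => [->//|_]; rewrite !mul0r.
Qed.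

Lemma scalar_rep_comp (B : starAlgType C) (T : finType) (r : B -> T -> T -> C)
    (f : A -> B) : (forall c x y, f (c *: x + y) = c *: f x + f y) ->
  {morph f : x y / x ** y} -> {morph f : x / star x} ->
  scalar_rep r -> scalar_rep (fun a => r (f a)).
Proof. by move=> fl fm fs [rl rm rs]; split=> *; rewrite ?fl ?fm ?fs. Qed.

End ScalarReps.

(** Row sums of $a D a^T$; they feed the Schur test with [a] the norms of the dilating isometry and
    [D] those of the error. *)
Lemma triple_row_sum (R : realType) (O S : finType) (a : O -> S -> R)
    (D : S -> S -> R) (M r : R) :
  (forall o k, 0 <= a o k) -> (forall k l, 0 <= D k l) -> 0 <= M -> 0 <= r ->
  (forall o, \sum_k a o k <= M) -> (forall k, \sum_o a o k <= M) ->
  (forall k, \sum_l D k l <= r) ->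
  forall o, \sum_o' \sum_k \sum_l a o k * D k l * a o' l <= M * r * M.
Proof.
move=> a0 D0 M0 r0 aM Ma Dr o.
rewrite exchange_big/=; apply: (@le_trans _ _ (\sum_k a o k * (r * M))).
  apply: ler_sum => k _; rewrite exchange_big/=.
  apply: (@le_trans _ _ (\sum_l a o k * D k l * M)).
    by apply: ler_sum => l _; rewrite -mulr_sumr ler_wpM2l// mulr_ge0.
  by rewrite -mulr_suml -mulr_sumr -mulrA ler_wpM2l// ler_wpM2r.
by rewrite -mulr_suml -mulrA ler_wpM2r// mulr_ge0.
Qed.

Section Scalars.
Context (R : realType) (F1 F2 : finCStarAlgType R).
Context (phi0 phi1 : {starhom F1 -> F2}) (u1 : F1) (u2 : F2).
Hypotheses (phi0u : phi0 u1 = u2) (phi1u : phi1 u1 = u2).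
Local Notation A := (nccw phi0 phi1).

Lemma nccw_scalar (c : R -> R[i]^o) : continuous c -> c 0 = c 1 ->
  exists x : A, (forall t, (nccw_val x).1 t = c (set_val t) *: u2) /\
    (nccw_val x).2 = c 0 *: u1.
Proof.
move=> cc c01; apply: (@nccw_path _ _ _ phi0 phi1 (fun s => c s *: u2) (c 0 *: u1));
  last 2 first.
- by rewrite linearZ/= phi0u.
- by rewrite linearZ/= phi1u c01.
move=> s; apply: (@cvgZ _ F2 _ _ _ _ (fun=> u2) _ _ (cc s)); exact: cvg_cst.
Qed.

End Scalars.

(** * Approximate factorization *)

Lemma scalar_rep_continuous (R : realType) (F : finCStarAlgType R) (T : finType)
    (r : F -> T -> T -> R[i]) i j : scalar_rep r ->
  continuous (fun a => r a i j : R[i]^o).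
Proof.
move=> [rl _ _]; have lf : linear (fun a => r a i j : R[i]^o).
  by move=> c a b; rewrite rl.
pose f : {linear F -> R[i]^o} := HB.pack (fun a => r a i j : R[i]^o)
  (GRing.isLinear.Build R[i] F R[i]^o *:%R (fun a => r a i j : R[i]^o) lf).
exact: (@finite_dim_continuous R F R[i]^o (@finite_dimT R F) f).
Qed.

Lemma rnormZr (R : realType) (V : normedModType R[i]) (x : R) (v : V) :
  rnorm (x%:C *: v) = `|x| * rnorm v.
Proof. by rewrite rnormZ normc_def/= expr0n/= addr0 sqrtr_sqr. Qed.

Lemma rnorm_unit_le1 (R : realType) (F : cstarAlgType R) (u : F) :
  (forall x, u ** x = x /\ x ** u = x) -> rnorm u <= 1.
Proof.
move=> uP; have [->|u0] := eqVneq u 0; first by rewrite rnorm0.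
by rewrite rnorm_projection//; split; [exact: star_unit|exact: (uP u).1].
Qed.

Lemma sum_prodE (V : nmodType) (I J : finType) (H : I * J -> V) :
  \sum_p H p = \sum_i \sum_j H (i, j).
Proof. by rewrite pair_bigA; apply: eq_bigr => -[]. Qed.

Section Main.
Context (R : realType) (F1 F2 : finCStarAlgType R).
Context (phi0 phi1 : {starhom F1 -> F2}) (u1 : F1) (u2 : F2).
Hypotheses (u1P : forall a, u1 ** a = a /\ a ** u1 = a)
  (u2P : forall b, u2 ** b = b /\ b ** u2 = b)
  (phi0u : phi0 u1 = u2) (phi1u : phi1 u1 = u2).
Context (T K : finType) (X : T -> F1) (tau : F1 -> T -> T -> R[i])
  (Y : K -> F2) (sig : F2 -> K -> K -> R[i]).
Hypotheses (tau_rep : scalar_rep tau) (sig_rep : scalar_rep sig)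
  (X_tau : forall a j, a ** X j = \sum_i tau a i j *: X i)
  (Y_sig : forall b j, b ** Y j = \sum_i sig b i j *: Y i)
  (X_unit : \sum_j X j ** star (X j) = u1)
  (Y_unit : \sum_j Y j ** star (Y j) = u2).
Local Notation A := (nccw phi0 phi1).
Local Notation Q := (T + (K + K))%type.
Implicit Types (f g : A) (s t : R).

Definition nccw_at f s : F2 := (nccw_val f).1 (itv_clamp s).

Definition path_rep s f (q r : Q) : R[i] :=
  match q, r with
  | inl i, inl j => tau (nccw_val f).2 i j
  | inr i, inr j => match i, j with
    | inl i, inl j => sig (nccw_at f s) i j
    | inr i, inr j => sig (nccw_at f (1 - s)) i j
    | _, _ => 0 end
  | _, _ => 0 end.

Lemma nccw_at_continuous f : continuous (nccw_at f).
Proof.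
by move=> s; apply: continuous_comp; [exact: itv_clamp_continuous|exact: nccw_continuous].
Qed.

Lemma nccw_at_scalar_rep s : scalar_rep (fun f => sig (nccw_at f s)).
Proof.
exact: scalar_rep_comp sig_rep.
Qed.

Lemma path_rep_scalar_rep s : scalar_rep (path_rep s).
Proof.
apply: scalar_rep_sum.
  exact: scalar_rep_comp tau_rep.
by apply: scalar_rep_sum; exact: nccw_at_scalar_rep.
Qed.

Lemma path_rep_continuous f q r : continuous (fun s => path_rep s f q r : R[i]^o).
Proof.
case: q => [i|[i|i]]; case: r => [j|[j|j]] s /=; try exact: cvg_cst.
  apply: (@continuous_comp _ _ _ (nccw_at f) (fun b => sig b i j : R[i]^o)).
    exact: nccw_at_continuous.
  exact: scalar_rep_continuous.
apply: (@continuous_comp _ _ _ (fun s => nccw_at f (1 - s)) (fun b => sig b i j : R[i]^o)).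
  apply: (@continuous_comp _ _ _ (fun s => 1 - s)); last exact: nccw_at_continuous.
  by apply: cvgB; [exact: cvg_cst|exact: cvg_id].
exact: scalar_rep_continuous.
Qed.

Context (n : nat) (d : R).
Hypotheses (n0 : (0 < n)%N) (d0 : 0 < d) (d8 : d <= 8^-1).
Local Notation S := ('I_n.+1 * Q)%type.

(** The loop at parameter [v] in copy 0, with the evaluations at $1/n, \dots, n/n$ added in the
    other copies; at [v = 0] all copies are grid evaluations. *)
Definition stack_rep v f (a b : S) : R[i] :=
  (a.1 == b.1)%:R * path_rep (stair_pos n v a.1) f a.2 b.2.

Lemma stack_rep_scalar_rep v : scalar_rep (stack_rep v).
Proof.
exact: (scalar_rep_diag (fun i : 'I_n.+1 => path_rep_scalar_rep (stair_pos n v i))).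
Qed.

Definition intertwiner t (q : Q) : F2 :=
  match q with
  | inl k => (left_bump d t)%:C *: phi0 (X k) + (right_bump d t)%:C *: phi1 (X k)
  | inr (inl k) => (first_weight d t)%:C *: Y k
  | inr (inr k) => (second_weight d t)%:C *: Y k
  end.

(** The component in [F1] of the row: at the ends only the bumps survive, and [intertwiner] is its
    image under [phi0] or [phi1]. *)
Definition end_intertwiner (q : Q) : F1 := if q is inl k then X k else 0.

Lemma nccw_at0 f : nccw_at f 0 = phi0 (nccw_val f).2.
Proof. by rewrite /nccw_at itv_clamp0 nccw_left. Qed.

Lemma nccw_at1 f : nccw_at f 1 = phi1 (nccw_val f).2.
Proof. by rewrite /nccw_at itv_clamp1 nccw_right. Qed.

(** While a weight is nonzero, the value of [f] at [slow_time] is the one that its row intertwines: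
    the image of the point of [F1] near the ends, the evaluation at [s] or [1 - s] elsewhere, with
    [s] the fold time. *)
Lemma intertwinerP t f q : nccw_at f (slow_time d t) ** intertwiner t q =
  \sum_r path_rep (fold_time d t) f r q *: intertwiner t r.
Proof.
have left_id k : (left_bump d t)%:C *: (nccw_at f (slow_time d t) ** phi0 (X k)) =
    (left_bump d t)%:C *: \sum_i tau (nccw_val f).2 i k *: phi0 (X i).
  have [->|/left_bump_neq0 td] := eqVneq (left_bump d t) 0; first by rewrite !scale0r.
  rewrite slow_time_first//; last by move: d8 (td d0) => ? ?; lra.
  rewrite fold_time_start ?nccw_at0//; last by rewrite ltW// td.
  rewrite -starhomM X_tau linear_sum; congr (_ *: _).
  by apply: eq_bigr => i _; rewrite linearZ.
have right_id k : (right_bump d t)%:C *: (nccw_at f (slow_time d t) ** phi1 (X k)) =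
    (right_bump d t)%:C *: \sum_i tau (nccw_val f).2 i k *: phi1 (X i).
  have [->|/right_bump_neq0 td] := eqVneq (right_bump d t) 0; first by rewrite !scale0r.
  rewrite slow_time_second//; last by move: d8 (td d0) => ? ?; lra.
  rewrite fold_time_end ?subr0 ?nccw_at1//; last by rewrite ltW// td.
  rewrite -starhomM X_tau linear_sum; congr (_ *: _).
  by apply: eq_bigr => i _; rewrite linearZ.
case: q => [k|[k|k]] /=; rewrite !big_sumType/=.
- rewrite [X in _ + (X + _)]big1 ?[X in _ + (_ + X)]big1 ?addr0;
    try by move=> *; rewrite scale0r.
  rewrite star_mulDr !star_mulZr left_id right_id !scaler_sumr -big_split/=.
  by apply: eq_bigr => i _; rewrite scalerDr !scalerA ![_ * tau _ _ _]mulrC.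
- rewrite [X in X + _]big1 ?[X in _ + (_ + X)]big1 ?add0r ?addr0;
    try by move=> *; rewrite scale0r.
  rewrite star_mulZr.
  have [->|/first_weight_neq0 ->//] := eqVneq (first_weight d t) 0.
    by rewrite scale0r big1// => i _; rewrite scale0r scaler0.
  rewrite Y_sig scaler_sumr; apply: eq_bigr => i _.
  by rewrite !scalerA mulrC.
- rewrite [X in X + _]big1 ?[X in _ + (X + _)]big1 ?add0r;
    try by move=> *; rewrite scale0r.
  rewrite star_mulZr.
  have [->|/second_weight_neq0 ->//] := eqVneq (second_weight d t) 0.
    by rewrite scale0r big1// => i _; rewrite scale0r scaler0.
  rewrite Y_sig scaler_sumr; apply: eq_bigr => i _.
  by rewrite !scalerA mulrC.
Qed.

Lemma intertwiner_unit t : \sum_q intertwiner t q ** star (intertwiner t q) = u2.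
Proof.
have cr (x : R) : Num.conj (x%:C) = x%:C :> R[i] by apply/CrealP; rewrite complex_real.
have lr : (left_bump d t)%:C * (right_bump d t)%:C = 0 :> R[i].
  by rewrite -rmorphM/= bumps_disjoint.
have rl : (right_bump d t)%:C * (left_bump d t)%:C = 0 :> R[i] by rewrite mulrC.
rewrite !big_sumType/=.
have -> : \sum_k ((left_bump d t)%:C *: phi0 (X k) + (right_bump d t)%:C *: phi1 (X k)) **
    star ((left_bump d t)%:C *: phi0 (X k) + (right_bump d t)%:C *: phi1 (X k)) =
    (left_bump d t ^+ 2 + right_bump d t ^+ 2)%:C *: u2.
  have E (phi : {starhom F1 -> F2}) : phi u1 = u2 ->
      u2 = \sum_k phi (X k) ** star (phi (X k)).
    move=> <-; rewrite -X_unit linear_sum; apply: eq_bigr => k _ /=.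
    by rewrite starhomM starhom_star.
  rewrite rmorphD/= scalerDl {1}(E _ phi0u) (E _ phi1u) !scaler_sumr -big_split.
  apply: eq_bigr => k _ /=; rewrite starD !starZ !cr star_mulDr !star_mulDl.
  rewrite !star_mulZl !star_mulZr !scalerA lr rl !scale0r addr0 add0r.
  by rewrite -!rmorphM/= -!expr2.
have Yw (x : R) : \sum_k (x%:C *: Y k) ** star (x%:C *: Y k) = (x ^+ 2)%:C *: u2.
  rewrite -Y_unit scaler_sumr; apply: eq_bigr => k _.
  by rewrite starZ cr star_mulZl star_mulZr scalerA -rmorphM -expr2.
rewrite !Yw -!scalerDl -!rmorphD/= addrA weights_unit//.
by rewrite scale1r.
Qed.

(** Independent of [n] and [d], so that these can be chosen after it. *)
Definition intertwiner_bound : R :=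
  \sum_k (rnorm (phi0 (X k)) + rnorm (phi1 (X k))) + (\sum_k rnorm (Y k)) *+ 2.

Lemma intertwiner_le t : \sum_q rnorm (intertwiner t q) <= intertwiner_bound.
Proof.
have [l1 r1 f1 s1] := weights_le1 d0 d8 t.
have Z (F : finCStarAlgType R) (x : R) (b : F) : `|x| <= 1 -> rnorm (x%:C *: b) <= rnorm b.
  by move=> x1; rewrite rnormZr ler_piMl ?rnorm_ge0.
rewrite /intertwiner_bound !big_sumType/= mulr2n; apply: lerD; last apply: lerD.
- apply: ler_sum => k _; rewrite (le_trans (ler_rnormD _ _))// lerD//; exact: Z.
- by apply: ler_sum => k _; exact: Z.
- by apply: ler_sum => k _; exact: Z.
Qed.


Lemma fold_time0 : fold_time d 0 = 0.
Proof. by rewrite fold_time_start// ltW. Qed.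

Lemma fold_time1 : fold_time d 1 = 0.
Proof. by rewrite fold_time_end// lerBlDr lerDl ltW. Qed.

Lemma slow_hom : exists gam : {starhom A -> A}, forall f,
  (forall t : unit_itv R, (nccw_val (gam f)).1 t = nccw_at f (slow_time d (set_val t))) /\
  (nccw_val (gam f)).2 = (nccw_val f).2.
Proof.
have /choice[g gE] : forall f, exists x : A,
    (forall t : unit_itv R, (nccw_val x).1 t = nccw_at f (slow_time d (set_val t))) /\
    (nccw_val x).2 = (nccw_val f).2.
  move=> f; apply: (@nccw_path _ _ _ phi0 phi1 (fun s => nccw_at f (slow_time d s))).
  - move=> s; apply: (@continuous_comp _ _ _ (slow_time d)).
      exact: slow_time_continuous.
    exact: nccw_at_continuous.
  - rewrite slow_time_first// ?fold_time0 ?nccw_at0//; lra.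
  - rewrite slow_time_second// ?fold_time1 ?subr0 ?nccw_at1//; lra.
have [|||gam gamE] := @starhomP _ A A g.
- move=> c x y; apply: nccw_eq => [t|].
    by rewrite [LHS](gE _).1 /nccw_at !nccw_fun_lin !(gE _).1.
  by rewrite [LHS](gE _).2 !nccw_pt_lin !(gE _).2.
- move=> x y; apply: nccw_eq => [t|] /=; last by rewrite !(gE _).2.
  by rewrite !(gE _).1.
- move=> x; apply: nccw_eq => [t|] /=; last by rewrite !(gE _).2.
  by rewrite !(gE _).1.
by exists gam => f; rewrite gamE.
Qed.

Lemma stack_hom : exists kap : A -> S -> S -> A, forall f a b,
  (forall t : unit_itv R,
    (nccw_val (kap f a b)).1 t = stack_rep (fold_time d (set_val t)) f a b *: u2) /\
  (nccw_val (kap f a b)).2 = stack_rep 0 f a b *: u1.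
Proof.
have H (z : A * S * S) : exists x : A,
    (forall t : unit_itv R,
      (nccw_val x).1 t = stack_rep (fold_time d (set_val t)) z.1.1 z.1.2 z.2 *: u2) /\
    (nccw_val x).2 = stack_rep 0 z.1.1 z.1.2 z.2 *: u1.
  case: z => [[f a] b] /=.
  have [||x [x1 x2]] := @nccw_scalar R F1 F2 phi0 phi1 u1 u2 phi0u phi1u
      (fun s => stack_rep (fold_time d s) f a b).
  - move=> s; rewrite /stack_rep; apply: (@cvgZ _ R[i]^o); first exact: cvg_cst.
    apply: (@continuous_comp _ _ _ (fun s => stair_pos n (fold_time d s) a.1)
      (fun s => path_rep s f a.2 b.2 : R[i]^o)); last exact: path_rep_continuous.
    rewrite /stair_pos; case: eqP => _; last exact: cvg_cst.
    exact: fold_time_continuous.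
  - by rewrite fold_time0 fold_time1.
  by exists x; split=> //; rewrite x2 fold_time0.
have /choice[k kE] := H.
by exists (fun f a b => k (f, a, b)) => f a b; exact: (kE (f, a, b)).
Qed.

Lemma rotation_matrix : exists W : S -> S -> A, forall a b,
  (forall t : unit_itv R, (nccw_val (W a b)).1 t =
    ((a.2 == b.2)%:R * (stair n (fold_time d (set_val t)) a.1 b.1)%:C) *: u2) /\
  (nccw_val (W a b)).2 = (a == b)%:R *: u1.
Proof.
have H (z : S * S) : exists x : A,
    (forall t : unit_itv R, (nccw_val x).1 t =
      ((z.1.2 == z.2.2)%:R * (stair n (fold_time d (set_val t)) z.1.1 z.2.1)%:C) *: u2) /\
    (nccw_val x).2 = (z.1 == z.2)%:R *: u1.
  case: z => [a b] /=.
  have [||x [x1 x2]] := @nccw_scalar R F1 F2 phi0 phi1 u1 u2 phi0u phi1u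
      (fun s => (a.2 == b.2)%:R * (stair n (fold_time d s) a.1 b.1)%:C).
  - move=> s; apply: (@cvgZ _ R[i]^o); first exact: cvg_cst.
    apply: (@real_complex_continuous _ (fun s => stair n (fold_time d s) a.1 b.1)).
    move=> {}s; apply: (@continuous_comp _ _ _ (fold_time d) (fun v => stair n v a.1 b.1)).
      exact: fold_time_continuous.
    exact: stair_continuous.
  - by rewrite fold_time0 fold_time1.
  exists x; split=> //; rewrite x2 fold_time0 stair_start.
  case: a b {x1 x2} => [i q] [j r] /=; rewrite xpair_eqE.
  by rewrite rmorph_nat -natrM mulnb andbC.
have /choice[w wE] := H.
by exists (fun a b => w (a, b)) => a b; exact: (wE (a, b)).
Qed.

Lemma intertwiner_row : exists om : S -> A, forall a,
  (forall t : unit_itv R,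
    (nccw_val (om a)).1 t = (a.1 == ord0)%:R *: intertwiner (set_val t) a.2) /\
  (nccw_val (om a)).2 = (a.1 == ord0)%:R *: end_intertwiner a.2.
Proof.
suff /choice[om omE] : forall a : S, exists x : A,
    (forall t : unit_itv R,
      (nccw_val x).1 t = (a.1 == ord0)%:R *: intertwiner (set_val t) a.2) /\
    (nccw_val x).2 = (a.1 == ord0)%:R *: end_intertwiner a.2 by exists om.
have [l0 r0 f0 s0] := weights_start d0 d8.
have [l1 r1 f1 s1] := weights_end d0 d8.
move=> [i q];
  apply: (@nccw_path _ _ _ phi0 phi1 (fun s => (i == ord0)%:R *: intertwiner s q)) => /=.
- move=> s; apply: (@cvgZ _ F2 _ _ _ _ _ _ _ (cvg_cst _)).
  have cst (b : F2) : continuous (fun _ : R => b) by move=> ?; exact: cvg_cst.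
  case: q => [k|[k|k]] /=.
  + by apply: cvgD; apply: rscale_continuous => //;
      [exact: left_bump_continuous|exact: right_bump_continuous].
  + by apply: rscale_continuous => //; exact: first_weight_continuous.
  + by apply: rscale_continuous => //; exact: second_weight_continuous.
- rewrite linearZ/=; congr (_ *: _); case: q => [k|[k|k]] /=.
  + by rewrite l0 r0 scale1r scale0r addr0.
  + by rewrite f0 scale0r linear0.
  + by rewrite s0 scale0r linear0.
- rewrite linearZ/=; congr (_ *: _); case: q => [k|[k|k]] /=.
  + by rewrite l1 r1 scale1r scale0r add0r.
  + by rewrite f1 scale0r linear0.
  + by rewrite s1 scale0r linear0.
Qed.


Lemma sum_row0 (V : lmodType R[i]) (G : S -> V) :
  \sum_(b : S) (b.1 == ord0)%:R *: G b = \sum_q G (ord0, q).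
Proof.
rewrite sum_prodE (bigD1 ord0)//= [X in _ + X]big1 ?addr0 => [|i /negbTE->].
  by apply: eq_bigr => q _; rewrite scale1r.
by apply: big1 => q _; rewrite scale0r.
Qed.

Definition rotation v (a b : S) : R[i] := (a.2 == b.2)%:R * (stair n v a.1 b.1)%:C.

Lemma sum_rotation v (a : S) (G : S -> R[i]) :
  \sum_(m : S) rotation v a m * G m = \sum_(k < n.+1) (stair n v a.1 k)%:C * G (k, a.2).
Proof.
rewrite sum_prodE; apply: eq_bigr => k _;
  rewrite /rotation/= (bigD1 a.2)//= eqxx mul1r big1 ?addr0// => q qa.
by rewrite eq_sym (negbTE qa) !mul0r.
Qed.

Lemma rotation_orthogonal v (a b : S) : 0 <= v <= 1 ->
  \sum_c rotation v c a * rotation v c b = (a == b)%:R.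
Proof.
move=> v01; case: a b => [i q] [j r].
rewrite sum_prodE /rotation exchange_big/=.
rewrite (bigD1 q)//= [X in _ + X]big1 ?addr0 => [|x /negbTE xq]; last first.
  by apply: big1 => k _; rewrite xq !mul0r.
transitivity ((q == r)%:R * (\sum_(k < n.+1) stair n v k i * stair n v k j)%:C : R[i]).
  rewrite rmorph_sum mulr_sumr; apply: eq_bigr => k _.
  by rewrite eqxx mul1r mulrCA rmorphM.
have [_ ->] := stair_orthogonal v01 i j.
by rewrite rmorph_nat -natrM mulnb xpair_eqE andbC.
Qed.

(** Orthonormality of the rows of [stair] lets the diagonal block of [stack_rep] be written as a sum
    over the same grid index [m] as the conjugate; the difference is then taken term by term. *)
Lemma stack_difference v f (a b : S) : 0 <= v <= 1 ->
  stack_rep v f a b -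
    \sum_k \sum_l stack_rep 0 f k l * (rotation v a k * rotation v b l) =
  \sum_(m < n.+1) (stair n v a.1 m * stair n v b.1 m)%:C *
    (path_rep (stair_pos n v a.1) f a.2 b.2 - path_rep (stair_pos n 0 m) f a.2 b.2).
Proof.
move=> v01; under [RHS]eq_bigr do rewrite mulrBr.
rewrite sumrB -mulr_suml -rmorph_sum/=.
have [-> _] := stair_orthogonal v01 a.1 b.1; rewrite rmorph_nat; congr (_ - _).
transitivity (\sum_(k : S) rotation v a k * \sum_(l : S) rotation v b l * stack_rep 0 f k l).
  apply: eq_bigr => k _; rewrite mulr_sumr; apply: eq_bigr => l _.
  by rewrite mulrC -!mulrA.
rewrite sum_rotation; apply: eq_bigr => k _; rewrite sum_rotation.
rewrite (bigD1 k)//= big1 ?addr0 => [|l /negbTE lk].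
  by rewrite /stack_rep/= eqxx mul1r rmorphM mulrA.
by rewrite /stack_rep/= eq_sym lk mul0r mulr0.
Qed.

Definition difference_bound v (e : R) (a b : S) : R :=
  \sum_(m < n.+1) `|stair n v a.1 m| * `|stair n v b.1 m| * e.

(** The 16 is the product of a row sum and a column sum of [stair]; the cardinal counts the
    components in [Q] of [b], which the summand ignores. *)
Lemma difference_bound_sum v e (a : S) : 0 <= v <= 1 -> 0 <= e ->
  \sum_b difference_bound v e a b <= 16 * #|{: Q}|%:R * e.
Proof.
move=> v01 e0; rewrite /difference_bound.
rewrite sum_prodE/=.
under eq_bigr do rewrite sumr_const -mulr_natl.
rewrite -mulr_sumr exchange_big/= mulrAC (mulrC _ #|_|%:R) ler_wpM2l//.
under eq_bigr do rewrite -mulr_suml -mulr_sumr.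
rewrite -mulr_suml ler_wpM2r//.
apply: (@le_trans _ _ (\sum_(m < n.+1) `|stair n v a.1 m| * 4)).
  apply: ler_sum => m _; rewrite ler_wpM2l//.
  by have [] := stair_bounds v01 m m.
rewrite -mulr_suml; have [h _] := stair_bounds v01 a.1 a.1.
by apply: (le_trans (ler_wpM2r _ h)) => //; lra.
Qed.

Lemma stack_difference_le v f e (a b : S) : 0 <= v <= 1 ->
  (forall s t, 0 <= s <= 1 -> 0 <= t <= 1 -> `|s - t| <= n%:R^-1 -> forall q r,
    rnorm (path_rep s f q r - path_rep t f q r : R[i]^o) <= e) ->
  rnorm (stack_rep v f a b - \sum_k \sum_l stack_rep 0 f k l *
    (rotation v a k * rotation v b l) : R[i]^o) <= difference_bound v e a b.
Proof.
move=> v01 fe; rewrite stack_difference//.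
apply: (le_trans (ler_rnorm_sum (V := R[i]^o) _)); apply: ler_sum => m _.
rewrite (rnormZr (V := R[i]^o)) normrM.
(* Where the entry is nonzero, [stair_local] puts the two evaluations within [1/n]. *)
have [->|w0] := eqVneq (stair n v a.1 m) 0; first by rewrite normr0 !mul0r.
rewrite ler_wpM2l ?mulr_ge0//; apply: fe.
- rewrite /stair_pos; case: eqP => // _; rewrite divr_ge0//= ler_pdivrMr ?ltr0n//.
  by rewrite mul1r ler_nat -ltnS.
- rewrite /stair_pos; case: eqP => // _; first by rewrite lexx ler01.
  by rewrite divr_ge0//= ler_pdivrMr ?ltr0n// mul1r ler_nat -ltnS.
- have -> : stair_pos n 0 m = m%:R / n%:R :> R.
    by rewrite /stair_pos; case: eqP => // ->; rewrite mul0r.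
  exact: stair_local.
Qed.


(** The error [e1] comes from slowing time and [e2] from the mesh. The constant [M] bounds row and
    column sums of the dilating isometry: the row [om] contributes [B = intertwiner_bound] and $1 -
    om^* om$ contributes $1 + B^2$. *)
Lemma approximate_factorization (F : set A) (e1 e2 : R) : 0 <= e1 -> 0 <= e2 ->
  (forall f, F f -> forall s t, 0 <= s <= 1 -> 0 <= t <= 1 -> `|s - t| <= 2 * d ->
    rnorm (nccw_at f s - nccw_at f t) <= e1) ->
  (forall f, F f -> forall s t, 0 <= s <= 1 -> 0 <= t <= 1 -> `|s - t| <= n%:R^-1 ->
    forall q r, rnorm (path_rep s f q r - path_rep t f q r : R[i]^o) <= e2) ->
  let M := 1 + intertwiner_bound + intertwiner_bound ^+ 2 in
  exists (m : nat) (rho : {starhom A -> matrix_alg A m})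
    (mu : {starhom A -> matrix_alg A m.+1}), finite_dim (range mu) /\
  forall f, F f -> (matrix_norm (block_diag f (rho f) - mu f)%R <=
    (e1 + M * (16 * #|{: Q}|%:R * e2) * M)%:E)%E.
Proof.
move=> e10 e20 Fe1 Fe2 M.
have [|//|e [ef ept]] := @nccw_scalar R F1 F2 phi0 phi1 u1 u2 phi0u phi1u (fun=> 1).
  by move=> s; exact: cvg_cst.
have eP (x : A) : e ** x = x /\ x ** e = x.
  split; apply: nccw_eq => [t|] /=;
    by rewrite ?ef ?ept scale1r ?(u1P _).1 ?(u1P _).2 ?(u2P _).1 ?(u2P _).2.
have [gam gamE] := slow_hom.
have [kap kapE] := stack_hom.
have [W WE] := rotation_matrix.
have [om omE] := intertwiner_row.
have fold01 t : 0 <= fold_time d t <= 1.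
  by have := fold_time_itv d0 d8 t; lra.
have stackM v : scalar_rep (stack_rep v) := stack_rep_scalar_rep v.
have u11 : u1 ** u1 = u1 by rewrite (u1P _).1.
have u22 : u2 ** u2 = u2 by rewrite (u2P _).1.
have su1 : star u1 = u1 by exact: star_unit.
have su2 : star u2 = u2 by exact: star_unit.
have kap_rep : matrix_rep kap.
  split.
  - move=> c f g a b; apply: nccw_eq => [t|].
      rewrite nccw_fun_lin !(kapE _ _ _).1; have [-> _ _] := stackM (fold_time d (set_val t)).
      by rewrite scalerDl scalerA.
    rewrite nccw_pt_lin !(kapE _ _ _).2; have [-> _ _] := stackM 0.
    by rewrite scalerDl scalerA.
  - move=> f g a b; apply: nccw_eq => [t|].
      rewrite nccw_fun_sum (kapE _ _ _).1; have [_ -> _] := stackM (fold_time d (set_val t)).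
      rewrite scaler_suml; apply: eq_bigr => c _ /=.
      by rewrite !(kapE _ _ _).1 star_mulZl star_mulZr u22 scalerA.
    rewrite nccw_pt_sum (kapE _ _ _).2; have [_ -> _] := stackM 0.
    rewrite scaler_suml; apply: eq_bigr => c _ /=.
    by rewrite !(kapE _ _ _).2 star_mulZl star_mulZr u11 scalerA.
  - move=> f a b; apply: nccw_eq => [t|] /=.
      rewrite !(kapE _ _ _).1; have [_ _ ->] := stackM (fold_time d (set_val t)).
      by rewrite starZ su2.
    by rewrite !(kapE _ _ _).2; have [_ _ ->] := stackM 0; rewrite starZ su1.
have om_kap f a : gam f ** om a = \sum_b om b ** kap f b a.
  apply: nccw_eq => [t|].
    rewrite nccw_fun_sum /= (gamE _).1 (omE _).1 star_mulZr intertwinerP.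
    transitivity (\sum_(b : S) (b.1 == ord0)%:R *:
        (stack_rep (fold_time d (set_val t)) f b a *:
        intertwiner (set_val t) b.2)); last first.
      apply: eq_bigr => b _; rewrite (omE _).1 (kapE _ _ _).1 star_mulZl star_mulZr.
      by rewrite (u2P _).2.
    rewrite sum_row0 scaler_sumr; apply: eq_bigr => q _.
    by rewrite /stack_rep /stair_pos/= eq_sym scalerA.
  rewrite nccw_pt_sum /= (gamE _).2 (omE _).2 star_mulZr.
  transitivity (\sum_(b : S) (b.1 == ord0)%:R *: (stack_rep 0 f b a *:
      end_intertwiner b.2)); last first.
    apply: eq_bigr => b _; rewrite (omE _).2 (kapE _ _ _).2 star_mulZl star_mulZr.
    by rewrite (u1P _).2.
  rewrite sum_row0 big_sumType/= [X in _ + X]big1 ?addr0; last first.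
    by move=> q _; rewrite scaler0.
  case: a => i [k|k]; rewrite /stack_rep/=.
    rewrite X_tau scaler_sumr; apply: eq_bigr => l _.
    by rewrite eq_sym scalerA.
  by rewrite star_mul0r scaler0 big1// => l _; rewrite mulr0 scale0r.
have om_unit : \sum_a om a ** star (om a) = e.
  apply: nccw_eq => [t|].
    rewrite nccw_fun_sum /= ef scale1r -(intertwiner_unit (set_val t)).
    rewrite -(sum_row0 (fun a =>
      intertwiner (set_val t) a.2 ** star (intertwiner (set_val t) a.2))).
    apply: eq_bigr => a _; rewrite (omE _).1 starZ conjC_nat star_mulZl star_mulZr.
    by rewrite scalerA -natrM mulnb andbb.
  rewrite nccw_pt_sum /= ept scale1r -X_unit.
  transitivity (\sum_(q : Q) end_intertwiner q ** star (end_intertwiner q)); last first.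
    by rewrite big_sumType/= [X in _ + X]big1 ?addr0// => q _; rewrite star_mul0l.
  rewrite -(sum_row0 (fun a => end_intertwiner a.2 ** star (end_intertwiner a.2))).
  apply: eq_bigr => a _; rewrite (omE _).2 starZ conjC_nat star_mulZl star_mulZr.
  by rewrite scalerA -natrM mulnb andbb.
have rot_conj v a b : Num.conj (rotation v a b) = rotation v a b.
  by rewrite rmorphM/= conjC_nat; congr (_ * _); apply/CrealP; rewrite complex_real.
have WE1 (t : unit_itv R) a b :
    (nccw_val (W a b)).1 t = rotation (fold_time d (set_val t)) a b *: u2.
  exact: (WE a b).1.
have W_unitary a b : \sum_k star (W k a) ** W k b = (a == b)%:R *: e.
  apply: nccw_eq => [t|].
    rewrite nccw_fun_sum nccw_valZ /= fctE ef scale1r.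
    rewrite -(rotation_orthogonal a b (fold01 (set_val t))).
    rewrite scaler_suml; apply: eq_bigr => k _ /=; rewrite !WE1 starZ rot_conj su2.
    by rewrite star_mulZl star_mulZr u22 scalerA.
  rewrite nccw_pt_sum nccw_valZ /= ept scale1r (bigD1 a)//= big1 ?addr0.
    by rewrite !(WE _ _).2 eqxx scale1r su1 star_mulZr u11.
  by move=> k /negbTE ka; rewrite !(WE _ _).2 ka scale0r star0 star_mul0l.
have [rho rhoE] := complement_hom eP kap_rep om_kap om_unit.
have [mu [mufin muE]] := finite_dim_hom eP om_unit (stackM 0) W_unitary.
exists #|{: S}|, rho, mu; split=> // f Ff.
pose D k l := kap f k l - \sum_m \sum_n stack_rep 0 f m n *: (W k m ** star (W l n)).
have entryE (i j : 'I_(1 + #|{: S}|)) : (block_diag f (rho f) - mu f)%R i j =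
  (if (block_index i, block_index j) is (inl _, inl _) then f - gam f else 0) +
  \sum_k \sum_l dilation_entry e om (block_index i) k ** D k l **
    star (dilation_entry e om (block_index j) l).
  rewrite -(block_diag_sub_conjugate eP kap_rep om_kap om_unit (stack_rep 0) W
    i j (rhoE f)).
  by rewrite !mxE muE.
pose B := intertwiner_bound.
have B0 : 0 <= B.
  rewrite /B /intertwiner_bound addr_ge0 ?mulrn_wge0// sumr_ge0// => k _.
    by rewrite addr_ge0 ?rnorm_ge0.
  exact: rnorm_ge0.
have M0 : 0 <= M by exact: (addr_ge0 (addr_ge0 ler01 B0) (exprn_ge0 2 B0)).
have r0 : 0 <= 16 * #|{: Q}|%:R * e2 by rewrite !mulr_ge0.
have tot0 : 0 <= e1 + M * (16 * #|{: Q}|%:R * e2) * M.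
  by rewrite addr_ge0// !mulr_ge0.
have sumO (H : unit + S -> R) : \sum_i H (block_index i) = \sum_o H o.
  by rewrite sum_block_index big_sumType/= (big_pred1 tt)//; case.
(* In [F1] there is no error: [gam f] has the component of [f], and [W] is the identity while [kap]
   is [stack_rep 0]. *)
have pt0 i j : (nccw_val ((block_diag f (rho f) - mu f)%R i j)).2 = 0.
  have D0 k l : (nccw_val (D k l)).2 = 0.
    rewrite nccw_valB/= nccw_pt_sum (kapE _ _ _).2 (bigD1 k)//= nccw_pt_sum.
    rewrite [X in _ - (_ + X)]big1 ?addr0 => [|k' /negbTE kk']; last first.
      rewrite nccw_pt_sum big1// => l' _.
      by rewrite nccw_valZ/= (WE _ _).2 eq_sym kk' scale0r star_mul0l scaler0.
    rewrite (bigD1 l)//= [X in _ - (_ + X)]big1 ?addr0 => [|l' /negbTE ll'].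
      rewrite !(WE _ _).2 !eqxx !scale1r su1 u11 subrr//.
    by rewrite !(WE _ _).2 [l == _]eq_sym ll' scale0r star0 star_mul0r scaler0.
  rewrite entryE nccw_valD/= nccw_pt_sum [X in _ + X]big1 ?addr0; last first.
    move=> k _; rewrite nccw_pt_sum big1// => l _.
    transitivity ((nccw_val (dilation_entry e om (block_index i) k)).2 **
      (nccw_val (D k l)).2 **
      (nccw_val (star (dilation_entry e om (block_index j) l))).2); first by [].
    by rewrite D0 star_mul0r star_mul0l.
  have z0 : (nccw_val (0 : A)).2 = 0.
    by rewrite -(subrr (0 : A)) nccw_valB/= subrr.
  case: (block_index i) => [[]|?]; case: (block_index j) => [[]|?] //=.
  by rewrite (gamE f).2 subrr.
pose a (t : unit_itv R) o k := rnorm ((nccw_val (dilation_entry e om o k)).1 t).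
pose b (t : unit_itv R) := difference_bound (fold_time d (set_val t)) e2.
(* [G] dominates the norms of the entries at [t]; being symmetric, it needs a bound on row sums
   only. *)
pose G (t : unit_itv R) (o o' : unit + S) : R :=
  (if (o, o') is (inl _, inl _) then e1 else 0) +
  \sum_k \sum_l a t o k * b t k l * a t o' l.
have a0 (t : unit_itv R) o k : 0 <= a t o k by exact: rnorm_ge0.
have b0 (t : unit_itv R) k l : 0 <= b t k l by rewrite sumr_ge0// => m _; rewrite !mulr_ge0.
have nu2 := rnorm_unit_le1 u2P.
have D_le (t : unit_itv R) k l : rnorm ((nccw_val (D k l)).1 t) <= b t k l.
  have -> : (nccw_val (D k l)).1 t = (stack_rep (fold_time d (set_val t)) f k l -
      \sum_m \sum_n stack_rep 0 f m n * (rotation (fold_time d (set_val t)) k m *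
        rotation (fold_time d (set_val t)) l n)) *: u2.
    rewrite nccw_fun_sub (kapE _ _ _).1 nccw_fun_sum scalerBl; congr (_ - _).
    rewrite scaler_suml; apply: eq_bigr => m _; rewrite nccw_fun_sum scaler_suml.
    apply: eq_bigr => m' _; rewrite nccw_fun_scale /= !WE1 starZ rot_conj su2.
    by rewrite star_mulZl star_mulZr u22 !scalerA.
  rewrite rnormZ -[leRHS]mulr1 ler_pM ?rnorm_ge0//; last first.
    by apply: stack_difference_le => //; exact: Fe2.
  exact: (@rnorm_ge0 R R[i]^o).
have fun_le (t : unit_itv R) i j :
    rnorm ((nccw_val ((block_diag f (rho f) - mu f)%R i j)).1 t) <=
    G t (block_index i) (block_index j).
  rewrite entryE nccw_valD/= (le_trans (ler_rnormD _ _))// lerD//; last first.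
    rewrite nccw_fun_sum (le_trans (ler_rnorm_sum _))// ler_sum// => k _.
    rewrite nccw_fun_sum (le_trans (ler_rnorm_sum _))// ler_sum// => l _.
    rewrite (_ : _.1 t = (nccw_val (dilation_entry e om (block_index i) k)).1 t **
      (nccw_val (D k l)).1 t **
      star ((nccw_val (dilation_entry e om (block_index j) l)).1 t))//.
    rewrite (le_trans (ler_rnorm_mul _ _))// rnorm_star ler_wpM2r ?rnorm_ge0//.
    rewrite (le_trans (ler_rnorm_mul _ _))// ler_wpM2l ?rnorm_ge0//. exact: D_le.
  have z0 : rnorm ((nccw_val (0 : A)).1 t) <= 0.
    by rewrite -(subrr (0 : A)) nccw_fun_sub subrr rnorm0.
  case: (block_index i) => [[]|?]; case: (block_index j) => [[]|?] //=.
  rewrite [X in rnorm X](_ : _ = nccw_at f (set_val t) -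
      nccw_at f (slow_time d (set_val t))); last first.
    by rewrite -(gamE f).1 /nccw_at itv_clampK.
  apply: Fe1 => //; [exact: unit_itv_bounds|exact: slow_time_itv|].
  by rewrite distrC slow_time_close// unit_itv_bounds.
have om_le (t : unit_itv R) : \sum_k rnorm ((nccw_val (om k)).1 t) <= B.
  apply: le_trans (intertwiner_le (set_val t)); rewrite le_eqVlt; apply/orP; left.
  rewrite sum_prodE (bigD1 ord0)//= [X in _ + X]big1 ?addr0 => [|i /negbTE i0].
    by apply/eqP; apply: eq_bigr => q _; rewrite (omE _).1 scale1r.
  by apply: big1 => q _; rewrite (omE _).1 i0 scale0r rnorm0.
have om_le1 (t : unit_itv R) k : rnorm ((nccw_val (om k)).1 t) <= B.
  apply: le_trans (om_le t); rewrite (bigD1 k)//= lerDl sumr_ge0// => l _.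
  exact: rnorm_ge0.
have a_le (t : unit_itv R) k l : a t (inr k) l <= (k == l)%:R +
    rnorm ((nccw_val (om k)).1 t) * rnorm ((nccw_val (om l)).1 t).
  rewrite /a /dilation_entry nccw_fun_sub nccw_fun_scale.
  rewrite (le_trans (ler_rnormD _ _))// rnormN lerD//.
    rewrite ef scale1r -[_%:R](rmorph_nat (real_complex R)) rnormZr.
    by rewrite ger0_norm// ler_piMr.
  by rewrite (le_trans (ler_rnorm_mul _ _))// rnorm_star.
have sum_delta (k : S) : \sum_l (k == l)%:R <= 1 :> R.
  rewrite (bigD1 k)//= eqxx big1 ?addr0// => l /negbTE.
  by rewrite eq_sym => ->.
have a_row (t : unit_itv R) o : \sum_k a t o k <= M.
  case: o => [[]|k].
    by rewrite (le_trans (om_le t))// /M -/B addrAC lerDr addr_ge0// exprn_ge0.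
  apply: le_trans (ler_sum _ (fun l _ => a_le t k l)) _.
  rewrite big_split/= -mulr_sumr /M expr2 -addrA lerD// (le_trans (_ : _ <= B * B))//.
    by rewrite ler_pM ?rnorm_ge0 ?sumr_ge0// => l _; exact: rnorm_ge0.
  by rewrite lerDr.
have a_col (t : unit_itv R) k : \sum_o a t o k <= M.
  rewrite big_sumType (big_pred1 tt); last by case.
  rewrite /M -/B -addrA (addrCA 1) lerD//; first exact: om_le1.
  apply: le_trans (ler_sum _ (fun l _ => a_le t l k)) _.
  rewrite big_split/= -mulr_suml expr2 lerD//.
    by under eq_bigr do rewrite eq_sym.
  by rewrite ler_pM ?rnorm_ge0 ?sumr_ge0// => l _; exact: rnorm_ge0.
have G_row (t : unit_itv R) o : \sum_o' G t o o' <= e1 + M * (16 * #|{: Q}|%:R * e2) * M.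
  rewrite big_split/= lerD//; last first.
    by apply: triple_row_sum => // k; exact: difference_bound_sum.
  rewrite big_sumType/= (big_pred1 tt)/=; last by case.
  by case: o => [[]|k]; rewrite big1 ?addr0.
have G_sym (t : unit_itv R) o o' : G t o o' = G t o' o.
  rewrite /G; congr (_ + _); first by case: o => ?; case: o' => ?.
  rewrite exchange_big/=; apply: eq_bigr => l _; apply: eq_bigr => k _.
  rewrite mulrC [a t o k * _]mulrC mulrA; congr (_ * _ * _); rewrite /b /difference_bound.
  by apply: eq_bigr => m _; rewrite [X in X * _]mulrC.
apply: (matrix_norm_le u1P u2P) => //.
- move=> t i; apply: le_trans (G_row t (block_index i)); rewrite -sumO.
  by apply: ler_sum => j _; exact: fun_le.
- move=> t j; apply: le_trans (G_row t (block_index j)); rewrite -sumO.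
  by apply: ler_sum => i _; rewrite G_sym; exact: fun_le.
- by move=> i; rewrite big1// => j _; rewrite pt0 rnorm0.
- by move=> j; rewrite big1// => i _; rewrite pt0 rnorm0.
Qed.


End Main.

(** * Choice of the time scale and of the mesh *)

Lemma near_all_seq (R : realType) (I : eqType) (l : seq I) (P : I -> R -> Prop) :
  (forall x, x \in l -> \forall d \near 0^'+, P x d) ->
  \forall d \near 0^'+, forall x, x \in l -> P x d.
Proof.
elim: l => [|x l IH] Pl; first by apply: nearW => d x.
have Px : \forall d \near 0^'+, P x d by apply: Pl; rewrite mem_head.
have Pl' : \forall d \near 0^'+, forall y, y \in l -> P y d.
  by apply: IH => y yl; apply: Pl; rewrite in_cons yl orbT.
apply: filterS2 Px Pl' => d Px Pl' y; rewrite in_cons => /orP[/eqP->//|].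
exact: Pl'.
Qed.

Lemma near_uniform_continuity (R : realType) (V : normedModType R[i]) (G : R -> V)
    (e : R) : continuous G -> 0 < e -> \forall d \near 0^'+, forall s t,
  0 <= s <= 1 -> 0 <= t <= 1 -> `|s - t| <= d -> rnorm (G s - G t) <= e.
Proof.
move=> cG e0; have [h h0 hP] := itv_uniform_continuity cG e0.
have lth : \forall d \near (0 : R)^'+, d < h by exact: nbhs_right_lt.
apply: filterS lth => d dh s t s01 _ st.
by apply/ltW/hP => //; exact: le_lt_trans dh.
Qed.

Theorem theorem4p8 (R : realType) (F1 F2 : finCStarAlgType R)
    (phi0 phi1 : {starhom F1 -> F2}) (A_unital : unital (nccw phi0 phi1)) :
  property_H (nccw phi0 phi1).
Proof.
move=> F eps finF eps0.
have [u1 [u2 [u1P u2P phi0u phi1u]]] := nccw_units A_unital.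
have [T [X [tau [tau_rep X_tau X_unit]]]] := scalar_dilation u1P.
have [K [Y [sig [sig_rep Y_sig Y_unit]]]] := scalar_dilation u2P.
pose M := 1 + intertwiner_bound phi0 phi1 X Y + intertwiner_bound phi0 phi1 X Y ^+ 2.
(* As [c] involves neither the mesh nor the time scale, [e2] can be fixed before both; the total
   error is then at most [eps / 2]. *)
pose c := M * (16 * #|{: T + (K + K)}|%:R) * M.
have c0 : 0 <= c.
  by rewrite /c mulrAC -expr2 mulr_ge0 ?sqr_ge0// mulr_ge0.
pose e1 := eps / 4; pose e2 := eps / 4 / (c + 1).
have e10 : 0 < e1 by rewrite divr_gt0.
have e20 : 0 < e2 by rewrite divr_gt0// ltr_wpDl.
have e12 : e1 + M * (16 * #|{: T + (K + K)}|%:R * e2) * M < eps.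
  have -> : M * (16 * #|{: T + (K + K)}|%:R * e2) * M = c * e2 by rewrite /c; ring.
  have : c * e2 <= eps / 4.
    rewrite /e2 mulrA ler_pdivrMr ?ltr_wpDl// mulrC.
    by rewrite ler_wpM2l ?lerDl// ltW.
  by rewrite /e1; clearbody c e2; move: eps0; lra.
pose path f s q r := @path_rep R F1 F2 phi0 phi1 T K tau sig s f q r.
pose P (f : nccw phi0 phi1) (d : R) := (forall s t, 0 <= s <= 1 -> 0 <= t <= 1 ->
    `|s - t| <= d -> rnorm (nccw_at f s - nccw_at f t) <= e1) /\
  (forall qr, qr \in enum {: (T + (K + K)) * (T + (K + K))} ->
    forall s t, 0 <= s <= 1 -> 0 <= t <= 1 ->
    `|s - t| <= d -> rnorm (path f s qr.1 qr.2 - path f t qr.1 qr.2 : R[i]^o) <= e2).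
have [l Fl] : exists l : seq (nccw phi0 phi1), F = [set` l] by exact/finite_seqP.
have near_P : \forall d \near (0 : R)^'+, forall f, f \in l -> P f d.
  apply: near_all_seq => f _.
  have N1 := near_uniform_continuity (@nccw_at_continuous R F1 F2 phi0 phi1 f) e10.
  have N2 : \forall d \near (0 : R)^'+, forall qr,
      qr \in enum {: (T + (K + K)) * (T + (K + K))} ->
      forall s t, 0 <= s <= 1 -> 0 <= t <= 1 -> `|s - t| <= d ->
      rnorm (path f s qr.1 qr.2 - path f t qr.1 qr.2 : R[i]^o) <= e2.
    apply: near_all_seq => qr _; apply: near_uniform_continuity => //.
    exact: path_rep_continuous.
  by apply: filterS2 N1 N2 => d h1 h2; split.
have near_gt0 : \forall d \near (0 : R)^'+, 0 < d by exact: nbhs_right_gt.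
have : \forall d \near (0 : R)^'+, (forall f, f \in l -> P f d) /\ 0 < d.
  by apply: filterS2 near_P near_gt0.
case/(@filter_ex R _ (at_right_proper_filter 0)) => d [dP d0].
(* The schedule requires [d' <= 1/8], and [2 d' <= d] keeps [slow_time] within the modulus [d]. *)
pose d' := Num.min 8^-1 (d / 2).
have d'0 : 0 < d' by rewrite lt_min invr_gt0 ltr0n divr_gt0.
have d'8 : d' <= 8^-1 by rewrite ge_min lexx.
have d'd : 2 * d' <= d.
  by rewrite mulrC -ler_pdivlMr// ge_min lexx orbT.
(* The successor makes [n] exceed [1/d], so that the mesh [1/n] is at most [d]. *)
pose n := (Num.truncn d^-1).+1.
have nd : (n%:R : R)^-1 <= d.
  rewrite -[leRHS]invrK lef_pV2 ?posrE ?invr_gt0 ?ltr0n//.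
  have := truncn_itv (ltW (_ : 0 < d^-1)); rewrite invr_gt0 => /(_ d0).
  by case/andP => _ /ltW.
have [||m [rho [mu [mufin H]]]] := @approximate_factorization R F1 F2 phi0 phi1
  u1 u2 u1P u2P phi0u phi1u T K X tau Y sig tau_rep sig_rep X_tau Y_sig X_unit
  Y_unit n d' isT d'0 d'8 F e1 e2 (ltW e10) (ltW e20).
- move=> f; rewrite Fl /= => fl s t s01 t01 st.
  have [h _] := dP f fl; apply: h => //; exact: le_trans st d'd.
- move=> f; rewrite Fl /= => fl s t s01 t01 st q r.
  have [_ h] := dP f fl; apply: (h (q, r)) => //; first by rewrite mem_enum.
  exact: le_trans st nd.
exists m, rho, mu; split => // f Ff.
by apply: le_lt_trans (H f Ff) _; rewrite lte_fin.
Qed.
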